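(* Let $n\ge 2$, $m\ge 1$ be integers, let $1<p<n$, let $p^{*}=\frac{np}{n-p}$, and let $\Omega\subset\mathbb{R}^n$ be open. Let $G:\Omega\times\mathbb{R}^m\times\mathbb{R}^{n\times m}\to\mathbb{R}$ be a Carathéodory function such that $$|G(x,s_1,\xi_1)-G(x,s_2,\xi_2)|\le a(x)\,|s_1-s_2|^{\alpha}\,(|\xi_1|+|\xi_2|+1)^{q_1}+b(x)\,(|s_1|+|s_2|+1)^{q_2}\,|\xi_1-\xi_2|^{\beta}$$ for $\mathcal{L}^n$-almost every $x\in\Omega$, every $s_1,s_2\in\mathbb{R}^m$ and every $\xi_1,\xi_2\in\mathbb{R}^{n\times m}$, where $q_1<p$, $q_2<p$, $0<\alpha<\min\{1,p-q_1\}$, $0<\beta<\min\{1,p-q_2\}$, $a\in L^{\sigma_1}_{loc}(\Omega)$ and $b\in L^{\sigma_2}_{loc}(\Omega)$ are non-negative functions, $$\sigma_1>\frac{pp^{*}}{(p^{*}-\alpha)p-q_1p^{*}},\qquad \sigma_2>\frac{pp^{*}}{(p-\beta)p^{*}-q_2p},$$ $$\frac{q_1}{p}+\frac{\alpha}{p^{*}}+\frac1{\sigma_1}<\frac pn\qquad\text{and}\qquad \frac{\beta}{p}+\frac{q_2}{p^{*}}+\frac1{\sigma_2}<\frac pn .$$ Let $u\in W^{1,p}(\Omega,\mathbb{R}^m)$ be a (local) minimizer of $$J(u,\Omega)=\int_\Omega \sum_{i=1}^{m}|\nabla u^{i}(x)|^p+G(x,u(x),\nabla u(x))\,dx .$$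 Then there is $\epsilon>0$ such that for every compact $\Sigma\subset\Omega$ there exist two positive constants $C_{Cac,1},C_{Cac,2}$, depending only on $\Sigma$, $p$ and $n$, and a radius $R_0>0$ such that for every $0<\varrho<R<R_0$, every $x_0\in\Sigma$, every $k\in\mathbb{R}$ and every $i=1,\dots,m$, $$\int_{A^{i}_{k,\varrho}}|\nabla u^{i}|^p\,dx\le\frac{C_{Cac,1}}{(R-\varrho)^p}\int_{A^{i}_{k,R}}(u^{i}-k)^p\,dx+C_{Cac,2}\,|A^{i}_{k,R}|^{1-\frac pn+\epsilon}$$ and $$\int_{B^{i}_{k,\varrho}}|\nabla u^{i}|^p\,dx\le\frac{C_{Cac,1}}{(R-\varrho)^p}\int_{B^{i}_{k,R}}(k-u^{i})^p\,dx+C_{Cac,2}\,|B^{i}_{k,R}|^{1-\frac pn+\epsilon},$$ where $A^{i}_{k,s}=\{u^{i}>k\}\cap B_s(x_0)$ and $B^{i}_{k,s}=\{u^{i}<k\}\cap B_s(x_0)$.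
   Context: $u=(u^1,\dots,u^m)$ with $u^i$ the components of $u$; $\mathcal{L}^n$ is Lebesgue measure on $\mathbb{R}^n$, $|E|$ is the Lebesgue measure of $E$, and $B_s(x_0)=\{x:|x-x_0|<s\}$. A function $u\in W^{1,p}(\Omega,\mathbb{R}^m)$ is a (local) minimizer of $J$ if $x\mapsto G(x,u(x),\nabla u(x))$ belongs to $L^1_{loc}(\Omega)$ and, for every $\varphi\in W^{1,p}(\Omega,\mathbb{R}^m)$ with compact support in $\Omega$, $J(u,\operatorname{supp}\varphi)\le J(u+\varphi,\operatorname{supp}\varphi)$, where $J(v,E)$ denotes the same integral taken over $E$. *)

(* Defs.v *)
From HB Require Import structures.
From mathcomp Require Import all_boot all_order all_algebra.
From mathcomp Require Import all_classical all_reals all_analysis.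

Set Implicit Arguments.
Unset Strict Implicit.
Unset Printing Implicit Defensive.
Import Order.TTheory GRing.Theory Num.Theory.
Import numFieldNormedType.Exports.

Local Open Scope classical_set_scope.
Local Open Scope ring_scope.

(* 'rV[R]_n is given the Borel sigma-algebra, as the sigma-algebra generated
   by the coordinates.  The Lebesgue sigma-algebra lives on the copy [Rn R n]
   of 'rV[R]_n below. *)
Section borel_rV.
Context {R : realType} (n : nat).

Let coord (i : 'I_n) (x : 'rV[R]_n) : R := x ord0 i.

Let rV_set0 : g_sigma_preimage coord set0.
Proof. exact: sigma_algebra0. Qed.

Let rV_setC A : g_sigma_preimage coord A -> g_sigma_preimage coord (~` A).
Proof. exact: sigma_algebraC. Qed.

Let rV_bigcup (F : _^nat) : (forall i, g_sigma_preimage coord (F i)) ->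
  g_sigma_preimage coord (\bigcup_i (F i)).
Proof. exact: sigma_algebra_bigcup. Qed.

HB.instance Definition _ := @isMeasurable.Build default_measure_display
  'rV[R]_n (g_sigma_preimage coord) rV_set0 rV_setC rV_bigcup.

Lemma measurable_rV_coord (i : 'I_n) :
  measurable_fun [set: 'rV[R]_n] (fun x => x ord0 i).
Proof.
move=> _ Y mY; rewrite setTI; apply: sub_sigma_algebra => /=.
rewrite -bigcup_seq/=; exists i => /=; first by rewrite mem_index_enum.
by exists Y => //; rewrite setTI.
Qed.

Lemma measurable_to_rV d (T : measurableType d) (f : T -> 'rV[R]_n) :
  (forall i, measurable_fun [set: T] (fun t => f t ord0 i)) ->
  measurable_fun [set: T] f.
Proof.
move=> mf _ Y mY; rewrite setTI.
pose S := [set B : set 'rV[R]_n | measurable (f @^-1` B)].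
suff: g_sigma_preimage coord `<=` S by apply.
apply: smallest_sub.
  split => [|A mA|F mF]; rewrite /S/=.
  - by rewrite preimage_set0.
  - by rewrite setTD preimage_setC; exact: measurableC.
  - by rewrite preimage_bigcup; exact: bigcupT_measurable.
rewrite -bigcup_seq => A [i _] [B mB <-] /=; rewrite /S/= setTI.
by have := mf i measurableT _ mB; rewrite setTI.
Qed.

End borel_rV.

Section rV_cons.
Context {R : realType} (n : nat).

Definition rV_cons (x : R * 'rV[R]_n) : 'rV[R]_n.+1 :=
  \row_j if unlift ord0 j is Some k then x.2 ord0 k else x.1.

Let rV_uncons (x : 'rV[R]_n.+1) : R * 'rV[R]_n :=
  (x ord0 ord0, \row_k x ord0 (lift ord0 k)).

Let rV_consK : cancel rV_cons rV_uncons.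
Proof.
move=> [a x]; rewrite /rV_cons /rV_uncons mxE unlift_none; congr pair.
by apply/rowP => k; rewrite !mxE liftK.
Qed.

Lemma measurable_rV_cons : measurable_fun [set: R * 'rV[R]_n] rV_cons.
Proof.
apply: measurable_to_rV => i.
have -> : (fun t => rV_cons t ord0 i) =
    fun t => if unlift ord0 i is Some k then t.2 ord0 k else t.1.
  by apply/funext => t; rewrite mxE.
case: (unlift ord0 i) => [k|]; last exact: measurable_fst.
exact: (measurableT_comp (measurable_rV_coord k) measurable_snd).
Qed.

Let measurable_rV_uncons : measurable_fun [set: 'rV[R]_n.+1] rV_uncons.
Proof.
apply: measurable_fun_pair; first exact: measurable_rV_coord.
apply: measurable_to_rV => i.
have := @measurable_rV_coord R _ (lift ord0 i).
by congr measurable_fun; apply/funext => t; rewrite mxE.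
Qed.

Local Open Scope ereal_scope.

Definition rV_prod (mu : {sigma_finite_measure set 'rV[R]_n -> \bar R}) :
    set 'rV[R]_n.+1 -> \bar R :=
  pushforward ((@lebesgue_measure R) \x mu) rV_cons.

Variable mu : {sigma_finite_measure set 'rV[R]_n -> \bar R}.

Let nu : set 'rV[R]_n.+1 -> \bar R := rV_prod mu.

Let nu0 : nu set0 = 0.
Proof. by rewrite /nu /rV_prod /pushforward preimage_set0 measure0. Qed.

Let nu_ge0 A : 0 <= nu A.
Proof. by apply: integral_ge0 => x _ /=; exact: measure_ge0. Qed.

Let nu_sigma_additive : semi_sigma_additive nu.
Proof.
have mc A : measurable A -> measurable (rV_cons @^-1` A).
  by move=> mA; rewrite -[X in measurable X]setTI; exact: measurable_rV_cons.
move=> F mF tF mUF; rewrite /nu /rV_prod /pushforward preimage_bigcup.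
apply: measure_semi_sigma_additive.
- by move=> k; exact: mc.
- apply/trivIsetP => /= i j _ _ ij; rewrite -preimage_setI.
  by move/trivIsetP : tF => /(_ _ _ _ _ ij) ->//; rewrite preimage_set0.
- by rewrite -preimage_bigcup; exact: mc.
Qed.

HB.instance Definition _ := isMeasure.Build _ _ _ (rV_prod mu)
  nu0 nu_ge0 nu_sigma_additive.

Let nu_sigma_finite : sigma_finite setT (rV_prod mu).
Proof.
have /sigma_finiteP[F [TF ndF Foo]] := sigma_finiteT (@lebesgue_measure R).
have /sigma_finiteP[G [TG ndG Goo]] := sigma_finiteT mu.
exists (fun k => rV_uncons @^-1` (F k `*` G k)).
  apply/esym; rewrite -subTset => x _.
  have [i _ Fi] : (\bigcup_i F i) (rV_uncons x).1 by rewrite -TF.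
  have [j _ Gj] : (\bigcup_i G i) (rV_uncons x).2 by rewrite -TG.
  exists (maxn i j) => //; split.
  - by move: Fi; exact/subsetPset/ndF/leq_maxl.
  - by move: Gj; exact/subsetPset/ndG/leq_maxr.
move=> k; have [mF Fk] := Foo k; have [mG Gk] := Goo k.
have mFG : measurable (F k `*` G k) by exact: measurableX.
split.
  by rewrite -[X in measurable X]setTI; exact: measurable_rV_uncons.
rewrite /rV_prod /pushforward -comp_preimage.
rewrite (_ : rV_uncons \o rV_cons = id); last exact/funext/rV_consK.
by rewrite preimage_id product_measure1E// lte_mul_pinfty// ge0_fin_numE.
Qed.

HB.instance Definition _ := Measure_isSigmaFinite.Build _ _ _ (rV_prod mu)
  nu_sigma_finite.

End rV_cons.

(* Lebesgue measure on the Borel sets of R^n, as the n-fold product of the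
   Lebesgue measure on R. *)
Fixpoint borel_lebesgue {R : realType} (n : nat) :
    {sigma_finite_measure set 'rV[R]_n -> \bar R} :=
  match n return {sigma_finite_measure set 'rV[R]_n -> \bar R} with
  | 0 => [the {sigma_finite_measure set 'rV[R]_0 -> \bar R} of \d_(0 : 'rV[R]_0)]
  | n'.+1 => [the {sigma_finite_measure set 'rV[R]_n'.+1 -> \bar R}
              of rV_prod (borel_lebesgue n')]
  end.

Definition lebesgue_outer {R : realType} (n : nat) :
    {outer_measure set 'rV[R]_n -> \bar R} :=
  [the {outer_measure set 'rV[R]_n -> \bar R} of mu_ext (@borel_lebesgue R n)].

(* The Caratheodory sigma-algebra of [lebesgue_outer] is the completion of the
   Borel sigma-algebra, i.e. the Lebesgue sigma-algebra. *)
Definition Rn (R : realType) (n : nat) := caratheodory_type (@lebesgue_outer R n).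
HB.instance Definition _ (R : realType) (n : nat) := Measurable.on (Rn R n).

Definition lebesgue {R : realType} (n : nat) :
    {measure set (Rn R n) -> \bar R} :=
  [the {measure set (Rn R n) -> \bar R} of
    (@lebesgue_outer R n : set (Rn R n) -> \bar R)].

(* The library norm on matrices is the sup norm. *)
Definition enorm {R : realType} {n m : nat} (A : 'M[R]_(n, m)) : R :=
  Num.sqrt (\sum_i \sum_j A i j ^+ 2).

Definition eball {R : realType} {n : nat} (x0 : 'rV[R]_n) (s : R) :
  set 'rV[R]_n := [set x | enorm (x - x0) < s].

Section function_spaces.
Context {R : realType} {n : nat}.
Implicit Types (Omega K : set 'rV[R]_n) (f phi : 'rV[R]_n -> R).

Definition Lp Omega (p : R) f : Prop :=
  (f \_ Omega : Rn R n -> R) \in Lfun (lebesgue n) p%:E.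

Definition Lp_loc Omega (p : R) f : Prop :=
  forall K, compact K -> K `<=` Omega -> Lp K p f.

(* Functions on [Omega] are total functions whose values outside of [Omega]
   are irrelevant. *)
Definition supp {V : zmodType} Omega (f : 'rV[R]_n -> V) : set 'rV[R]_n :=
  closure [set x | Omega x /\ f x != 0].

Definition partial (j : 'I_n) f : 'rV[R]_n -> R := 'D_(delta_mx ord0 j) f.

Definition smooth f : Prop :=
  forall s : seq 'I_n, continuous (foldr partial f s) /\
    forall x j, derivable (foldr partial f s) x (delta_mx ord0 j).

Definition test_function Omega phi : Prop :=
  [/\ smooth phi, compact (supp setT phi) & supp setT phi `<=` Omega].

(* The gradient of an R^m-valued map is the n x m matrix whose i-th column is
   the gradient of the i-th component. *)
Definition weak_gradient {m : nat} Omega (u : 'rV[R]_n -> 'rV[R]_m)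
    (Du : 'rV[R]_n -> 'M[R]_(n, m)) : Prop :=
  forall phi, test_function Omega phi -> forall (j : 'I_n) (i : 'I_m),
    (\int[lebesgue n]_(x in Omega) (u x ord0 i * partial j phi x)%:E =
     - \int[lebesgue n]_(x in Omega) (Du x j i * phi x)%:E)%E.

(* [u] belongs to W^{1,p}(Omega, R^m) and [Du] is a representative of its
   gradient. *)
Definition W1p {m : nat} (p : R) Omega (u : 'rV[R]_n -> 'rV[R]_m)
    (Du : 'rV[R]_n -> 'M[R]_(n, m)) : Prop :=
  [/\ forall i, Lp Omega p (fun x => u x ord0 i),
      forall j i, Lp Omega p (fun x => Du x j i)
    & weak_gradient Omega u Du].

Definition caratheodory_function {m : nat} Omega
    (G : 'rV[R]_n -> 'rV[R]_m -> 'M[R]_(n, m) -> R) : Prop :=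
  (forall s xi, measurable_fun (Omega : set (Rn R n)) (fun x => G x s xi)) /\
  {ae lebesgue n, forall x, Omega x ->
     continuous (fun z : 'rV[R]_m * 'M[R]_(n, m) => G x z.1 z.2)}.

Definition energy {m : nat} (p : R)
    (G : 'rV[R]_n -> 'rV[R]_m -> 'M[R]_(n, m) -> R)
    (v : 'rV[R]_n -> 'rV[R]_m) (Dv : 'rV[R]_n -> 'M[R]_(n, m))
    (E : set 'rV[R]_n) : \bar R :=
  (\int[lebesgue n]_(x in E)
     (\sum_(i < m) enorm (col i (Dv x)) `^ p + G x (v x) (Dv x))%:E)%E.

Definition local_minimizer {m : nat} (p : R) Omega
    (G : 'rV[R]_n -> 'rV[R]_m -> 'M[R]_(n, m) -> R)
    (u : 'rV[R]_n -> 'rV[R]_m) (Du : 'rV[R]_n -> 'M[R]_(n, m)) : Prop :=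
  [/\ W1p p Omega u Du,
      Lp_loc Omega 1 (fun x => G x (u x) (Du x))
    & forall (phi : 'rV[R]_n -> 'rV[R]_m) (Dphi : 'rV[R]_n -> 'M[R]_(n, m)),
        W1p p Omega phi Dphi ->
        compact (supp Omega phi) -> supp Omega phi `<=` Omega ->
        (energy p G u Du (supp Omega phi) <=
         energy p G (fun x => u x + phi x)%R (fun x => Du x + Dphi x)%R
                (supp Omega phi))%E].

Definition superlevel {m : nat} Omega (u : 'rV[R]_n -> 'rV[R]_m) (i : 'I_m)
    (x0 : 'rV[R]_n) (k s : R) : set 'rV[R]_n :=
  [set x | Omega x /\ k < u x ord0 i] `&` eball x0 s.

Definition sublevel {m : nat} Omega (u : 'rV[R]_n -> 'rV[R]_m) (i : 'I_m)
    (x0 : 'rV[R]_n) (k s : R) : set 'rV[R]_n :=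
  [set x | Omega x /\ u x ord0 i < k] `&` eball x0 s.

End function_spaces.

Definition sobolev_exponent {R : realType} (n : nat) (p : R) : R :=
  n%:R * p / (n%:R - p).

(* Main.v *)
Require Import Defs.
From HB Require Import structures.
From mathcomp Require Import all_boot all_order all_algebra.
From mathcomp Require Import all_classical all_reals all_analysis.
From mathcomp Require Import measurable_realfun.
From mathcomp Require Import ring lra.

(** Let [V] be a cutoff function [zeta] times the signed excess of the
    component [u^i] over the level [k]. Minimality is tested with the
    variation that subtracts the positive part of [V] from [u^i], up to the
    sign: where the excess is positive, the new gradient is a convex
    combination of [Du^i] and of a multiple of the gradient of [zeta], with
    weights [1 - zeta] and [zeta]. By convexity of the [p]-th power, its
    energy is at most [(1 - zeta) |Du^i|^p + zeta^(1-p) |u^i - k|^p |D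
    zeta|^p]. A cutoff function built from [exp (-1/t)] satisfies [|D zeta|^p
    <= c zeta^(p-1) / (R - rho)^p], so the weight cancels and
    [variation_energy] bounds the integral of [zeta |Du^i|^p] by the first
    term of the inequality plus the oscillation of [G]; no iteration over
    radii is needed, and the constants come from [zeta] alone. That the
    competitor belongs to the Sobolev space is the chain rule for positive
    parts, [weak_partial_pos_part].

    It remains to estimate the oscillation of [G] between [u] and the
    competitor. The growth condition is first freed from the actual arguments:
    by comparison with a far point, [far_point_oscillation] bounds the
    oscillation by [a S^alpha T^q1 + b S^q2 T^beta] for all [S] and [T] above
    the norms of the arguments. The exponents [q1], [q2] may be negative, so
    [S] and [T] are chosen to balance the two terms, after which Young's
    inequality applies with nonnegative exponents. Let [t] be the measure of
    the level set, and let [N^p] bound 1 and the [p]-energy of the variation.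
    In [oscillation_young] the four factors are weighted so that every
    integral is bounded in terms of the data near the compact set, and the
    integrated oscillation is at most [M N^p t^(1-e)], where [e < p/n] by the
    two smallness conditions. This uses the integrability of [u] and of the
    variation with an exponent [r] slightly below [p^*], for which the strict
    inequalities in the smallness conditions leave room. Since [N^p] is again
    bounded by the energy, and [t] is small for small radii, half of the
    energy is absorbed on the left, and a power of [t] larger than [1 - p/n]
    remains ([one_sided_caccioppoli]).

    The analysis on R^n is developed from the definitions. A weak derivative
    controls translations in [L1] ([weak_partial_shift_le]): testing against
    smooth functions, the translation is moved to the test function.
    Truncating at dyadic levels and translating by lengths comparable to the
    [n]-th root of the measure of a level set gives a recursion for the
    measures of the level sets ([level_set_decay]), hence their decay at the
    critical rate and the Sobolev inequality for every subcritical exponent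
    ([sobolev_subcritical]). All this happens on Borel sets, where Fubini's
    theorem is available; Borel representatives carry it over to Lebesgue
    measure. *)

Set Implicit Arguments.
Unset Strict Implicit.
Unset Printing Implicit Defensive.
Import Order.TTheory GRing.Theory Num.Theory.
Import numFieldNormedType.Exports.
Local Open Scope classical_set_scope.
Local Open Scope ring_scope.

(** * A flat function and smooth functions of several variables *)

Section flat_function.
Context {R : realType}.
Implicit Types (t y : R) (k : nat).

Definition flat k t : R := if 0 < t then t^-1 ^+ k * expR (- t^-1) else 0.

Lemma flat_le0 k t : t <= 0 -> flat k t = 0.
Proof. by rewrite /flat leNgt => /negbTE ->. Qed.

Lemma flat_gt0 k t : 0 < t -> flat k t = t^-1 ^+ k * expR (- t^-1).
Proof. by rewrite /flat => ->. Qed.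

Lemma flat_ge0 k t : 0 <= flat k t.
Proof.
rewrite /flat; case: ifPn => // t0.
by rewrite mulr_ge0 ?expR_ge0// exprn_ge0// invr_ge0 ltW.
Qed.

Lemma expRN_expn_le k y : 0 <= y -> y ^+ k * expR (- y) <= k`!%:R.
Proof.
move=> y0; rewrite expRN ler_pdivrMr ?expR_gt0//.
case: k => [|k].
  by rewrite expr0 fact0 mul1r -expR0 ler_expR.
rewrite mulrC -ler_pdivrMr ?ltr0n ?fact_gt0//.
by rewrite (le_trans _ (expR_ge1Dxn k y0))// lerDr.
Qed.

Lemma flat_bounded k t : flat k t <= k`!%:R.
Proof.
rewrite /flat; case: ifPn => // t0.
by apply: expRN_expn_le; rewrite invr_ge0 ltW.
Qed.

Lemma flat0_le1 t : flat 0 t <= 1.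
Proof. by rewrite (le_trans (flat_bounded 0 t))// fact0. Qed.

(** A quadratic bound is what makes [flat k] differentiable at 0, with
    derivative 0. *)
Lemma flat_le_sqr k t : flat k t <= k.+2`!%:R * t ^+ 2.
Proof.
have [t0|t0] := leP t 0; first by rewrite flat_le0// mulr_ge0// sqr_ge0.
have -> : flat k t = flat k.+2 t * t ^+ 2.
  rewrite !flat_gt0// -[k.+2]addn2 exprD mulrAC -[in RHS](mulrA (_ ^+ k)).
  by rewrite -exprMn mulVf ?gt_eqF// expr1n mulr1.
by rewrite ler_pM2r ?flat_bounded// exprn_gt0.
Qed.

(** Each derivative is a combination of functions of the same family, so [flat
    0] has derivatives of all orders. *)
Lemma is_derive_flat k t :
  is_derive t 1 (flat k) (flat k.+2 t - k%:R * flat k.+1 t).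
Proof.
have [t0|t0|->] := ltgtP t 0.
- rewrite !flat_le0 ?ltW// mulr0 subrr.
  apply: (near_eq_is_derive (f := cst 0)) (is_derive_cst _ _ _).
  by near=> s; rewrite flat_le0//= ltW//; near: s; apply: lt_nbhsl.
- apply: (near_eq_is_derive
      (f := (fun y => y ^+ k * expR (- y)) \o (fun s => s^-1))).
    near=> s; rewrite flat_gt0//=; near: s; exact: lt_nbhsr.
  have tn0 : t != 0 by rewrite gt_eqF.
  have dV : is_derive t 1 (fun s => s^-1) (- t ^- 2).
    by have := is_deriveV tn0 (is_derive_id t 1); rewrite [_ *: 1]mulr1.
  pose y := t^-1.
  have dE : is_derive y 1 (fun s => s ^+ k * expR (- s))
      (y ^+ k *: (expR (- y) * -1) + expR (- y) *: (k%:R * y ^+ k.-1)).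
    have d1 : is_derive y 1 (fun s => s ^+ k) (k%:R * y ^+ k.-1).
      have := @is_deriveX _ _ (id : R -> R) k y 1 1 (is_derive_id y 1).
      by rewrite /GRing.scale/= mulr1 (_ : id ^+ k = fun s => s ^+ k)//;
        apply/funext => s; rewrite exprfctE.
    have d2 : is_derive y 1 (fun s => expR (- s)) (expR (- y) * -1).
      exact: (@is_derive1_comp _ expR -%R).
    exact: (is_deriveM d1 d2).
  have := @is_derive1_comp _ (fun s => s ^+ k * expR (- s)) (fun s => s^-1) t _ _ dE dV.
  set D1 := (X in is_derive _ _ _ X -> _) => H; suff <- : D1 = flat k.+2 t - k%:R * flat k.+1 t by [].
  rewrite /D1 {D1 H}.
  rewrite !flat_gt0// -/y -exprVn -/y /GRing.scale/=.
  case: k {dE} => [|k] /=; first by rewrite !expr0 !expr2; ring.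
  by rewrite !exprS; ring.
- rewrite !flat_le0// mulr0 subrr.
  have H : (h^-1 *: ((flat k \o shift 0) (h *: 1) - flat k 0)) @[h --> 0^'] --> 0.
    apply/cvgrPdist_le => e e0.
    near=> h; rewrite sub0r normrN /= (flat_le0 _ (lexx 0)) subr0 addr0.
    rewrite [h%:A]mulr1 normrZ normfV.
    have h0 : 0 < `|h| by rewrite normr_gt0; near: h; exact: nbhs_dnbhs_neq.
    rewrite ler_pdivrMl// ger0_norm ?flat_ge0//.
    rewrite (le_trans (flat_le_sqr _ _))// -real_normK ?num_real//.
    rewrite expr2 mulrCA ler_pM2l//.
    rewrite -ler_pdivlMl ?ltr0n ?fact_gt0//.
    near: h; apply: dnbhs0_le.
    by rewrite mulr_gt0// invr_gt0 ltr0n fact_gt0.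
  by apply: DeriveDef; [apply/cvg_ex; exists 0|exact/cvg_lim].
Unshelve. all: by end_near. Qed.

End flat_function.

Section smooth_functions.
Context {R : realType} {n : nat}.
Implicit Types (f g : 'rV[R]_n -> R) (B : set ('rV[R]_n -> R)).

Inductive generated_algebra B : ('rV[R]_n -> R) -> Prop :=
| alg_gen f : B f -> generated_algebra B f
| alg_cst c : generated_algebra B (cst c)
| alg_add f g : generated_algebra B f -> generated_algebra B g -> generated_algebra B (fun x => f x + g x)
| alg_mul f g : generated_algebra B f -> generated_algebra B g -> generated_algebra B (fun x => f x * g x).

(** [smooth] asks for all iterated partial derivatives. If those of the
    generators stay in the algebra, the product rule keeps the algebra stable
    and an induction on the list of directions is immediate. *)
Lemma alg_smooth B :
  (forall f, B f -> [/\ continuous f,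
     forall x j, derivable f x (delta_mx ord0 j) &
     forall j, generated_algebra B (partial j f)]) ->
  forall f, generated_algebra B f -> smooth f.
Proof.
move=> HB.
have H f : generated_algebra B f -> [/\ continuous f,
     forall x j, derivable f x (delta_mx ord0 j) &
     forall j, generated_algebra B (partial j f)].
  elim=> [{}f /HB//|c|{}f g af [cf df pf] ag [cg dg pg]|
          {}f g af [cf df pf] ag [cg dg pg]].
  - split=> [x|x j|j]; [exact: cst_continuous|exact: derivable_cst|].
    rewrite (_ : partial j _ = cst 0); first exact: alg_cst.
    by apply/funext => x; rewrite /partial derive_cst.
  - split=> [x|x j|j]; [exact: (cvgD (cf x) (cg x))|exact: derivableD|].
    rewrite (_ : partial j _ = fun x => partial j f x + partial j g x).
      exact: alg_add.
    by apply/funext => x; rewrite /partial deriveD.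
  - split=> [x|x j|j]; [exact: (cvgM (cf x) (cg x))|exact: derivableM|].
    rewrite (_ : partial j _ =
      fun x => f x * partial j g x + g x * partial j f x).
      by apply: alg_add; apply: alg_mul.
    by apply/funext => x; rewrite /partial deriveM.
move=> f af s; suff : generated_algebra B (foldr partial f s) by move=> /H[].
by elim: s => //= j s /H[].
Qed.

Lemma smooth_continuous f : smooth f -> continuous f.
Proof. by move=> /(_ [::])[]. Qed.

Lemma smooth_derivable f x j : smooth f -> derivable f x (delta_mx ord0 j).
Proof. by move=> /(_ [::])[_]; apply. Qed.

Lemma smooth_partial f j : smooth f -> smooth (partial j f).
Proof. by move=> sf s; have := sf (rcons s j); rewrite foldr_rcons. Qed.

Lemma smooth_is_derive f x j : smooth f ->
  is_derive x (delta_mx ord0 j) f (partial j f x).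
Proof. by move=> sf; apply: DeriveDef => //; exact: smooth_derivable. Qed.

Let smooth_gen f : smooth f -> [/\ continuous f,
     forall x j, derivable f x (delta_mx ord0 j) &
     forall j, generated_algebra smooth (partial j f)].
Proof.
move=> sf; split; first exact: smooth_continuous.
  by move=> x j; exact: smooth_derivable.
by move=> j; exact/alg_gen/smooth_partial.
Qed.

Lemma smoothD f g : smooth f -> smooth g -> smooth (fun x => f x + g x).
Proof. by move=> sf sg; apply: alg_smooth smooth_gen _ _; apply: alg_add; exact: alg_gen. Qed.

Lemma smoothM f g : smooth f -> smooth g -> smooth (fun x => f x * g x).
Proof. by move=> sf sg; apply: alg_smooth smooth_gen _ _; apply: alg_mul; exact: alg_gen. Qed.

Lemma smooth_cst c : smooth (cst c : 'rV[R]_n -> R).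
Proof. apply: alg_smooth smooth_gen _ _; exact: alg_cst. Qed.

Lemma smoothB f g : smooth f -> smooth g -> smooth (fun x => f x - g x).
Proof.
move=> sf sg; apply: (smoothD sf).
rewrite (_ : (fun x => - g x) = fun x => (cst (-1) : 'rV[R]_n -> R) x * g x).
  by apply: (smoothM (smooth_cst (-1)) sg).
by apply/funext => x; rewrite /= mulN1r.
Qed.

Lemma smooth_sum (I : Type) (r : seq I) (F : I -> 'rV[R]_n -> R) :
  (forall i, smooth (F i)) -> smooth (fun x => \sum_(i <- r) F i x).
Proof.
move=> sF; elim: r => [|i r IH].
  rewrite (_ : (fun x => _) = cst 0); first exact: smooth_cst.
  by apply/funext => x; rewrite big_nil.
rewrite (_ : (fun x => _) = fun x => F i x + \sum_(i <- r) F i x).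
  exact: (smoothD (sF i) IH).
by apply/funext => x; rewrite big_cons.
Qed.

Lemma is_derive_coord (x : 'rV[R]_n) (i j : 'I_n) :
  is_derive x (delta_mx ord0 j) (fun y : 'rV[R]_n => y ord0 i) (i == j)%:R.
Proof.
have H : (h^-1 *: (((fun y : 'rV[R]_n => y ord0 i) \o shift x)
     (h *: delta_mx ord0 j) - x ord0 i)) @[h --> (0:R)^'] --> ((i == j)%:R : R).
  apply: (@cvg_near_cst R R); near=> h.
  rewrite /= !mxE eqxx /= addrK /GRing.scale/= mulrA mulVf ?mul1r//.
  by near: h; exact: nbhs_dnbhs_neq.
apply: DeriveDef; last exact/cvg_lim.
by apply/cvg_ex; exists (i == j)%:R.
Unshelve. all: by end_near. Qed.

Lemma smooth_coord i : smooth (fun x : 'rV[R]_n => x ord0 i).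
Proof.
apply: (@alg_smooth [set fun x : 'rV[R]_n => x ord0 i]); last exact: alg_gen.
move=> _ ->; split => [|x j|j]; first exact: coord_continuous.
  by case: (is_derive_coord x i j).
rewrite (_ : partial j _ = cst (i == j)%:R); first exact: alg_cst.
by apply/funext => x; case: (is_derive_coord x i j).
Qed.

(** Restricted to the line through [x] in the direction [v], this is the chain
    rule in one variable. *)
Lemma is_derive_comp_dir (g : R -> R) f x v a b :
  is_derive (f x) 1 g a -> is_derive x v f b -> is_derive x v (g \o f) (a * b).
Proof.
move=> dg [/derivable1P df fb].
have E (h : 'rV[R]_n -> R) :
    'D_v h x = 'D_1 (fun s : R => h (s *: v + x)) 0.
  rewrite /derive; set F := fun s => _; set G := fun s => _.
  suff -> : F = G by []; apply/funext => s; rewrite /F /G /=.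
  by rewrite addr0 scale0r add0r [s%:A]mulr1.
have df' : is_derive (0:R) 1 (fun s => f (s *: v + x)) b.
  by apply: DeriveDef; rewrite -?E.
have dg' : is_derive ((fun s : R => f (s *: v + x)) 0) 1 g a.
  by rewrite scale0r add0r.
have [dc cE] := is_derive1_comp dg' df'.
by apply: DeriveDef; [exact/derivable1P|rewrite E].
Qed.

(** Differentiating [flat k] only shifts [k], so the functions [flat k \o f],
    together with the smooth functions, generate an algebra that is stable
    under all partial derivatives. *)
Lemma smooth_flat_comp k f : smooth f -> smooth (flat k \o f).
Proof.
move=> sf; pose B : set ('rV[R]_n -> R) := [set g | smooth g \/ exists k, g = flat k \o f].
apply: (@alg_smooth B); last by apply: alg_gen; right; exists k.
have dflat l x j : is_derive x (delta_mx ord0 j) (flat l \o f)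
    ((flat l.+2 (f x) - l%:R * flat l.+1 (f x)) * partial j f x).
  by apply: is_derive_comp_dir; [exact: is_derive_flat|exact: smooth_is_derive].
move=> g [sg|[l ->]]; split.
- exact: smooth_continuous.
- by move=> x j; exact: smooth_derivable.
- by move=> j; apply: alg_gen; left; exact: smooth_partial.
- move=> x; apply: continuous_comp; first exact: smooth_continuous.
  apply/differentiable_continuous/derivable1_diffP.
  by case: (is_derive_flat l (f x)).
- by move=> x j; case: (dflat l x j).
- move=> j; rewrite (_ : partial j _ = fun x =>
    (flat l.+2 (f x) + cst (- l%:R) x * flat l.+1 (f x)) * partial j f x).
    apply: alg_mul; last by apply: alg_gen; left; exact: smooth_partial.
    apply: alg_add; first by apply: alg_gen; right; exists l.+2.
    apply: alg_mul; first exact: alg_cst.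
    by apply: alg_gen; right; exists l.+1.
  by apply/funext => x; rewrite mulNr; case: (dflat l x j).
Qed.

Lemma partial_flat_comp k f j x : smooth f ->
  partial j (flat k \o f) x =
  (flat k.+2 (f x) - k%:R * flat k.+1 (f x)) * partial j f x.
Proof.
move=> sf; have [] // := @is_derive_comp_dir (flat k) f x (delta_mx ord0 j) _ _
  (is_derive_flat k (f x)) (smooth_is_derive x j sf).
Qed.

Lemma partialM f g j x : smooth f -> smooth g ->
  partial j (fun x => f x * g x) x = f x * partial j g x + g x * partial j f x.
Proof. by move=> sf sg; rewrite /partial deriveM//; exact: smooth_derivable. Qed.

End smooth_functions.

(** * Borel sets and Lebesgue measure of R^n *)

Section borel_sets.
Context {R : realType} {n : nat}.

Lemma rat_row_ball (x : 'rV[R]_n) (e : R) : 0 < e ->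
  exists q : 'rV[rat]_n, ball (map_mx ratr q : 'rV[R]_n) e x.
Proof.
move=> e0.
have H j : exists q : rat, `|ratr q - x ord0 j| < e.
  have xe : x ord0 j - e < x ord0 j + e by rewrite ltrD2l gt0_cp.
  have [q] := rat_in_itvoo xe.
  by rewrite in_itv/= => /andP[q1 q2]; exists q; rewrite ltr_distl q1.
have [q qP] := choice H.
exists (\row_j q j); split=> // i j /=; rewrite !mxE /ball/= (ord1 i).
exact: qP.
Qed.

Lemma measurable_ball_rV (x : 'rV[R]_n) (e : R) : 0 < e -> measurable (ball x e).
Proof.
move=> e0.
rewrite (_ : ball x e =
    \bigcap_(j in [set: 'I_n]) ((fun y : 'rV[R]_n => y ord0 j) @^-1` ball (x ord0 j) e)).
  apply: fin_bigcap_measurable => [|j _]; first exact: finite_finset.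
  rewrite -[X in measurable X]setTI; apply: measurable_rV_coord => //.
  exact: measurable_ball.
apply/seteqP; split=> [y [_ xy] j _|y xy]; first exact: xy.
by split=> // i j; rewrite (ord1 i); exact: xy.
Qed.

(** The measurable sets are generated by the coordinates, and the balls of the
    sup norm are boxes; an open set is the union of the countably many
    rational ones that it contains. *)
Lemma open_measurable_rV (U : set 'rV[R]_n) : open U -> measurable U.
Proof.
move=> oU.
pose V (q : 'rV[rat]_n * nat) : set 'rV[R]_n :=
  if `[< ball (map_mx ratr q.1 : 'rV[R]_n) q.2.+1%:R^-1 `<=` U >]
  then ball (map_mx ratr q.1 : 'rV[R]_n) q.2.+1%:R^-1 else set0.
rewrite (_ : U = \bigcup_q V q).
  apply: countable_bigcupT_measurable => [|q]; first exact: countableP.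
  by rewrite /V; case: asboolP => // _; apply: measurable_ball_rV; rewrite invr_gt0.
apply/seteqP; split=> [x Ux|x [q _]]; last first.
  by rewrite /V; case: asboolP => // qU /qU.
have /nbhs_ballP[e /= e0 xeU] := open_nbhs_nbhs (conj oU Ux).
have [k _ /(_ k (leqnn k)) ke] := near_infty_natSinv_lt (PosNum (divr_gt0 e0 (ltr0n R 2))).
have [q qx] := @rat_row_ball x k.+1%:R^-1 (ltac:(by rewrite invr_gt0)).
exists (q, k) => //; rewrite /V/=; case: asboolP => //=; apply.
move=> y qy; apply: xeU; apply: (@ball_splitr R 'rV[R]_n (map_mx ratr q : 'rV[R]_n)).
  by apply: le_ball qx; exact: ltW.
by apply: le_ball qy; exact: ltW.
Qed.

Lemma closed_measurable_rV (U : set 'rV[R]_n) : closed U -> measurable U.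
Proof.
by move=> /closed_openC/open_measurable_rV/measurableC; rewrite setCK.
Qed.

Lemma continuous_measurable_rV (f : 'rV[R]_n -> R) :
  continuous f -> measurable_fun [set: 'rV[R]_n] f.
Proof.
move=> cf; apply: (measurability _ (RGenOpens.measurableE R)) => //.
move=> _ [_ [a [b ->]] <-]; rewrite setTI.
by apply: open_measurable_rV; apply: open_comp => // x _; exact: cf.
Qed.

Lemma measurable_shift_rV (v : 'rV[R]_n) :
  measurable_fun [set: 'rV[R]_n] (fun x => x + v).
Proof.
apply: measurable_to_rV => i.
rewrite (_ : (fun t => _) = fun t : 'rV[R]_n => t ord0 i + v ord0 i).
  by apply: measurable_funD => //; exact: measurable_rV_coord.
by apply/funext => t; rewrite mxE.
Qed.

End borel_sets.

Section borel_lebesgue_invariance.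
Context {R : realType}.
Local Open Scope ereal_scope.

Lemma lebesgue_measure_shift (c : R) (A : set R) : measurable A ->
  (@lebesgue_measure R) [set x | A (x + c)%R] = lebesgue_measure A.
Proof.
move=> mA.
have mc : measurable_fun [set: R] (fun x : R => x + c)%R by exact: measurable_funD.
pose mu' : {measure set (measurableTypeR R) -> \bar R} :=
  [the measure _ _ of pushforward (@lebesgue_measure R)
    ((fun x : R => x + c)%R : measurableTypeR R -> measurableTypeR R)].
apply/esym; apply: (@lebesgue_measure_unique R (mu' mc)) => //.
move=> _ [[a b] _ <-] /=; rewrite /pushforward.
rewrite (_ : _ @^-1` _ = `](a - c)%R, (b - c)%R]%classic); last first.
  by apply/seteqP; split=> x /=; rewrite !in_itv/= ltrBlDr lerBrDr.
by rewrite !lebesgue_measure_itv/= !lte_fin ltrD2r -!EFinB opprD addrACA subrr addr0.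
Qed.

(** By induction on the dimension: a translation acts separately on the two
    factors of the product, and a product measure is determined by the
    measures of rectangles. *)
Lemma borel_lebesgue_shift n (v : 'rV[R]_n) (A : set 'rV[R]_n) : measurable A ->
  borel_lebesgue n [set x | A (x + v)%R] = borel_lebesgue n A.
Proof.
elim: n v A => [|n IH] v A mA.
  by congr (borel_lebesgue 0 _); apply/funext => x /=; rewrite (thinmx0 v) addr0.
rewrite /= /rV_prod /pushforward.
pose v' : 'rV[R]_n := \row_k v ord0 (lift ord0 k).
pose s (z : measurableTypeR R * 'rV[R]_n) : measurableTypeR R * 'rV[R]_n :=
  (z.1 + v ord0 ord0, z.2 + v')%R.
have ms : measurable_fun setT s.
  apply: measurable_fun_pair.
    by apply: measurable_funD => //; exact: measurable_fst.
  exact: (measurableT_comp (measurable_shift_rV v') measurable_snd).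
have -> : @rV_cons R n @^-1` [set x | A (x + v)%R] = s @^-1` (@rV_cons R n @^-1` A).
  have E : (fun z => rV_cons z + v)%R = @rV_cons R n \o s.
    apply/funext => -[a x]; apply/rowP => j; rewrite /rV_cons !mxE/=.
    by case: unliftP => [k ->|->]; rewrite ?mxE.
  transitivity ((fun z => @rV_cons R n z + v)%R @^-1` A); first by [].
  by rewrite E comp_preimage.
pose m' : {measure set (measurableTypeR R * 'rV[R]_n) -> \bar R} :=
  [the measure _ _ of pushforward ((@lebesgue_measure R) \x (borel_lebesgue n)) s].
apply/esym; apply: (@product_measure_unique _ _ _ _ R (@lebesgue_measure R) (borel_lebesgue n) (m' ms)).
  move=> B C mB mC; rewrite /m' /= /pushforward.
  rewrite (_ : s @^-1` _ = [set x | B (x + v ord0 ord0)%R] `*` [set x | C (x + v')%R]) //.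
  rewrite product_measure1E.
  - by congr (_ * _); [exact: lebesgue_measure_shift|exact: IH].
  - rewrite -[X in measurable X]setTI.
    by apply: (@measurable_funD _ _ _ _ id (cst (v ord0 ord0))).
  - by rewrite -[X in measurable X]setTI; exact: measurable_shift_rV.
by rewrite -[X in measurable X]setTI; exact: measurable_rV_cons.
Qed.

Definition cube (n : nat) (h : R) : set 'rV[R]_n := [set x | forall i, (0 <= x ord0 i < h)%R].
Arguments cube : clear implicits.

Lemma measurable_cube (n : nat) (h : R) : measurable (cube n h).
Proof.
rewrite (_ : cube n h = \bigcap_(j in [set: 'I_n])
    ((fun y : 'rV[R]_n => y ord0 j) @^-1` `[0%R, h[)).
  apply: fin_bigcap_measurable => [|j _]; first exact: finite_finset.
  by rewrite -[X in measurable X]setTI; apply: measurable_rV_coord.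
apply/seteqP; split=> y H j => [_|].
  by have := H j; rewrite /= in_itv.
by have := H j I; rewrite /= in_itv.
Qed.

Lemma borel_lebesgue_cube n (h : R) : (0 <= h)%R ->
  borel_lebesgue n (cube n h) = (h ^+ n)%:E.
Proof.
move=> h0; elim: n => [|n IH].
  change (\d_(0%R : 'rV[R]_0) (cube 0 h) = (h ^+ 0)%:E).
  by rewrite diracE mem_set ?expr0// => -[].
rewrite /= /rV_prod /pushforward.
rewrite (_ : _ @^-1` _ = `[0%R, h[%classic `*` cube n h); last first.
  apply/seteqP; split=> [[a x] H|[a x] [/= H1 H2] j]; last first.
    rewrite /rV_cons mxE /=; case: unliftP => [k _|_]; first exact: H2.
    by move: H1; rewrite in_itv.
  split=> [|k].
    by have := H ord0; rewrite mxE unlift_none /= in_itv.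
  by have := H (lift ord0 k); rewrite mxE liftK.
rewrite product_measure1E//; last exact: measurable_cube.
have H : lebesgue_measure (`[0%R, h[%classic : set R) = h%:E.
  rewrite lebesgue_measure_itv/= lte_fin oppr0 adde0.
  by move: h0; rewrite le_eqVlt => /predU1P[<-|->//]; rewrite ltxx.
by rewrite [X in X * _]H IH -EFinM exprS.
Qed.

End borel_lebesgue_invariance.

Section borel_versus_lebesgue.
Context {R : realType} {n : nat}.
Local Open Scope ereal_scope.
Local Notation mu := (@borel_lebesgue R n).
Local Notation la := (@lebesgue R n).

Lemma measurable_Rn (A : set 'rV[R]_n) : measurable A -> measurable (A : set (Rn R n)).
Proof. by move=> mA; exact: (caratheodory_measurable_mu_ext mu mA). Qed.

Lemma lebesgueE (A : set 'rV[R]_n) : measurable A -> la A = mu A.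
Proof. by move=> mA; exact: (measurable_mu_extE mu mA). Qed.

Lemma measurable_fun_Rn d (T : measurableType d) (f : 'rV[R]_n -> T) :
  measurable_fun [set: 'rV[R]_n] f -> measurable_fun [set: Rn R n] (f : Rn R n -> T).
Proof.
move=> mf _ Y mY; have := mf measurableT _ mY; rewrite !setTI.
exact: measurable_Rn.
Qed.

Let mid : measurable_fun [set: Rn R n] (id : Rn R n -> 'rV[R]_n).
Proof. by move=> _ Y mY; rewrite setTI; exact: measurable_Rn. Qed.

(** Under the identity, which is measurable from the Lebesgue to the Borel
    sets, the Lebesgue measure is transported to its Borel restriction; a
    change of variables compares the integrals. *)
Let pushE (D : set 'rV[R]_n) (f : 'rV[R]_n -> \bar R) :
  \int[mu]_(x in D) f x = \int[pushforward la (id : Rn R n -> 'rV[R]_n)]_(x in D) f x.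
Proof.
apply: eq_measure_integral => A mA _; exact: (esym (lebesgueE mA)).
Qed.

Lemma ge0_integral_lebesgueE (f : 'rV[R]_n -> \bar R) :
  measurable_fun [set: 'rV[R]_n] f -> (forall x, 0 <= f x) ->
  \int[la]_x f x = \int[mu]_x f x.
Proof.
move=> mf f0; rewrite pushE ge0_integral_pushforward//.
Qed.

Lemma integrable_lebesgueE (f : 'rV[R]_n -> \bar R) :
  measurable_fun [set: 'rV[R]_n] f ->
  la.-integrable setT f <-> mu.-integrable setT f.
Proof.
move=> mf; split=> /integrableP[_ H]; apply/integrableP; split=> //.
- rewrite -ge0_integral_lebesgueE//; exact: measurableT_comp.
- exact: measurable_fun_Rn.
- rewrite ge0_integral_lebesgueE//; exact: measurableT_comp.
Qed.

Lemma integral_lebesgueE (f : 'rV[R]_n -> \bar R) :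
  measurable_fun [set: 'rV[R]_n] f -> \int[la]_x f x = \int[mu]_x f x.
Proof.
move=> mf; rewrite integralE [RHS]integralE.
by rewrite !ge0_integral_lebesgueE//;
  [exact: measurable_funeneg|exact: measurable_funepos].
Qed.

(** Lebesgue measure is the Caratheodory extension of its Borel restriction, so
    an optimal sequence of countable Borel covers traps a Lebesgue set inside a
    Borel set of the same measure; sigma-finiteness removes the assumption of
    finite measure. *)
Lemma borel_hull (E : set (Rn R n)) : measurable E ->
  exists F : set 'rV[R]_n, [/\ measurable F, E `<=` F & la (F `\` E) = 0].
Proof.
move=> mE.
have fin (E' : set (Rn R n)) : measurable E' -> la E' < +oo ->
    exists F : set 'rV[R]_n, [/\ measurable F, E' `<=` F & la (F `\` E') = 0].
  move=> {E mE} {}mE Eoo; set E := E'.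
  have fE : la E \is a fin_num by rewrite ge0_fin_numE.
  have cov (k : nat) : exists A : (set 'rV[R]_n)^nat, measurable_cover (E : set 'rV[R]_n) A /\
     \sum_(0 <= i <oo) mu (A i) < la E + k.+1%:R^-1%:E.
    have k0 : (0 < k.+1%:R^-1 :> R)%R by rewrite invr_gt0.
    have [_ [A EA <-] AE] := lb_ereal_inf_adherent k0 fE.
    by exists A; split; [exact: EA|exact: AE].
  have [A AP] := choice cov.
  pose F := \bigcap_k \bigcup_i A k i.
  have mA k i : measurable (A k i) by have [[+ _] _] := AP k; apply.
  have mF : measurable F.
    by apply: bigcapT_measurable => k; exact: bigcupT_measurable.
  have EF : E `<=` F by move=> x Ex k _; have [[_ +] _] := AP k; apply.
  exists F; split=> //.
  have FE : la F <= la E.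
    apply/lee_addgt0Pr => e e0.
    have [k _ /(_ k (leqnn k)) ke] := near_infty_natSinv_lt (PosNum e0).
    apply: (@le_trans _ _ (la E + k.+1%:R^-1%:E)); last first.
      by rewrite leeD2l// lee_fin ltW.
    apply: (le_trans _ (ltW (AP k).2)).
    apply: (@le_trans _ _ (la (\bigcup_i A k i))).
      by apply: (le_outer_measure (mu_ext mu)); exact: bigcap_inf.
    rewrite lebesgueE; last exact: bigcupT_measurable.
    apply: measure_sigma_subadditive => //; exact: bigcupT_measurable.
  have mF' := measurable_Rn mF.
  rewrite measureD//; last by rewrite (le_lt_trans FE).
  have EF' : la E <= la F by apply: le_measure; rewrite ?inE.
  rewrite setIidr//; apply/eqP; rewrite eq_le; apply/andP; split.
    by rewrite sube_le0.
  by rewrite sube_ge0// fE.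
have /sigma_finiteP[G [TG _ Goo]] := sigma_finiteT mu.
have H k : exists F : set 'rV[R]_n, [/\ measurable F, (E `&` G k) `<=` F &
    la (F `\` (E `&` G k)) = 0].
  have [mG Gk] := Goo k.
  apply: fin; first by apply: measurableI => //; exact: measurable_Rn.
  have Gk' : la (G k) < +oo by rewrite lebesgueE.
  apply: le_lt_trans Gk'; apply: le_measure; rewrite ?inE//.
    by apply: measurableI => //; exact: measurable_Rn.
  exact: measurable_Rn.
have [F FP] := choice H.
exists (\bigcup_k F k); split.
- by apply: bigcupT_measurable => k; have [] := FP k.
- move=> x Ex; have [k _ Gx] : (\bigcup_k G k) x by rewrite -TG.
  by exists k => //; have [_ + _] := FP k; apply.
- apply/eqP; rewrite eq_le measure_ge0 andbT.
  have mD k : measurable (F k `\` (E `&` G k) : set (Rn R n)).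
    have [mF _ _] := FP k; have [mG _] := Goo k.
    apply: measurableD; first exact: measurable_Rn.
    by apply: measurableI => //; exact: measurable_Rn.
  apply: (@le_trans _ _ (la (\bigcup_k (F k `\` (E `&` G k))))).
    apply: (le_outer_measure (mu_ext mu)) => x [[k _ Fx] nEx]; exists k => //.
    by split=> // -[].
  apply: (@le_trans _ _ (\sum_(0 <= k <oo) la (F k `\` (E `&` G k)))).
  - by apply: measure_sigma_subadditive => //; exact: bigcupT_measurable.
  - by rewrite eseries0// => k _ _; have [_ _] := FP k.
Qed.

Lemma borel_null_hull (N : set 'rV[R]_n) : la.-negligible N ->
  exists M : set 'rV[R]_n, [/\ measurable M, N `<=` M & mu M = 0].
Proof.
move=> [E [mE E0 NE]]; have [F [mF EF F0]] := borel_hull mE.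
exists F; split=> //; first exact: subset_trans NE EF.
rewrite -lebesgueE//; apply/eqP; rewrite eq_le measure_ge0 andbT.
have mF' := measurable_Rn mF.
rewrite -(setDUK EF) (le_trans (outer_measureU2 (mu_ext mu) _ _))//.
by rewrite -/(la E) -/(la (F `\` E)) E0 F0 adde0.
Qed.

(** The superlevel sets at rational heights are replaced by Borel hulls. The
    countably many errors lie in one Borel null set, off which nothing
    changes. *)
Lemma borel_version (f : 'rV[R]_n -> R) :
  measurable_fun [set: Rn R n] (f : Rn R n -> R) ->
  exists M : set 'rV[R]_n, [/\ measurable M, mu M = 0 &
    measurable_fun [set: 'rV[R]_n] (f \_ (~` M))].
Proof.
move=> mf.
have mE (q : rat) : measurable [set x : Rn R n | (ratr q < f x)%R].
  have := mf measurableT _ (measurable_itv `]ratr q, +oo[).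
  rewrite setTI; congr measurable; apply/seteqP.
  by split=> x /=; rewrite in_itv/= andbT.
have [B BP] := choice (fun q => borel_hull (mE q)).
pose D q := B q `\` [set x | (ratr q < f x)%R].
pose N := \bigcup_k (if unpickle k is Some q then D q else set0).
have mB q : measurable (B q) by have [] := BP q.
have nN : la.-negligible N.
  apply: negligible_bigcup => k; case: (unpickle k) => [q|]; last exact: negligible_set0.
  exists (D q).
  split=> //; last by have [] := BP q.
  by apply: measurableD => //; exact: measurable_Rn.
have [M [mM NM M0]] := borel_null_hull nN.
exists M; split=> //.
have HB q x : ~ M x -> B q x <-> (ratr q < f x)%R.
  move=> nM; split=> [Bx|]; last by have [_ + _] := BP q; apply.
  by apply: contrapT => nf; apply/nM/NM; exists (pickle q); [exact: I|rewrite pickleK; split].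
have mq (q : rat) : measurable [set x | (ratr q < (f \_ (~` M)) x)%R].
  have [q0|q0] := boolP ((ratr q : R) < 0)%R.
    rewrite (_ : mkset _ = (B q `\` M) `|` M).
      by apply: measurableU => //; exact: measurableD.
    apply/seteqP; split=> x /=; rewrite patchE; case: ifPn; rewrite ?inE ?notin_setE => Mx.
    - by move=> /(HB q _ Mx) ?; left.
    - by move=> _; right; exact: contrapT.
    - by move=> [[/(HB q _ Mx)]|/Mx].
    - by move=> _.
  rewrite (_ : mkset _ = B q `\` M); first exact: measurableD.
  apply/seteqP; split=> x /=; rewrite patchE; case: ifPn; rewrite ?inE ?notin_setE => Mx.
  - by move=> /(HB q _ Mx) ?.
  - by rewrite (negbTE q0).
  - by move=> [/(HB q _ Mx)].
  - by move=> [_ /Mx].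
apply: (measurability _ (RGenOInfty.measurableE R)) => //.
move=> _ [_ [c ->] <-]; rewrite setTI.
rewrite (_ : _ @^-1` _ = \bigcup_(q : rat) (if (c < ratr q)%R then
    [set x | (ratr q < (f \_ (~` M)) x)%R] else set0)).
  by apply: bigcupT_measurable_rat => q; case: ifP.
apply/seteqP; split=> x /=; rewrite in_itv/= andbT.
  move=> /rat_in_itvoo[q]; rewrite in_itv/= => /andP[cq qf].
  by exists q => //; rewrite cq.
by move=> [q _]; case: ifP => // cq /= /(lt_trans cq).
Qed.

End borel_versus_lebesgue.

(** * Real-valued integrable functions *)

Section L1_functions.
Context d (T : measurableType d) {R : realType}.
Variable mu : {measure set T -> \bar R}.
Implicit Types f g h : T -> R.

(** Integrable real-valued functions, with real-valued integrals, so that the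
    estimates below are carried out by ordinary arithmetic. *)
Definition L1 f := mu.-integrable setT (EFin \o f).

Lemma L1_measurable f : L1 f -> measurable_fun setT f.
Proof. by move=> /integrableP[/measurable_EFinP]. Qed.

Lemma L1_dom f g : measurable_fun setT f -> L1 g ->
  (forall x, `|f x| <= g x) -> L1 f.
Proof.
move=> mf ig fg; apply: (le_integrable measurableT _ _ ig).
  exact/measurable_EFinP.
by move=> x _ /=; rewrite lee_fin (le_trans (fg x))// ler_norm.
Qed.

Lemma L1_norm f : L1 f -> L1 (fun x => `|f x|).
Proof. by move=> /integrable_norm. Qed.

Lemma L1D f g : L1 f -> L1 g -> L1 (fun x => f x + g x).
Proof. exact: integrableD. Qed.

Lemma L1B f g : L1 f -> L1 g -> L1 (fun x => f x - g x).
Proof. exact: integrableB. Qed.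

Lemma L1Z k f : L1 f -> L1 (fun x => k * f x).
Proof. exact: integrableZl. Qed.

Lemma L1N f : L1 f -> L1 (fun x => - f x).
Proof. exact: integrableN. Qed.

Lemma L10 : L1 (fun=> 0).
Proof. exact: integrable0. Qed.

Lemma L1_sum (J : Type) (r : seq J) (F : J -> T -> R) :
  (forall j, L1 (F j)) -> L1 (fun x => \sum_(j <- r) F j x).
Proof.
move=> LF; elim: r => [|j r IH].
  by rewrite (_ : (fun x => _) = fun=> 0)//; [exact: L10|apply/funext => x; rewrite big_nil].
rewrite (_ : (fun x => _) = fun x => F j x + \sum_(i <- r) F i x); first exact: L1D.
by apply/funext => x; rewrite big_cons.
Qed.

Lemma L1M_bounded f g M : L1 f -> measurable_fun setT g ->
  (forall x, `|g x| <= M) -> L1 (fun x => f x * g x).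
Proof.
move=> Lf mg gM; apply: (@L1_dom _ (fun x => M * `|f x|)).
- by apply: measurable_funM => //; exact: L1_measurable.
- exact/L1Z/L1_norm.
- by move=> x; rewrite normrM mulrC ler_wpM2r.
Qed.

Lemma L1_indic (A : set T) : measurable A -> (mu A < +oo)%E -> L1 (\1_A).
Proof.
move=> mA Aoo; apply/integrableP; split; first exact/measurable_EFinP/measurable_indic.
rewrite (eq_integral (EFin \o \1_A)); first by rewrite integral_indic// setIT.
by move=> x _ /=; rewrite ger0_norm.
Qed.

Lemma L1_patch (A : set T) f : measurable A -> L1 f -> L1 (f \_ A).
Proof.
move=> mA Lf; apply: (@L1_dom _ (fun x => `|f x|)); last first.
- by move=> x; rewrite patchE; case: ifP => // _; rewrite normr0.
- exact: L1_norm.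
- apply/measurable_restrict => //; rewrite setTI.
  by apply: (measurable_funS measurableT) => //; exact: L1_measurable.
Qed.

Lemma Rintegral_EFin f : L1 f -> (\int[mu]_x (f x)%:E)%E = (\int[mu]_x f x)%:E.
Proof. by move=> Lf; rewrite /Rintegral fineK//; exact: integrable_fin_num Lf. Qed.

Lemma integral_norm f : L1 f -> `|\int[mu]_x f x| <= \int[mu]_x `|f x|.
Proof. by move=> Lf; exact: le_normr_Rintegral. Qed.

Lemma integral_le f g : L1 f -> L1 g -> (forall x, f x <= g x) ->
  \int[mu]_x f x <= \int[mu]_x g x.
Proof. by move=> Lf Lg fg; apply: le_Rintegral. Qed.

Lemma integral_pos f : (forall x, 0 <= f x) -> 0 <= \int[mu]_x f x.
Proof. by move=> f0; apply: Rintegral_ge0. Qed.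

Lemma integral_add f g : L1 f -> L1 g ->
  \int[mu]_x (f x + g x) = \int[mu]_x f x + \int[mu]_x g x.
Proof. by move=> Lf Lg; exact: RintegralD. Qed.

Lemma integral_sub f g : L1 f -> L1 g ->
  \int[mu]_x (f x - g x) = \int[mu]_x f x - \int[mu]_x g x.
Proof. by move=> Lf Lg; exact: RintegralB. Qed.

Lemma integral_scale k f : L1 f -> \int[mu]_x (k * f x) = k * \int[mu]_x f x.
Proof. by move=> Lf; exact: RintegralZl. Qed.

Lemma integral_opp f : L1 f -> \int[mu]_x (- f x) = - \int[mu]_x f x.
Proof.
move=> Lf; rewrite -mulN1r -integral_scale//.
by apply: eq_Rintegral => x _; rewrite mulN1r.
Qed.

Lemma integral_dominated (f_ : nat -> T -> R) f g :
  (forall k, measurable_fun setT (f_ k)) ->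
  (forall x, f_ k x @[k --> \oo] --> f x) -> L1 g ->
  (forall k x, `|f_ k x| <= g x) ->
  \int[mu]_x f_ k x @[k --> \oo] --> \int[mu]_x f x.
Proof.
move=> mf ff Lg fg.
have mlim : measurable_fun setT f.
  by apply: (@measurable_fun_cvg _ _ _ _ f_) => // x _; exact: ff.
have Lf : L1 f.
  apply: (L1_dom mlim Lg) => x.
  have H : `|f_ k x| @[k --> \oo] --> `|f x| by apply: cvg_norm; exact: ff.
  rewrite -(cvg_lim _ H)//; apply: limr_le; first by apply/cvg_ex; exists `|f x|.
  exact: nearW.
apply: fine_cvg; rewrite fineK; last exact: integrable_fin_num.
apply: (@dominated_cvg _ _ _ mu setT measurableT (fun k x => (f_ k x)%:E)
  (EFin \o f) (EFin \o g)).
- by move=> k; exact/measurable_EFinP.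
- by move=> x _; apply: cvg_EFin; [exact: nearW|exact: ff].
- by [].
- exact: Lg.
- by move=> k x _; rewrite lee_fin; exact: fg.
Qed.

(** Dominated convergence in the form used for epsilon-arguments: one index
    suffices. *)
Lemma integral_dominated0 (f_ : nat -> T -> R) g e :
  (forall k, measurable_fun setT (f_ k)) ->
  (forall x, f_ k x @[k --> \oo] --> 0) -> L1 g ->
  (forall k x, `|f_ k x| <= g x) -> 0 < e ->
  exists N, forall k, (N <= k)%N -> `|\int[mu]_x f_ k x| <= e.
Proof.
move=> mf ff Lg fg e0.
have := integral_dominated mf ff Lg fg.
rewrite [X in _ --> X](_ : _ = 0); last by rewrite /Rintegral integral0.
move=> /cvgrPdist_le/(_ _ e0)[N _ H]; exists N => k Nk.
by have := H k Nk; rewrite sub0r normrN.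
Qed.

End L1_functions.

(** * Test functions and density *)

Section test_functions.
Context {R : realType} {n : nat}.
Local Notation mu := (@borel_lebesgue R n).
Local Notation X := 'rV[R]_n.
Implicit Types (f g psi : X -> R) (j : 'I_n).

Definition nball (N : R) : set X := [set x | `|x| <= N].

Lemma closed_nball (N : R) : closed (nball N).
Proof.
rewrite (_ : nball N = (fun x : X => `|x|) @^-1` [set t | t <= N])//.
by apply: closed_comp => [x _|]; [exact: norm_continuous|exact: closed_le].
Qed.

Lemma measurable_nball (N : R) : measurable (nball N).
Proof. by apply: closed_measurable_rV; exact: closed_nball. Qed.

Lemma compact_nball (N : R) : compact (nball N).
Proof.
apply: bounded_closed_compact; last exact: closed_nball.
exists N; split; first exact: num_real.
by move=> M NM x /le_trans; apply; exact: ltW.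
Qed.

Lemma coord_le_norm (x : X) j : `|x ord0 j| <= `|x|.
Proof.
rewrite [leRHS]/Num.norm /= mx_normrE.
by apply/bigmax_geP; right; exists (ord0, j).
Qed.

Lemma nball_finite (N : R) : (mu (nball N) < +oo)%E.
Proof.
pose M : R := `|N| + 1.
have M0 : 0 < M by rewrite ltr_pwDr.
pose v : X := const_mx M.
have H : (mu (nball N) <= mu [set x | @cube R n (2 * M) (x + v)%R])%E.
  apply: le_measure; rewrite ?inE.
  - exact: measurable_nball.
  - by rewrite -[X in measurable X]setTI; apply: measurable_shift_rV => //; exact: measurable_cube.
  - move=> x xN i; rewrite !mxE.
    have : `|x ord0 i| < M.
      by rewrite (le_lt_trans (coord_le_norm _ _))// (le_lt_trans xN)// ltr_pwDr// ler_norm.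
    by rewrite ltr_norml mulr_natl mulr2n => /andP[? ?]; lra.
apply: (le_lt_trans H); rewrite borel_lebesgue_shift; last exact: measurable_cube.
by rewrite borel_lebesgue_cube ?ltry// mulr_ge0// ltW.
Qed.

Definition bounded_supp f := exists N : R, forall x, f x != 0 -> `|x| <= N.

(** Closed balls of R^n are compact, so a bounded support is compact. *)
Lemma test_functionP psi :
  test_function setT psi <-> smooth psi /\ bounded_supp psi.
Proof.
split=> [[sp cp _]|[sp [N HN]]].
  split=> //; have [M [_ HM]] := compact_bounded cp.
  exists (M + 1) => x px; apply: HM; first by rewrite ltrDl.
  by apply: subset_closure; split.
split=> //.
apply: (subclosed_compact _ (@compact_nball N)); first exact: closed_closure.
rewrite /supp [X in _ `<=` X]((closure_id _).1 (@closed_nball N)).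
by apply: closure_subset => x [_ /HN].
Qed.

Lemma test_smooth psi : test_function setT psi -> smooth psi.
Proof. by move=> /test_functionP[]. Qed.

Lemma test_measurable psi : test_function setT psi -> measurable_fun setT psi.
Proof. by move=> /test_smooth/smooth_continuous/continuous_measurable_rV. Qed.

Lemma smooth_measurable f : smooth f -> measurable_fun setT f.
Proof. by move=> /smooth_continuous/continuous_measurable_rV. Qed.

Lemma test_bounded psi : test_function setT psi ->
  exists2 M, 0 <= M & forall x, `|psi x| <= M.
Proof.
move=> /test_functionP[sp [N HN]].
have [M [_ HM]] : bounded_set (psi @` nball N).
  apply: compact_bounded; apply: continuous_compact; last exact: compact_nball.
  exact/continuous_subspaceT/smooth_continuous.
exists (`|M| + 1); first by rewrite addr_ge0.
move=> x; have [->|px] := eqVneq (psi x) 0; first by rewrite normr0 addr_ge0.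
apply: HM; first by rewrite ltr_pwDr// ler_norm.
by exists x => //; exact: HN.
Qed.

Lemma test_partial psi j : test_function setT psi -> test_function setT (partial j psi).
Proof.
move=> /test_functionP[sp [N HN]]; apply/test_functionP; split.
  exact: smooth_partial.
exists N => x; apply: contraNT; rewrite -ltNge => Nx.
have oU : open (~` nball N) by exact/closed_openC/closed_nball.
have Ux : (~` nball N) x by apply/negP; rewrite -ltNge.
rewrite /partial (@near_eq_derive _ _ _ _ (cst 0)); first by rewrite derive_cst.
near=> y; apply/eqP; rewrite -[_ == _]negbK; apply/negP => /HN; apply/negP.
rewrite -ltNge; suff : (~` nball N) y by move=> /negP; rewrite -ltNge.
by near: y; exact: open_nbhs_nbhs.
Unshelve. all: by end_near. Qed.

Lemma derivable_shift f (v x : X) j : derivable f (x + v) (delta_mx ord0 j) ->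
  derivable (fun x => f (x + v)) x (delta_mx ord0 j) /\
  partial j (fun x => f (x + v)) x = partial j f (x + v).
Proof.
rewrite /partial /derivable /derive.
suff -> : (fun h : R => h^-1 *: (((fun x => f (x + v)) \o shift x) (h *: delta_mx ord0 j) -
   f (x + v))) = (fun h : R => h^-1 *: ((f \o shift (x + v)) (h *: delta_mx ord0 j) -
   f (x + v))) by [].
by apply/funext => h /=; rewrite addrA.
Qed.

Lemma partial_shift f v j : smooth f ->
  partial j (fun x => f (x + v)) = fun x => partial j f (x + v).
Proof.
by move=> sf; apply/funext => x; have [] := derivable_shift (@smooth_derivable _ _ f (x + v) j sf).
Qed.

Lemma smooth_shift f v : smooth f -> smooth (fun x => f (x + v)).
Proof.
move=> sf s.
have E : foldr partial (fun x => f (x + v)) s = fun x => foldr partial f s (x + v).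
  elim: s => //= i s ->; rewrite partial_shift// => t.
  by have := sf (t ++ s); rewrite foldr_cat.
rewrite E; have [cf df] := sf s; split=> [x|x i].
  apply: (@continuous_comp _ _ _ (fun y : X => y + v)); last exact: cf.
  have H : {for x, continuous ((id : X -> X) + cst v)}.
    by apply: continuousD => //; exact: cst_continuous.
  exact: H.
by have [] := derivable_shift (df (x + v) i).
Qed.

Lemma test_shift psi v : test_function setT psi ->
  test_function setT (fun x => psi (x + v)).
Proof.
move=> /test_functionP[sp [N HN]]; apply/test_functionP; split.
  exact: smooth_shift.
exists (N + `|v|) => x /HN; rewrite -lerBlDr; apply: le_trans.
by rewrite lerBlDr -[in leLHS](addrK v x) ler_normB.
Qed.

Lemma testM f psi : smooth f -> test_function setT psi ->
  test_function setT (fun x => f x * psi x).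
Proof.
move=> sf /test_functionP[sp [N HN]]; apply/test_functionP; split.
  exact: smoothM.
by exists N => x; rewrite mulf_eq0 negb_or => /andP[_ /HN].
Qed.

Lemma testB psi phi : test_function setT psi -> test_function setT phi ->
  test_function setT (fun x => psi x - phi x).
Proof.
move=> /test_functionP[sp [N HN]] /test_functionP[sq [M HM]].
apply/test_functionP; split; first exact: smoothB.
exists (Num.max N M) => x; rewrite le_max; apply: contraR.
rewrite negb_or -!ltNge => /andP[Nx Mx].
have [->|/HN] := eqVneq (psi x) 0; last by rewrite leNgt Nx.
by have [->|/HM] := eqVneq (phi x) 0; [rewrite subrr|rewrite leNgt Mx].
Qed.

Lemma L1_test psi : test_function setT psi -> L1 mu psi.
Proof.
move=> tp; have [M M0 HM] := test_bounded tp.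
have /test_functionP[_ [N HN]] := tp.
apply: (@L1_dom _ _ _ _ _ (fun x => M * \1_(nball N) x)).
- exact: test_measurable.
- by apply/L1Z/L1_indic; [exact: measurable_nball|exact: nball_finite].
- move=> x; have [->|/HN xN] := eqVneq (psi x) 0.
    by rewrite normr0 mulr_ge0// indicE.
  by rewrite indicE mem_set// mulr1.
Qed.

Lemma L1M_test f psi : L1 mu f -> test_function setT psi ->
  L1 mu (fun x => f x * psi x).
Proof.
move=> Lf tp; have [M _ HM] := test_bounded tp.
by apply: L1M_bounded HM => //; exact: test_measurable.
Qed.

Lemma smooth_lipschitz f j (M : R) (x : X) (t : R) : smooth f ->
  (forall y, `|partial j f y| <= M) ->
  `|f (x + t *: delta_mx ord0 j) - f x| <= M * `|t|.
Proof.
move=> sf HM; pose e : X := delta_mx ord0 j.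
suff main (y : X) (s : R) : 0 < s -> `|f (y + s *: e) - f y| <= M * s.
  have [t0|t0|->] := ltgtP t 0; last by rewrite scale0r addr0 subrr !normr0 mulr0.
    rewrite distrC; have := main (x + t *: e) (- t).
    rewrite scaleNr addrK oppr_gt0 => /(_ t0) H.
    by rewrite (le_trans H)// ltr0_norm.
  by rewrite (gtr0_norm t0); exact: main.
move=> s0; pose g (r : R) := f (r *: e + y).
have dg (r : R) : is_derive r 1 g (partial j f (r *: e + y)).
  have de : is_derive (r *: e + y) e f (partial j f (r *: e + y)).
    exact: smooth_is_derive.
  have E : (fun h : R => h^-1 *: ((g \o shift r) (h *: 1) - g r)) =
      (fun h : R => h^-1 *: ((f \o shift (r *: e + y)) (h *: e) - f (r *: e + y))).
    by apply/funext => h; rewrite /g /= [h%:A]mulr1 scalerDl addrA.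
  case: de => de1 de2; apply: DeriveDef; first by rewrite /derivable E.
  by rewrite /derive E.
have cg : {within `[0, s], continuous g}.
  apply: continuous_subspaceT => r.
  by apply/differentiable_continuous/derivable1_diffP; case: (dg r).
have [c _ H] := MVT s0 (fun r _ => dg r) cg.
rewrite [y + _]addrC; move: H; rewrite /g scale0r add0r subr0 => ->.
by rewrite normrM (gtr0_norm s0) ler_wpM2r// ltW.
Qed.

End test_functions.

Section density.
Context {R : realType} {n : nat}.
Local Notation mu := (@borel_lebesgue R n).
Local Notation X := 'rV[R]_n.
Implicit Types (f g w psi : X -> R) (A : set X) (j : 'I_n).

Lemma flat0_cvg1 (t : R) : 0 < t -> flat 0 (k%:R * t) @[k --> \oo] --> (1 : R).
Proof.
move=> t0; rewrite -cvg_shiftS /=.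
rewrite (_ : (fun k => _) = fun k => expR (- (t^-1 * k.+1%:R^-1))); last first.
  apply/funext => k; rewrite flat_gt0 ?mulr_gt0//.
  by rewrite expr0 mul1r invfM mulrC.
have H : - (t^-1 * k.+1%:R^-1) @[k --> \oo] --> (0 : R).
  rewrite -(oppr0 R); apply: cvgN; rewrite -(mulr0 t^-1).
  by apply: cvgMr; exact: cvg_harmonic.
have H' : expR (- (t^-1 * k.+1%:R^-1)) @[k --> \oo] --> expR (0 : R).
  by apply: continuous_cvg => //; exact: continuous_expR.
by rewrite expR0 in H'.
Qed.

Lemma flat0_cvg_indic (t : R) :
  flat 0 (k%:R * t) @[k --> \oo] --> (((0:R) < t)%R%:R : R).
Proof.
have [t0|t0] := ltP 0 t; first exact: flat0_cvg1.
rewrite (_ : (fun k => _) = cst 0); first exact: cvg_cst.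
by apply/funext => k; rewrite flat_le0// mulr_ge0_le0.
Qed.

(** The indicator is approximated in a weighted norm because, for an
    integrable weight, the sets for which this is possible form a
    sigma-algebra. It contains the half-spaces, hence all Borel sets. *)
Definition approximable w A := measurable A /\ forall e, 0 < e -> exists psi,
  [/\ smooth psi, forall x, 0 <= psi x <= 1 &
      \int[mu]_x (w x * `|\1_A x - psi x|) <= e].

Section approximable.
Variable w : X -> R.
Hypotheses (Lw : L1 mu w) (w0 : forall x, 0 <= w x).

Let L1w g : measurable_fun setT g -> (forall x, `|g x| <= 1) ->
  L1 mu (fun x => w x * `|g x|).
Proof.
move=> mg g1; apply: (@L1M_bounded _ _ _ _ _ _ 1) => //.
  exact: measurableT_comp.
by move=> x; rewrite normr_id.
Qed.

Let indic01 A x : 0 <= (\1_A x : R) <= 1.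
Proof. by rewrite indicE; case: (x \in A); rewrite /= ler01 lexx. Qed.

Let L1wB f g : measurable_fun setT f -> measurable_fun setT g ->
  (forall x, 0 <= f x <= 1) -> (forall x, 0 <= g x <= 1) ->
  L1 mu (fun x => w x * `|f x - g x|).
Proof.
move=> mf mg f1 g1; apply: L1w; first exact: measurable_funB.
move=> x; have /andP[? ?] := f1 x; have /andP[? ?] := g1 x.
by rewrite ler_norml; lra.
Qed.

Lemma approximableC A : approximable w A -> approximable w (~` A).
Proof.
move=> [mA HA]; split; first exact: measurableC.
move=> e /HA[psi [sp p1 Ie]]; exists (fun x => 1 - psi x); split.
- exact: (smoothB (smooth_cst 1) sp).
- by move=> x; have /andP[? ?] := p1 x; apply/andP; split; lra.
- apply: le_trans Ie; rewrite le_eqVlt; apply/orP; left; apply/eqP.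
  apply: eq_Rintegral => x _; rewrite !indicE in_setC; congr (_ * _).
  rewrite -normrN; congr (`| _ |); case: (x \in A) => /=; ring.
Qed.

Lemma approximableI A B : approximable w A -> approximable w B ->
  approximable w (A `&` B).
Proof.
move=> [mA HA] [mB HB]; split; first exact: measurableI.
move=> e e0; have e2 : 0 < e / 2 by rewrite divr_gt0.
have [p [sp p1 Ip]] := HA _ e2; have [q [sq q1 Iq]] := HB _ e2.
exists (fun x => p x * q x); split; first exact: smoothM.
  move=> x; have /andP[? ?] := p1 x; have /andP[? ?] := q1 x.
  by rewrite mulr_ge0//= mulr_ile1.
have m1 : measurable_fun setT (\1_A : X -> R) by exact: measurable_indic.
have m2 : measurable_fun setT (\1_B : X -> R) by exact: measurable_indic.
have mp := smooth_measurable sp; have mq := smooth_measurable sq.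
rewrite (splitr e) (le_trans _ (lerD Ip Iq))// -integral_add; [|exact: L1wB..].
apply: integral_le.
- apply: L1wB => //; first exact/measurable_indic/measurableI.
    exact: measurable_funM.
  move=> x; have /andP[? ?] := p1 x; have /andP[? ?] := q1 x.
  by rewrite mulr_ge0//= mulr_ile1.
- by apply: L1D; exact: L1wB.
- move=> x; rewrite -mulrDr ler_wpM2l// indicI.
  have /andP[? ?] := q1 x; have /andP[? ?] := indic01 A x.
  (* all factors are at most 1, so the errors add up *)
  rewrite (_ : _ - _ = \1_A x * (\1_B x - q x) + (\1_A x - p x) * q x); last first.
    by rewrite /=; ring.
  rewrite (le_trans (ler_normD _ _))// addrC lerD// normrM.
    by rewrite ler_piMr// ger0_norm.
  by rewrite ler_piMl// ger0_norm.
Qed.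

Lemma approximable_seq A (F : nat -> set X) :
  (forall k, approximable w (F k)) -> measurable A ->
  (forall x, (\1_(F k) x : R) @[k --> \oo] --> (\1_A x : R)) -> approximable w A.
Proof.
move=> HF mA FA; split=> // e e0; have e2 : 0 < e / 2 by rewrite divr_gt0.
have m1 B : measurable B -> measurable_fun setT (\1_B : X -> R).
  by move=> mB; exact: measurable_indic.
have [N] : exists N, forall k, (N <= k)%N ->
    `|\int[mu]_x (w x * `|\1_A x - \1_(F k) x|)| <= e / 2.
  apply: (integral_dominated0 (g := w)) => //.
  - move=> k; apply: L1_measurable (L1wB _ _ _ _) => //; apply: m1 => //.
    by have [] := HF k.
  - move=> x; rewrite -[X in _ --> X](mulr0 (w x)); apply: cvgMr.
    rewrite -[X in _ --> X](normr0 R); apply: cvg_norm.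
    rewrite -[X in _ --> X](subrr (\1_A x : R)).
    by apply: cvgB; [exact: cvg_cst|exact: FA].
  - move=> k x; rewrite ger0_norm ?mulr_ge0// ler_piMr//.
    have /andP[? ?] := indic01 A x; have /andP[? ?] := indic01 (F k) x.
    by rewrite ler_norml; lra.
move=> /(_ N (leqnn N)) HN; have [mF HFN] := HF N; have [p [sp p1 Ip]] := HFN _ e2.
exists p; split=> //.
have mp := smooth_measurable sp.
rewrite (splitr e) (le_trans _ (lerD (le_trans (ler_norm _) HN) Ip))//.
rewrite -integral_add; [|by apply: L1wB => //; exact: m1..].
apply: integral_le.
+ by apply: L1wB => //; exact: m1.
+ by apply: L1D; apply: L1wB => //; exact: m1.
+ by move=> x; rewrite -mulrDr ler_wpM2l// ler_distD.
Qed.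

Lemma approximable_bigcup (F : nat -> set X) :
  (forall k, approximable w (F k)) -> approximable w (\bigcup_k F k).
Proof.
move=> HF.
have fin k : approximable w (\big[setU/set0]_(i < k) F i).
  elim: k => [|k IH]; last first.
    rewrite big_ord_recr/= -[X in approximable _ X]setCK setCU.
    by apply: approximableC; apply: approximableI; exact: approximableC.
  rewrite big_ord0; split=> // e e0; exists (cst 0); split.
  - exact: smooth_cst.
  - by move=> x; rewrite lexx ler01.
  - under eq_Rintegral do rewrite indic0 subrr normr0 mulr0.
    by rewrite /Rintegral integral0/= ltW.
apply: (approximable_seq fin).
  by apply: bigcupT_measurable => k; have [] := HF k.
move=> x; have [[i _ Fx]|nF] := pselect ((\bigcup_k F k) x).
  apply: cvg_near_cst; near=> k; rewrite !indicE !mem_set//; first by exists i.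
  rewrite -bigcup_mkord; exists i => //=.
  by near: k; exact: nbhs_infty_gt.
apply: cvg_near_cst; apply: nearW => k; rewrite !indicE !memNset//.
by rewrite -bigcup_mkord => -[i _ Fx]; apply: nF; exists i.
Unshelve. all: by end_near. Qed.

(** [flat 0] of a large multiple of a positive number is close to 1. *)
Lemma approximable_halfspace j (c : R) :
  approximable w [set x : X | c < x ord0 j].
Proof.
have mA : measurable [set x : X | c < x ord0 j].
  have := @measurable_rV_coord R n j measurableT _ (measurable_itv `]c, +oo[).
  by rewrite setTI; congr measurable; apply/seteqP; split=> x /=; rewrite in_itv/= andbT.
split=> // e e0.
pose p (k : nat) (x : X) : R := flat 0 (k%:R * (x ord0 j - c)).
have sp k : smooth (p k).
  apply: (@smooth_flat_comp _ _ 0 (fun x : X => k%:R * (x ord0 j - c))).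
  apply: (smoothM (smooth_cst k%:R)).
  exact: (smoothB (smooth_coord j) (smooth_cst c)).
have p1 k x : 0 <= p k x <= 1 by rewrite flat_ge0 flat0_le1.
have m1 : measurable_fun setT (\1_([set x : X | c < x ord0 j]) : X -> R).
  exact: measurable_indic.
have [N] : exists N, forall k, (N <= k)%N ->
    `|\int[mu]_x (w x * `|\1_([set x : X | c < x ord0 j]) x - p k x|)| <= e.
  apply: (integral_dominated0 (g := w)) => //.
  - move=> k; apply: L1_measurable (L1wB _ _ _ _) => //.
    exact: smooth_measurable.
  - move=> x; rewrite -[X in _ --> X](mulr0 (w x)); apply: cvgMr.
    rewrite -[X in _ --> X](normr0 R); apply: cvg_norm.
    rewrite -[X in _ --> X](subrr (\1_([set x : X | c < x ord0 j]) x : R)).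
    apply: cvgB; first exact: cvg_cst.
    rewrite indicE; have := @flat0_cvg_indic (x ord0 j - c).
    rewrite subr_gt0 (_ : (_ \in _) = (c < x ord0 j)) //.
    by apply/idP/idP; rewrite inE.
  - move=> k x; rewrite ger0_norm ?mulr_ge0// ler_piMr//.
    have /andP[? ?] := indic01 [set x : X | c < x ord0 j] x.
    have /andP[? ?] := p1 k x.
    by rewrite ler_norml; lra.
move=> /(_ N (leqnn N)) HN; exists (p N); split=> //.
exact: le_trans (ler_norm _) HN.
Qed.

Lemma measurable_approximable A : measurable A -> approximable w A.
Proof.
suff H : @measurable _ X `<=` approximable w by move=> /H.
apply: smallest_sub; first split.
- split=> // e e0; exists (cst 0); split.
  + exact: smooth_cst.
  + by move=> x; rewrite lexx ler01.
  + under eq_Rintegral do rewrite indic0 subrr normr0 mulr0.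
    by rewrite /Rintegral integral0/= ltW.
- by move=> B HB; rewrite setTD; exact: approximableC.
- exact: approximable_bigcup.
- rewrite -bigcup_seq => B [j _] [C mC <-]; rewrite setTI.
  pose S : set (set R) := [set C | approximable w ((fun x : X => x ord0 j) @^-1` C)].
  suff : @measurable _ R `<=` S by apply.
  rewrite -[@measurable _ R]/(@measurable _ (measurableTypeR R)) RGenOInfty.measurableE.
  apply: smallest_sub; first split.
  + rewrite /S/= preimage_set0; split=> // e e0; exists (cst 0); split.
    * exact: smooth_cst.
    * by move=> x; rewrite lexx ler01.
    * under eq_Rintegral do rewrite indic0 subrr normr0 mulr0.
      by rewrite /Rintegral integral0/= ltW.
  + by move=> D HD; rewrite /S/= setTD preimage_setC; exact: approximableC.
  + by move=> D HD; rewrite /S/= preimage_bigcup; exact: approximable_bigcup.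
  + move=> _ [c ->]; rewrite /S/=.
    have := approximable_halfspace j c; congr approximable.
    by apply/seteqP; split=> x /=; rewrite in_itv/= andbT.
Qed.

End approximable.

Definition sqnorm (x : X) : R := \sum_j x ord0 j ^+ 2.

Lemma smooth_sqnorm : smooth sqnorm.
Proof.
apply: smooth_sum => j; rewrite (_ : (fun x => _) = fun x : X => x ord0 j * x ord0 j).
  by apply: smoothM; exact: smooth_coord.
by apply/funext => x; rewrite expr2.
Qed.

Lemma sqnorm_ge x : `|x| ^+ 2 <= sqnorm x.
Proof.
have [->|x0] := eqVneq `|x| 0; first by rewrite expr0n/= sumr_ge0// => j _; exact: sqr_ge0.
have [[i j] /= E] := mx_norm_neq0 x0.
rewrite [`|x|]E real_normK ?num_real// (ord1 i) /sqnorm (bigD1 j)//= lerDl.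
by rewrite sumr_ge0// => k _; exact: sqr_ge0.
Qed.

(** These functions increase to the indicator of the open Euclidean ball of
    radius [N] as [k] grows. *)
Definition bump (N : R) (k : nat) (x : X) : R :=
  flat 0 (k%:R * (N ^+ 2 - sqnorm x)).

Lemma smooth_bump N k : smooth (bump N k).
Proof.
apply: (@smooth_flat_comp _ _ 0 (fun x : X => k%:R * (N ^+ 2 - sqnorm x))).
apply: (smoothM (smooth_cst k%:R)).
exact: (smoothB (smooth_cst (N ^+ 2)) smooth_sqnorm).
Qed.

Lemma bump01 N k x : 0 <= bump N k x <= 1.
Proof. by rewrite flat_ge0 flat0_le1. Qed.

Lemma bump_supp (N : R) k x : 0 <= N -> bump N k x != 0 -> sqnorm x < N ^+ 2.
Proof.
move=> N0; rewrite /bump; apply: contraNT; rewrite -leNgt => Nx.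
by rewrite flat_le0// mulr_ge0_le0// subr_le0.
Qed.

Lemma test_bump N k : 0 <= N -> test_function setT (bump N k).
Proof.
move=> N0; apply/test_functionP; split; first exact: smooth_bump.
exists N => x /(bump_supp N0) xN.
by rewrite -(ler_sqr (normr_ge0 _)) ?nnegrE// (le_trans (sqnorm_ge x))// ltW.
Qed.

Definition sball (N : R) : set X := [set x | sqnorm x < N ^+ 2].

Lemma measurable_sball N : measurable (sball N).
Proof.
have m1 := smooth_measurable smooth_sqnorm.
have := m1 measurableT _ (measurable_itv `]-oo, N ^+ 2[).
by rewrite setTI; congr measurable; apply/seteqP; split=> x /=; rewrite in_itv.
Qed.

Lemma sball_finite N : 0 <= N -> (mu (sball N) < +oo)%E.
Proof.
move=> N0; apply: le_lt_trans (nball_finite N); apply: le_measure; rewrite ?inE.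
- exact: measurable_sball.
- exact: measurable_nball.
- move=> x xN; rewrite /nball/= -(ler_sqr (normr_ge0 _)) ?nnegrE//.
  by rewrite (le_trans (sqnorm_ge x))// ltW.
Qed.

Lemma bump_cvg N x : bump N k x @[k --> \oo] --> (\1_(sball N) x : R).
Proof.
rewrite indicE; have := @flat0_cvg_indic (N ^+ 2 - sqnorm x).
rewrite subr_gt0 (_ : (_ \in _) = (sqnorm x < N ^+ 2))//.
by apply/idP/idP; rewrite inE.
Qed.

Lemma indic_sball_cvg x : (\1_(sball k%:R) x : R) @[k --> \oo] --> (1 : R).
Proof.
apply: cvg_near_cst; near=> k; rewrite indicE mem_set// /sball/=.
have k1 : sqnorm x + 1 <= k%:R.
  near: k; exact: nbhs_infty_ger.
have s0 : 0 <= sqnorm x by apply: le_trans (sqnorm_ge x); exact: sqr_ge0.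
by nra.
Unshelve. all: by end_near. Qed.

(** With [w := `|f|] this approximates the sign of [f] by test functions. *)
Lemma test_approx_indic w A e : L1 mu w -> (forall x, 0 <= w x) ->
  measurable A -> 0 < e -> exists psi, [/\ test_function setT psi,
    forall x, 0 <= psi x <= 1 & \int[mu]_x (w x * `|\1_A x - psi x|) <= e].
Proof.
move=> Lw w0 mA e0; have e3 : 0 < e / 3 by rewrite divr_gt0.
have L1w g : measurable_fun setT g -> (forall x, `|g x| <= 1) ->
    L1 mu (fun x => w x * `|g x|).
  move=> mg g1; apply: (@L1M_bounded _ _ _ _ _ _ 1) => //.
    exact: measurableT_comp.
  by move=> x; rewrite normr_id.
have [_ /(_ _ e3)[p [sp p1 Ip]]] := measurable_approximable Lw w0 mA.
have mp := smooth_measurable sp.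
have mi B : measurable B -> measurable_fun setT (\1_B : X -> R).
  by move=> mB; exact: measurable_indic.
have [N] : exists N, forall k, (N <= k)%N ->
    `|\int[mu]_x (w x * `|1 - \1_(sball k%:R) x|)| <= e / 3.
  apply: (integral_dominated0 (g := w)) => //.
  - move=> k; apply: measurable_funM; first exact: L1_measurable Lw.
    apply: measurableT_comp => //; apply: measurable_funB => //.
    by apply: mi; exact: measurable_sball.
  - move=> x; rewrite -(mulr0 (w x)); apply: cvgMr.
    rewrite -(normr0 R); apply: cvg_norm; rewrite -(subrr (1 : R)).
    by apply: cvgB; [exact: cvg_cst|exact: indic_sball_cvg].
  - move=> k x; rewrite ger0_norm ?mulr_ge0// ler_piMr// indicE.
    by case: (_ \in _) => /=; rewrite ?subrr ?normr0 ?subr0 ?normr1.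
move=> /(_ N (leqnn N)) HN.
have [M] : exists M, forall k, (M <= k)%N ->
    `|\int[mu]_x (w x * `|\1_(sball N%:R) x - bump N%:R k x|)| <= e / 3.
  apply: (integral_dominated0 (g := w)) => //.
  - move=> k; apply: measurable_funM; first exact: L1_measurable Lw.
    apply: measurableT_comp => //; apply: measurable_funB => //.
      by apply: mi; exact: measurable_sball.
    by apply: smooth_measurable; exact: smooth_bump.
  - move=> x; rewrite -(mulr0 (w x)); apply: cvgMr.
    rewrite -(normr0 R); apply: cvg_norm; rewrite -(subrr (\1_(sball N%:R) x : R)).
    by apply: cvgB; [exact: cvg_cst|exact: bump_cvg].
  - move=> k x; rewrite ger0_norm ?mulr_ge0// ler_piMr// indicE.
    have /andP[? ?] := bump01 N%:R k x.
    by rewrite ler_norml; case: (_ \in _) => /=; lra.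
move=> /(_ M (leqnn M)) HM.
pose b := bump N%:R M.
have b1 x : 0 <= b x <= 1 by exact: bump01.
have tb : test_function setT b by exact: test_bump.
exists (fun x => p x * b x); split.
- exact: testM.
- move=> x; have /andP[? ?] := p1 x; have /andP[? ?] := b1 x.
  by rewrite mulr_ge0//= mulr_ile1.
- have -> : e = e / 3 + (e / 3 + e / 3) by field.
  rewrite (le_trans _ (lerD Ip (lerD (le_trans (ler_norm _) HN) (le_trans (ler_norm _) HM))))//.
  have mb := test_measurable tb.
  have i01 (B : set X) x : 0 <= (\1_B x : R) <= 1.
    by rewrite indicE; case: (x \in B); rewrite /= ler01 lexx.
  have La : L1 mu (fun x => w x * `|\1_A x - p x|).
    apply: L1w; first by apply: measurable_funB => //; exact: mi.
    move=> x; have /andP[? ?] := p1 x; have /andP[? ?] := i01 A x.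
    by rewrite ler_norml; lra.
  have Lb : L1 mu (fun x => w x * `|1 - \1_(sball N%:R) x|).
    apply: L1w; first by apply: measurable_funB => //; apply: mi; exact: measurable_sball.
    move=> x; have /andP[? ?] := i01 (sball N%:R) x.
    by rewrite ler_norml; lra.
  have Lc : L1 mu (fun x => w x * `|\1_(sball N%:R) x - b x|).
    apply: L1w; first by apply: measurable_funB => //; apply: mi; exact: measurable_sball.
    move=> x; have /andP[? ?] := i01 (sball N%:R) x; have /andP[? ?] := b1 x.
    by rewrite ler_norml; lra.
  rewrite -(integral_add Lb Lc) -integral_add//; last exact: L1D.
  apply: integral_le.
  + apply: L1w; first by apply: measurable_funB; [exact: mi|exact: measurable_funM].
    move=> x; have /andP[? ?] := p1 x; have /andP[? ?] := b1 x.
    have /andP[? ?] := i01 A x; have : 0 <= p x * b x <= 1.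
      by rewrite mulr_ge0//= mulr_ile1.
    by move=> /andP[? ?]; rewrite ler_norml; lra.
  + by apply: L1D => //; exact: L1D.
  + move=> x; rewrite -!mulrDr ler_wpM2l//.
    have /andP[? ?] := p1 x; have /andP[? ?] := b1 x.
    rewrite (_ : _ - p x * b x = (\1_A x - p x) + p x * ((1 - \1_(sball N%:R) x) + (\1_(sball N%:R) x - b x))); last by ring.
    rewrite (le_trans (ler_normD _ _))// lerD2l normrM ger0_norm//.
    by rewrite (le_trans (ler_piMl _ _))// ler_normD.
Qed.

(** The integral of [`|f|] is the integral of [f] against the sign of [f], and
    the sign is approximated by test functions up to an arbitrarily small
    error. *)
Lemma L1_norm_duality f (C : R) : L1 mu f ->
  (forall psi, test_function setT psi -> (forall x, `|psi x| <= 1) ->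
     \int[mu]_x (f x * psi x) <= C) ->
  \int[mu]_x `|f x| <= C.
Proof.
move=> Lf HC; apply/ler_addgt0Pr => e e0; have e2 : 0 < e / 2 by rewrite divr_gt0.
have mf := L1_measurable Lf; have La := L1_norm Lf.
have mA : measurable [set x | 0 < f x].
  have := mf measurableT _ (measurable_itv `]0, +oo[).
  by rewrite setTI; congr measurable; apply/seteqP; split=> x /=; rewrite in_itv/= andbT.
have mB : measurable [set x | f x < 0].
  have := mf measurableT _ (measurable_itv `]-oo, 0[).
  by rewrite setTI; congr measurable; apply/seteqP; split=> x /=; rewrite in_itv.
have [p [tp p1 Ip]] := test_approx_indic La (fun x => normr_ge0 _) mA e2.
have [q [tq q1 Iq]] := test_approx_indic La (fun x => normr_ge0 _) mB e2.
have tpq := testB tp tq.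
have H : \int[mu]_x (f x * (p x - q x)) <= C.
  apply: HC => // x; have /andP[? ?] := p1 x; have /andP[? ?] := q1 x.
  by rewrite ler_norml; lra.
have i01 (B : set X) x : 0 <= (\1_B x : R) <= 1.
  by rewrite indicE; case: (x \in B); rewrite /= ler01 lexx.
have LA (B : set X) r : measurable B -> test_function setT r -> (forall x, 0 <= r x <= 1) ->
    L1 mu (fun x => `|f x| * `|\1_B x - r x|).
  move=> mB' tr r1; apply: (@L1M_bounded _ _ _ _ _ _ 1) => //.
    apply: measurableT_comp => //; apply: measurable_funB; first exact: measurable_indic.
    exact: test_measurable.
  move=> x; have /andP[? ?] := i01 B x; have /andP[? ?] := r1 x.
  by rewrite normr_id ler_norml; lra.
have Lfpq := L1M_test Lf tpq.
rewrite (splitr e) (le_trans _ (lerD H (lerD Ip Iq)))//.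
rewrite -integral_add; [|exact: LA..].
rewrite -integral_add//; last by apply: L1D; exact: LA.
apply: integral_le => //.
  by apply: L1D => //; apply: L1D; exact: LA.
move=> x; rewrite !indicE.
have /andP[? ?] := p1 x; have /andP[? ?] := q1 x.
have [f0|f0|f0] := ltgtP (f x) 0.
- rewrite memNset/=; last by rewrite /= ltNge ltW.
  rewrite mem_set//= ltr0_norm// sub0r normrN !ger0_norm ?subr_ge0//.
  by nra.
- rewrite mem_set//= memNset/=; last by rewrite /= ltNge ltW.
  rewrite gtr0_norm// sub0r normrN !ger0_norm ?subr_ge0//.
  by nra.
- by rewrite f0 normr0 !mul0r !addr0.
Qed.

Let L1_dense f := forall e, 0 < e ->
  exists2 psi, test_function setT psi & \int[mu]_x `|f x - psi x| <= e.

Let L1_dense_indic (A : set X) (N : R) : 0 <= N -> measurable A ->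
  A `<=` sball N -> L1_dense \1_A.
Proof.
move=> N0 mA AN e e0; have e2 : 0 < e / 2 by rewrite divr_gt0.
have mB := measurable_sball N.
have LB : L1 mu \1_(sball N) by apply: L1_indic => //; exact: sball_finite.
have i01 (B : set X) x : 0 <= (\1_B x : R) <= 1.
  by rewrite indicE; case: (x \in B); rewrite /= ler01 lexx.
have iB x : 0 <= (\1_(sball N) x : R) by have /andP[] := i01 (sball N) x.
have [_ /(_ _ e2)[p [sp p1 Ip]]] := measurable_approximable LB iB mA.
have mp := smooth_measurable sp.
have mi (B : set X) : measurable B -> measurable_fun setT (\1_B : X -> R).
  by move=> mB'; exact: measurable_indic.
have [M] : exists M, forall k, (M <= k)%N ->
    `|\int[mu]_x (`|\1_(sball N) x - bump N k x|)| <= e / 2.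
  apply: (integral_dominated0 (g := \1_(sball N))) => //.
  - move=> k; apply: measurableT_comp => //; apply: measurable_funB; first exact: mi.
    by apply: smooth_measurable; exact: smooth_bump.
  - move=> x; rewrite -(normr0 R); apply: cvg_norm; rewrite -(subrr (\1_(sball N) x : R)).
    by apply: cvgB; [exact: cvg_cst|exact: bump_cvg].
  - move=> k x; rewrite normr_id indicE; have /andP[? ?] := bump01 N k x.
    have [xN|xN] := boolP (x \in sball N).
      by rewrite /= ler_norml; lra.
    have [->|/(bump_supp N0) ?] := eqVneq (bump N k x) 0; first by rewrite subrr normr0.
    by move: xN; rewrite notin_setE.
move=> /(_ M (leqnn M)) HM; pose b := bump N M.
have b1 x : 0 <= b x <= 1 by exact: bump01.
have tb : test_function setT b by exact: test_bump.
have mb := test_measurable tb.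
exists (fun x => p x * b x); first exact: testM.
have La : L1 mu (fun x => \1_(sball N) x * `|\1_A x - p x|).
  apply: (@L1M_bounded _ _ _ _ _ _ 1) => //.
    by apply: measurableT_comp => //; apply: measurable_funB => //; exact: mi.
  move=> x; have /andP[? ?] := p1 x; have /andP[? ?] := i01 A x.
  by rewrite normr_id ler_norml; lra.
have Lb : L1 mu (fun x => `|\1_(sball N) x - b x|).
  by apply/L1_norm/L1B => //; exact: L1_test.
rewrite (splitr e) (le_trans _ (lerD Ip (le_trans (ler_norm _) HM)))//.
rewrite -(integral_add La Lb); apply: integral_le.
- apply/L1_norm/L1B; last by apply: L1_test; exact: testM.
  apply: L1_indic => //; apply: le_lt_trans (sball_finite N0).
  by apply: le_measure; rewrite ?inE.
- exact: L1D.
- move=> x; have /andP[? ?] := p1 x; have /andP[? ?] := b1 x.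
  have [xN|xN] := boolP (x \in sball N).
    have -> : (\1_(sball N) x : R) = 1 by rewrite indicE xN.
    rewrite mul1r.
    rewrite (_ : _ - p x * b x = (\1_A x - p x) + p x * (1 - b x)); last by ring.
    rewrite (le_trans (ler_normD _ _))// lerD2l normrM ger0_norm//.
    by rewrite ler_piMl.
  have -> : b x = 0.
    apply: contra_notP (_ : ~ sball N x) => [/eqP/(bump_supp N0)//|].
    by move: xN; rewrite notin_setE.
  have -> : (\1_A x : R) = 0.
    by rewrite indicE memNset// => /AN; move: xN; rewrite notin_setE.
  by rewrite mulr0 !subr0 normr0 addr_ge0// mulr_ge0.
Qed.

Let L1_denseD f g : L1 mu f -> L1 mu g -> L1_dense f -> L1_dense g ->
  L1_dense (fun x => f x + g x).
Proof.
move=> Lf Lg Df Dg e e0; have e2 : 0 < e / 2 by rewrite divr_gt0.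
have [p tp Ip] := Df _ e2; have [q tq Iq] := Dg _ e2.
have sq : smooth (fun x => - q x).
  rewrite (_ : (fun x => _) = fun x => (cst 0 : X -> R) x - q x).
    exact: (smoothB (smooth_cst 0) (test_smooth tq)).
  by apply/funext => x; rewrite /= sub0r.
have tpq : test_function setT (fun x => p x - - q x).
  apply: testB => //; apply/test_functionP; split=> //.
  by have /test_functionP[_ [N HN]] := tq; exists N => x; rewrite oppr_eq0 => /HN.
have Lp := L1_test tp; have Lq := L1_test tq.
exists (fun x => p x - - q x) => //.
rewrite (splitr e) (le_trans _ (lerD Ip Iq))// -integral_add; [|exact/L1_norm/L1B..].
apply: integral_le.
- by apply/L1_norm/L1B; [exact: L1D|exact: L1_test].
- by apply: L1D; exact/L1_norm/L1B.
- move=> x; rewrite opprK opprD addrACA; exact: ler_normD.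
Qed.

Let L1_denseZ (c : R) f : L1 mu f -> L1_dense f -> L1_dense (fun x => c * f x).
Proof.
move=> Lf Df e e0; have c0 : 0 < `|c| + 1 by rewrite ltr_wpDl.
have [p tp Ip] := Df _ (divr_gt0 e0 c0).
exists (fun x => c * p x).
  exact: (testM (smooth_cst c) tp).
have Lp := L1_test tp.
apply: (@le_trans _ _ (\int[mu]_x ((`|c| + 1) * `|f x - p x|))).
  apply: integral_le.
  - by apply/L1_norm/L1B; exact: L1Z.
  - exact/L1Z/L1_norm/L1B.
  - by move=> x; rewrite -mulrBr normrM ler_wpM2r// lerDl.
rewrite integral_scale; last exact/L1_norm/L1B.
by rewrite mulrC -ler_pdivlMr.
Qed.

Import HBSimple.

(** Through simple functions, cut off to a ball so that all their level sets,
    that of 0 included, have finite measure. *)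
Lemma test_dense f e : L1 mu f -> 0 < e ->
  exists2 psi, test_function setT psi & \int[mu]_x `|f x - psi x| <= e.
Proof.
move=> Lf e0; have e3 : 0 < e / 3 by rewrite divr_gt0.
have [s_ [Ls _ cs]] := approximation_sfun_integrable measurableT Lf.
have [k Hk] : exists k, \int[mu]_x `|f x - s_ k x| <= e / 3.
  have Lk k : L1 mu (fun x => `|f x - s_ k x|) by apply/L1_norm/L1B => //; exact: Ls.
  move: cs => /fine_cvgP[_] /cvgrPdist_le/(_ _ e3)[N _ /(_ N (leqnn N))] /=.
  rewrite sub0r normrN => H; exists N.
  apply: (le_trans (ler_norm _)); apply: le_trans H.
  by rewrite /Rintegral.
pose s := s_ k; have {}Ls : L1 mu s by exact: Ls.
have [N] : exists N, forall i, (N <= i)%N ->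
    `|\int[mu]_x (`|s x - s x * \1_(sball i%:R) x|)| <= e / 3.
  apply: (integral_dominated0 (g := fun x => `|s x|)) => //.
  - move=> j; apply: measurableT_comp => //; apply: measurable_funB => //.
    by apply: measurable_funM => //; apply: measurable_indic; exact: measurable_sball.
  - move=> x; rewrite -(normr0 R); apply: cvg_norm; rewrite -(subrr (s x)).
    apply: cvgB; first exact: cvg_cst.
    by rewrite -[X in _ --> X]mulr1; apply: cvgMr; exact: indic_sball_cvg.
  - exact: L1_norm.
  - move=> j x; rewrite normr_id indicE.
    by case: (_ \in _); rewrite ?mulr1 ?mulr0 ?subrr ?subr0 ?normr0.
move=> /(_ N (leqnn N)) HN.
pose B := sball N%:R; have mB : measurable B by exact: measurable_sball.
have N0 : 0 <= N%:R :> R by [].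
have Boo := sball_finite N0.
have mA y : measurable (s @^-1` [set y] `&` B).
  by apply: measurableI => //; exact: measurable_sfunP.
have LA y : L1 mu \1_(s @^-1` [set y] `&` B).
  apply: L1_indic => //; apply: le_lt_trans Boo.
  by apply: le_measure; rewrite ?inE// ; exact: subIsetr.
pose r : seq R := finmap.enum_fset (fset_set (range s)).
pose g x := \sum_(y <- r) y * \1_(s @^-1` [set y] `&` B) x.
have sE x : s x * \1_B x = g x.
  rewrite [in LHS]fimfunE fsbig_finite//= mulr_suml; apply: eq_bigr => y _.
  by rewrite -mulrA indicI.
have [p tp Ip] : exists2 psi, test_function setT psi & \int[mu]_x `|g x - psi x| <= e / 3.
  suff : L1_dense g by apply.
  have : forall r' : seq R, L1_dense (fun x => \sum_(y <- r') y * \1_(s @^-1` [set y] `&` B) x).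
    elim=> [|y r' IH].
      move=> e' e'0; exists (cst 0).
        apply/test_functionP; split; first exact: smooth_cst.
        by exists 0 => x; rewrite eqxx.
      under eq_Rintegral do rewrite big_nil subrr normr0.
      by rewrite /Rintegral integral0 ltW.
    rewrite (_ : (fun x => _) = fun x => y * \1_(s @^-1` [set y] `&` B) x +
      \sum_(y <- r') y * \1_(s @^-1` [set y] `&` B) x); last first.
      by apply/funext => x; rewrite big_cons.
    apply: L1_denseD => //.
    - exact: L1Z.
    - by apply: L1_sum => z; exact: L1Z.
    - apply: L1_denseZ => //; apply: (L1_dense_indic N0) => //; exact: subIsetr.
  exact.
have Lg : L1 mu g by apply: L1_sum => z; exact: L1Z.
have Lp := L1_test tp.
exists p => //.
have -> : e = e / 3 + (e / 3 + e / 3) by field.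
rewrite (le_trans _ (lerD Hk (lerD (le_trans (ler_norm _) HN) Ip)))//.
have Lsg : L1 mu (fun x => `|s x - s x * \1_B x|).
  by apply/L1_norm/L1B => //; under eq_fun do rewrite sE.
rewrite -[X in _ <= _ + X]integral_add => //; last exact/L1_norm/L1B.
have Lfs : L1 mu (fun x => `|f x - s x|) by exact/L1_norm/L1B.
have Lgp : L1 mu (fun x => `|g x - p x|) by exact/L1_norm/L1B.
rewrite -integral_add//; last exact: L1D.
apply: integral_le.
- exact/L1_norm/L1B.
- by apply: L1D => //; exact: L1D.
- move=> x; rewrite sE (_ : f x - p x = (f x - s x) + ((s x - g x) + (g x - p x))); last by ring.
  by rewrite (le_trans (ler_normD _ _))// lerD2l ler_normD.
Qed.

End density.

(** * Translations and weak derivatives on R^n *)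

Section weak_derivatives.
Context {R : realType} {n : nat}.
Local Notation mu := (@borel_lebesgue R n).
Local Notation X := 'rV[R]_n.
Local Notation "''e_' j" := (delta_mx ord0 j : 'rV[R]_n) (at level 8, j at level 2).
Implicit Types (f g V psi : X -> R) (j : 'I_n).

Let pushE (v : X) (f : X -> \bar R) :
  (\int[mu]_x f x = \int[pushforward mu (fun x => (x + v)%R)]_x f x)%E.
Proof.
apply: eq_measure_integral => [|m A mA _]; first exact: measurable_shift_rV.
exact: (esym (borel_lebesgue_shift v mA)).
Qed.

Lemma ge0_integral_shift (v : X) (f : X -> \bar R) :
  measurable_fun [set: X] f -> (forall x, 0 <= f x)%E ->
  (\int[mu]_x f (x + v)%R = \int[mu]_x f x)%E.
Proof.
move=> mf f0; rewrite [RHS](pushE v) ge0_integral_pushforward//.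
exact: measurable_shift_rV.
Qed.

Lemma integral_shift (v : X) f : measurable_fun [set: X] f ->
  \int[mu]_x f (x + v) = \int[mu]_x f x.
Proof.
move=> mf; rewrite /Rintegral integralE [in RHS]integralE; congr (fine (_ - _)%E).
- rewrite -[RHS](@ge0_integral_shift v).
  + by apply: eq_integral => x _; rewrite !funeposE.
  + by apply: measurable_funepos; exact/measurable_EFinP.
  + by [].
- rewrite -[RHS](@ge0_integral_shift v).
  + by apply: eq_integral => x _; rewrite !funenegE.
  + by apply: measurable_funeneg; exact/measurable_EFinP.
  + by [].
Qed.

Lemma L1_shift (v : X) f : L1 mu f -> L1 mu (fun x => f (x + v)).
Proof.
move=> Lf; have /integrableP[mf foo] := Lf; apply/integrableP; split.
  by apply: (measurableT_comp mf); exact: measurable_shift_rV.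
have := ge0_integral_shift v (measurableT_comp (@abse_measurable R setT) mf).
by move=> /= ->.
Qed.

Lemma is_derive_line psi j (x : X) (t : R) : smooth psi ->
  is_derive t 1 (fun t => psi (x + t *: 'e_j)) (partial j psi (x + t *: 'e_j)).
Proof.
move=> sp; have [d1 d2] := smooth_is_derive (x + t *: 'e_j) j sp.
have E : (fun h : R => h^-1 *: (((fun t : R => psi (x + t *: 'e_j)) \o shift t) (h *: 1) -
      psi (x + t *: 'e_j))) =
    (fun h : R => h^-1 *: ((psi \o shift (x + t *: 'e_j)) (h *: 'e_j) - psi (x + t *: 'e_j))).
  by apply/funext => h /=; rewrite [h%:A]mulr1 scalerDl addrCA.
by apply: DeriveDef; [rewrite /derivable E|rewrite /derive E].
Qed.

(** By density of test functions, for which the mean value inequality applies. *)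
Lemma L1_shift_continuous f j e : L1 mu f -> 0 < e ->
  exists2 d, 0 < d & forall t : R, `|t| <= d ->
    \int[mu]_x `|f (x + t *: 'e_j) - f x| <= e.
Proof.
move=> Lf e0; have e3 : 0 < e / 3 by rewrite divr_gt0.
have [p tp Ip] := test_dense Lf e3.
have [M M0 HM] := test_bounded (test_partial j tp).
have /test_functionP[sp [N HN]] := tp.
pose B := nball (N + 1) : set X.
pose K := fine (mu B).
have K0 : 0 <= K by exact: fine_ge0.
have MK : 0 < 3 * (M * K + 1) by rewrite mulr_gt0// ltr_wpDl// mulr_ge0.
have LB : L1 mu (\1_B : X -> R).
  by apply: L1_indic; [exact: measurable_nball|exact: nball_finite].
exists (Num.min 1 (e / (3 * (M * K + 1)))); first by rewrite lt_min ltr01 divr_gt0.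
move=> t; rewrite le_min => /andP[t1 te].
have Lp := L1_test tp.
have Lpt := L1_shift (t *: 'e_j) Lp; have Lft := L1_shift (t *: 'e_j) Lf.
have ne : `|'e_j| <= 1.
  have [->//|x0] := eqVneq `|'e_j| 0.
  have [[i k] /= E] := mx_norm_neq0 x0.
  by rewrite [leLHS]E mxE; case: (_ && _); rewrite ?normr1// normr0.
have IB : \int[mu]_x \1_B x = K.
  by rewrite /Rintegral /K integral_indic ?setIT//; exact: measurable_nball.
have H3 : \int[mu]_x `|p (x + t *: 'e_j) - p x| <= e / 3.
  apply: (@le_trans _ _ (\int[mu]_x ((M * `|t|) * \1_B x))).
    apply: integral_le; first exact/L1_norm/L1B.
      exact: L1Z.
    move=> x; have [xB|xB] := boolP (x \in B).
      by rewrite indicE xB mulr1; exact: smooth_lipschitz.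
    have nx : N + 1 < `|x| by move: xB; rewrite notin_setE /B /nball/= => /negP; rewrite -ltNge.
    have -> : p x = 0.
      by apply/eqP; apply: contraTT nx => /HN H; rewrite -leNgt (le_trans H)// lerDl.
    have -> : p (x + t *: 'e_j) = 0.
      apply/eqP; apply: contraTT nx => /HN H; rewrite -leNgt.
      rewrite -[x](addrK (t *: 'e_j)) (le_trans (ler_normB _ _))// lerD//.
      by rewrite normrZ mulr_ile1.
    by rewrite subrr normr0 !mulr_ge0// indicE.
  rewrite integral_scale// IB mulrAC.
  apply: (@le_trans _ _ ((M * K + 1) * `|t|)); first by rewrite ler_wpM2r// lerDl.
  rewrite mulrC -ler_pdivlMr; last by rewrite ltr_wpDl// mulr_ge0.
  by rewrite -mulrA -invfM.
have Ip' : \int[mu]_x `|f (x + t *: 'e_j) - p (x + t *: 'e_j)| <= e / 3.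
  rewrite (integral_shift (t *: 'e_j) (f := fun x => `|f x - p x|))//.
  by apply: (@L1_measurable _ _ _ mu); exact/L1_norm/L1B.
have -> : e = e / 3 + (e / 3 + e / 3) by field.
rewrite (le_trans _ (lerD Ip (lerD Ip' H3)))//.
have L_a : L1 mu (fun x => `|f x - p x|) by exact/L1_norm/L1B.
have L_b : L1 mu (fun x => `|f (x + t *: 'e_j) - p (x + t *: 'e_j)|) by exact/L1_norm/L1B.
have L_c : L1 mu (fun x => `|p (x + t *: 'e_j) - p x|) by exact/L1_norm/L1B.
rewrite -(integral_add L_b L_c) -integral_add//; last exact: L1D.
apply: integral_le; [exact/L1_norm/L1B|by apply: L1D => //; exact: L1D|].
move=> x; rewrite (_ : _ - f x = - (f x - p x) + ((f (x + t *: 'e_j) - p (x + t *: 'e_j)) +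
  (p (x + t *: 'e_j) - p x))); last by ring.
by rewrite (le_trans (ler_normD _ _))// normrN lerD2l ler_normD.
Qed.

Definition weak_partial j V g := forall psi, test_function setT psi ->
  \int[mu]_x (V x * partial j psi x) = - \int[mu]_x (g x * psi x).

(** After a change of variables the translation falls on the test function.
    The integral is then differentiable in the length of the translation, the
    weak derivative computes its derivative, and the mean value theorem
    applies. *)
Lemma weak_partial_mvt j V g psi (h : R) : L1 mu V -> L1 mu g ->
  weak_partial j V g -> test_function setT psi -> 0 < h ->
  exists2 t, 0 < t < h & \int[mu]_x ((V (x + h *: 'e_j) - V x) * psi x) =
    h * \int[mu]_x (g (x + t *: 'e_j) * psi x).
Proof.
move=> LV Lg Vg tp h0; have sp := test_smooth tp.
pose F (t : R) (x : X) := V x * psi (x + t *: 'e_j).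
pose b (t : R) := \int[mu]_x F t x.
have [M M0 HM] := test_bounded (test_partial j tp).
have LF t : L1 mu (F t) by apply: L1M_test => //; exact: test_shift.
have dF (t : R) x : is_derive t 1 (F ^~ x) (V x * partial j psi (x + t *: 'e_j)).
  exact: (is_deriveZ (V x) (is_derive_line j x t sp)).
have db (t : R) : is_derive t 1 b (- \int[mu]_x (g x * psi (x + t *: 'e_j))).
  have It : [set` `]t - 1, t + 1[] t by rewrite /= in_itv/=; apply/andP; split; lra.
  have d1 : forall (x : R) (y : X), [set` `]t - 1, t + 1[] x -> setT y ->
      derivable (F ^~ y) x 1 by move=> x y _ _; have [] := dF x y.
  have LG : mu.-integrable setT (EFin \o (fun x => M * `|V x|)) by exact/L1Z/L1_norm.
  have ub : forall (x : R) (y : X), [set` `]t - 1, t + 1[] x -> setT y ->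
      `|partial1of2 F x y| <= M * `|V y|.
    move=> x y _ _; rewrite partial1of2E; have [_ ->] := dF x y.
    by rewrite normrM mulrC ler_wpM2r.
  have G0 y : 0 <= M * `|V y| by rewrite mulr_ge0.
  apply: DeriveDef.
    exact: (@derivable_under_integral _ _ _ mu F setT measurableT t (t - 1) (t + 1) It
      (fun x _ => LF x) d1 _ G0 LG ub).
  rewrite -derive1E (@differentiation_under_integral _ _ _ mu F setT measurableT t (t - 1) (t + 1) It
      (fun x _ => LF x) d1 _ G0 LG ub).
  rewrite -(Vg _ (test_shift (t *: 'e_j) tp)).
  apply: eq_Rintegral => x _; rewrite partial1of2E; have [_ ->] := dF t x.
  by rewrite partial_shift.
have Nh0 : - h < 0 by rewrite oppr_lt0.
have cb : {within `[- h, 0], continuous b}.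
  apply: continuous_subspaceT => t.
  by apply/differentiable_continuous/derivable1_diffP; case: (db t).
have [c] := MVT Nh0 (fun x _ => db x) cb.
rewrite in_itv/= => /andP[c1 c2] bE; exists (- c); first by apply/andP; split; lra.
have Lh := L1_shift (h *: 'e_j) LV.
under eq_Rintegral do rewrite mulrBl.
rewrite integral_sub; [|exact: L1M_test..].
have -> : \int[mu]_x (V (x + h *: 'e_j) * psi x) = b (- h).
  rewrite /b -[RHS](integral_shift (h *: 'e_j)); last exact: L1_measurable (LF _).
  by apply: eq_Rintegral => x _; rewrite /F scaleNr addrK.
have -> : \int[mu]_x (V x * psi x) = b 0.
  by apply: eq_Rintegral => x _; rewrite /F scale0r addr0.
rewrite -opprB bE opprK add0r mulNr opprK mulrC; congr (_ * _).
rewrite -[RHS](integral_shift (c *: 'e_j)); last first.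
  by apply: (@L1_measurable _ _ _ mu); apply: L1M_test => //; exact: L1_shift.
by apply: eq_Rintegral => x _; rewrite scaleNr addrK.
Qed.

(** By duality it is enough to test against bounded smooth functions, and
    [weak_partial_mvt] expresses these integrals through [g]. *)
Lemma weak_partial_shift_le j V g (h : R) : L1 mu V -> L1 mu g ->
  weak_partial j V g -> 0 <= h ->
  \int[mu]_x `|V (x + h *: 'e_j) - V x| <= h * \int[mu]_x `|g x|.
Proof.
move=> LV Lg Vg; rewrite le_eqVlt => /predU1P[<-|h0].
  rewrite mul0r; under eq_Rintegral do rewrite scale0r addr0 subrr normr0.
  by rewrite /Rintegral integral0.
apply: L1_norm_duality => [|psi tp p1]; first by apply: L1B => //; exact: L1_shift.
have [t _ ->] := weak_partial_mvt LV Lg Vg tp h0.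
have Lt := L1_shift (t *: 'e_j) Lg.
rewrite ler_pM2l// (le_trans (ler_norm _))// (le_trans (integral_norm (L1M_test Lt tp)))//.
rewrite -(integral_shift (t *: 'e_j) (f := fun x => `|g x|)); last by apply: (@L1_measurable _ _ _ mu); exact: L1_norm.
apply: integral_le; [exact/L1_norm/L1M_test|exact/L1_norm|].
by move=> x; rewrite normrM ler_piMr.
Qed.

(** Difference quotients converge to the weak derivative in [L1], at the rate
    [w] given by the continuity of translations; again by duality and
    [weak_partial_mvt]. *)
Lemma weak_partial_diff_quotient j V g (h w : R) : L1 mu V -> L1 mu g ->
  weak_partial j V g -> 0 < h ->
  (forall t, 0 <= t <= h -> \int[mu]_x `|g (x + t *: 'e_j) - g x| <= w) ->
  \int[mu]_x `|V (x + h *: 'e_j) - V x - h * g x| <= h * w.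
Proof.
move=> LV Lg Vg h0 Hw.
have LhV := L1_shift (h *: 'e_j) LV.
have LD : L1 mu (fun x => V (x + h *: 'e_j) - V x) by exact: L1B.
apply: L1_norm_duality => [|psi tp p1]; first by apply: L1B => //; exact: L1Z.
under eq_Rintegral do rewrite mulrBl -mulrA.
rewrite integral_sub; [|exact: L1M_test|by apply: L1Z; exact: L1M_test].
rewrite integral_scale; last exact: L1M_test.
have [t /andP[t0 th] ->] := weak_partial_mvt LV Lg Vg tp h0.
have Lt := L1_shift (t *: 'e_j) Lg.
rewrite -mulrBr ler_pM2l// -integral_sub; [|exact: L1M_test..].
have Ld : L1 mu (fun x => g (x + t *: 'e_j) - g x) by exact: L1B.
apply: (le_trans _ (Hw t _)); last by rewrite !ltW.
apply: integral_le; [by apply: L1B; exact: L1M_test|exact: L1_norm|].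
move=> x; rewrite -mulrBl (le_trans (ler_norm _))// normrM.
by rewrite ler_piMr.
Qed.

Lemma integral_truncation_tail g e : L1 mu g -> 0 < e ->
  exists2 K, 0 <= K & \int[mu]_x (if K < `|g x| then `|g x| else 0) <= e.
Proof.
move=> Lg e0; have mg := L1_measurable Lg.
have [N /(_ N (leqnn N)) HN] : exists N, forall k, (N <= k)%N ->
    `|\int[mu]_x (if k%:R < `|g x| then `|g x| else 0)| <= e.
  apply: (@integral_dominated0 _ _ _ mu (fun k x => if k%:R < `|g x| then `|g x| else 0)
    (fun x => `|g x|)) => //.
  - move=> k; apply: measurable_fun_ifT => //; last exact: measurableT_comp.
    by apply: measurable_fun_ltr => //; exact: measurableT_comp.
  - move=> x; apply: cvg_near_cst; near=> k.
    have -> : (k%:R < `|g x|) = false.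
      by apply/negbTE; rewrite -leNgt; near: k; exact: nbhs_infty_ger.
    by [].
  - exact: L1_norm.
  - by move=> k x; case: ifP; rewrite ?normr_id// normr0.
exists N%:R => //; exact: le_trans (ler_norm _) HN.
Unshelve. all: by end_near. Qed.

End weak_derivatives.

(** * The chain rule *)

Section chain_rule.
Context {R : realType} {n : nat}.
Local Notation mu := (@borel_lebesgue R n).
Local Notation X := 'rV[R]_n.
Local Notation "''e_' j" := (delta_mx ord0 j : 'rV[R]_n) (at level 8, j at level 2).
Implicit Types (f g V psi : X -> R) (j : 'I_n).

Lemma partial_cvg psi j (x : X) : smooth psi ->
  h^-1 *: ((psi \o shift x) (h *: 'e_j) - psi x) @[h --> (0:R)^'] --> partial j psi x.
Proof. by move=> sp; have := @smooth_derivable _ _ psi x j sp. Qed.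

Section lipschitz_truncation.
Variables (F dF : R -> R) (L : R).
Hypotheses (mF : measurable_fun setT F) (mdF : measurable_fun setT dF).
Hypotheses (dF1 : forall s, `|dF s| <= 1) (F0 : F 0 = 0) (L0 : 0 <= L).
Hypothesis F1 : forall s t, `|F s - F t| <= `|s - t|.
Hypothesis F2 : forall s t, `|F s - F t - dF t * (s - t)| <= L * (s - t) ^+ 2.

Let L1F V : L1 mu V -> L1 mu (fun x => F (V x)).
Proof.
move=> LV; apply: L1_dom (L1_norm LV) _.
  by apply: measurableT_comp => //; exact: L1_measurable LV.
by move=> x; have := F1 (V x) 0; rewrite F0 !subr0.
Qed.

Let L1dF V g : L1 mu V -> L1 mu g -> L1 mu (fun x => dF (V x) * g x).
Proof.
move=> LV Lg; rewrite (_ : (fun x => _) = fun x => g x * dF (V x)); last first.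
  by apply/funext => x; rewrite mulrC.
apply: (L1M_bounded (M := 1)) => //.
by apply: measurableT_comp => //; exact: L1_measurable LV.
Qed.

(** With [d0] the increment of [V] and [h * g0] its linearization: the
    quadratic error is at most a multiple of [h * K * `|d0|] as long as [`|g0|
    <= K] and [`|d0|] is small. Otherwise the Lipschitz bound [2 * `|d0|] is
    used. *)
Let pointwise (d0 g0 K h s t : R) : 0 < h -> 0 <= K -> d0 = s - t ->
  `|F s - F t - h * (dF t * g0)| <=
  L * K * h * `|d0| + 2 * h * (if K < `|g0| then `|g0| else 0) + 3 * `|d0 - h * g0|.
Proof.
move=> h0 K0 dE; set r := F s - F t - dF t * d0.
have r1 : `|r| <= L * `|d0| * `|d0|.
  by rewrite /r dE (le_trans (F2 _ _))// -mulrA -expr2 real_normK// num_real.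
have r2 : `|r| <= 2 * `|d0|.
  rewrite /r (le_trans (ler_normB _ _))// mulr_natl mulr2n lerD//.
    by rewrite dE F1.
  by rewrite normrM ler_piMl.
have dh : `|d0| <= h * `|g0| + `|d0 - h * g0|.
  by have := lerB_dist d0 (h * g0); rewrite normrM (gtr0_norm h0); lra.
rewrite (_ : _ - _ = r + dF t * (d0 - h * g0)); last by rewrite /r; ring.
rewrite (le_trans (ler_normD _ _))//.
have d1 : `|dF t * (d0 - h * g0)| <= `|d0 - h * g0| by rewrite normrM ler_piMl.
have [Kg|gK] := ltP K `|g0|.
  have : 0 <= L * K * h * `|d0| by rewrite !mulr_ge0// ltW.
  by move: r2 dh d1; rewrite -!mulrA => ? ? ? ?; lra.
have [le1|le2] := leP (L * `|d0|) 2.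
  have : L * `|d0| * `|d0| <= L * K * h * `|d0| + 2 * `|d0 - h * g0|.
    apply: (@le_trans _ _ (L * `|d0| * (h * K + `|d0 - h * g0|))).
      by rewrite ler_wpM2l ?mulr_ge0// (le_trans dh)// lerD2r ler_pM2l.
    rewrite mulrDr lerD//; last by rewrite ler_wpM2r.
    by rewrite le_eqVlt; apply/orP; left; apply/eqP; ring.
  by move: r1 d1 => ? ? ?; rewrite mulr0 addr0; lra.
have : 2 * `|d0| <= L * K * h * `|d0| + 2 * `|d0 - h * g0|.
  apply: (@le_trans _ _ (2 * (h * K) + 2 * `|d0 - h * g0|)).
    rewrite -mulrDr ler_pM2l// (le_trans dh)// lerD2r ler_pM2l//.
  rewrite lerD2r.
  have -> : L * K * h * `|d0| = (L * `|d0|) * (h * K) by ring.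
  by rewrite ler_wpM2r ?mulr_ge0// ltW.
by move: r2 d1 => ? ? ?; rewrite mulr0 addr0; lra.
Qed.

(** Difference quotients converge to the weak derivative in [L1], and the
    linearization error of [F] is quadratic; splitting [g] at a large height
    [K] makes that error negligible after division by the increment. *)
Lemma weak_partial_comp j V g : L1 mu V -> L1 mu g -> weak_partial j V g ->
  weak_partial j (F \o V) (fun x => dF (V x) * g x).
Proof.
move=> LV Lg Vg psi tp; have sp := test_smooth tp.
have [M M0 HM] := test_bounded tp.
have [M' M'0 HM'] := test_bounded (test_partial j tp).
have LFV := L1F LV; have LdF := L1dF LV Lg.
pose h (k : nat) : R := k.+1%:R^-1.
have h0 k : 0 < h k by rewrite invr_gt0.
pose q (k : nat) (x : X) := (h k)^-1 * (psi (x - h k *: 'e_j) - psi x).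
have tpk k : test_function setT (fun x => psi (x - h k *: 'e_j)) by exact: test_shift.
have lim1 : \int[mu]_x (F (V x) * q k x) @[k --> \oo] -->
    \int[mu]_x (F (V x) * - partial j psi x).
  apply: (integral_dominated (g := fun x => M' * `|F (V x)|)).
  - move=> k; apply: measurable_funM; first exact: L1_measurable LFV.
    apply: measurable_funM => //; apply: measurable_funB; exact: test_measurable.
  - move=> x; apply: cvgMr.
    have H : h^-1 *: ((psi \o shift x) (h *: 'e_j) - psi x) @[h --> 0^'] --> partial j psi x.
      exact: partial_cvg.
    have hN : (forall k, - h k != 0) /\ (- h k @[k --> \oo] --> (0:R)).
      split=> [k|]; first by rewrite oppr_eq0 gt_eqF.
      by rewrite -(oppr0 R); apply: cvgN; exact: cvg_harmonic.
    have /cvgr_dnbhsP/(_ _ hN) := H.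
    move=> /cvgN; apply: cvg_trans; apply: near_eq_cvg; near=> k.
    rewrite -[LHS]/(- ((- h k)^-1 * (psi (- h k *: 'e_j + x) - psi x))).
    by rewrite /q invrN mulNr opprK scaleNr [_ + x]addrC.
  - exact/L1Z/L1_norm.
  - move=> k x; rewrite normrM mulrC ler_wpM2r//.
    rewrite /q normrM gtr0_norm ?invr_gt0// ler_pdivrMl//.
    have := smooth_lipschitz x (- h k) sp HM'.
    by rewrite scaleNr normrN (gtr0_norm (h0 k)) mulrC.
apply/eqP; rewrite -subr_eq0 opprK -normr_le0; apply/ler_addgt0Pr => e e0; rewrite add0r.
pose e' := e / (2 * (M + 1)).
have M1 : 0 < M + 1 by rewrite ltr_wpDl.
have e'0 : 0 < e' by rewrite divr_gt0// mulr_gt0.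
have e8 : 0 < e' / 8 by rewrite divr_gt0.
have [K K0 HK] := integral_truncation_tail Lg e8.
have [d d0 Hd] := L1_shift_continuous j Lg e8.
pose G := \int[mu]_x `|g x|.
have G0 : 0 <= G by exact: integral_pos.
have e2 : 0 < e / 2 by rewrite divr_gt0.
have LKG : 0 <= L * K * G by rewrite !mulr_ge0.
have P : 0 < L * K * G + 1 by rewrite ltr_wpDl.
have P' : 0 < (L * K * G + 1)^-1 * (e' / 4) by rewrite mulr_gt0 ?invr_gt0// divr_gt0.
have [k [k1 k2 k3]] : exists k, [/\ h k <= d, L * K * h k * G <= e' / 4 &
    `|\int[mu]_x (F (V x) * - partial j psi x) - \int[mu]_x (F (V x) * q k x)| <= e / 2].
  near \oo => k; exists k; split.
  - by near: k; apply: filterS (near_infty_natSinv_lt (PosNum d0)) => i /ltW.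
  - have -> : L * K * h k * G = (L * K * G) * h k by ring.
    apply: (@le_trans _ _ ((L * K * G + 1) * h k)); first by rewrite ler_wpM2r ?lerDl// ltW.
    rewrite -ler_pdivlMl//.
    by near: k; apply: filterS (near_infty_natSinv_lt (PosNum P')) => i /ltW.
  - by near: k; move/cvgrPdist_le : lim1; apply.
have Lh := L1_shift (h k *: 'e_j) LV; have LFh := L1F Lh.
have LgT : L1 mu (fun x => if K < `|g x| then `|g x| else 0).
  apply: L1_dom (L1_norm Lg) _.
    have mg := L1_measurable Lg; apply: measurable_fun_ifT => //; last exact: measurableT_comp.
    by apply: measurable_fun_ltr => //; exact: measurableT_comp.
  by move=> x; case: ifP; rewrite ?normr_id// normr0.
have LD : L1 mu (fun x => `|V (x + h k *: 'e_j) - V x|) by exact/L1_norm/L1B.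
have LDh : L1 mu (fun x => `|V (x + h k *: 'e_j) - V x - h k * g x|).
  by apply/L1_norm/L1B; [exact: L1B|exact: L1Z].
have LE : L1 mu (fun x => F (V (x + h k *: 'e_j)) - F (V x) - h k * (dF (V x) * g x)).
  by apply: L1B; [exact: L1B|exact: L1Z].
have key : \int[mu]_x `|F (V (x + h k *: 'e_j)) - F (V x) - h k * (dF (V x) * g x)| <= h k * e'.
  apply: (@le_trans _ _ (L * K * h k * (h k * G) + 2 * h k * (e' / 8) + 3 * (h k * (e' / 8)))).
    apply: (@le_trans _ _ (\int[mu]_x (L * K * h k * `|V (x + h k *: 'e_j) - V x| +
        2 * h k * (if K < `|g x| then `|g x| else 0) +
        3 * `|V (x + h k *: 'e_j) - V x - h k * g x|))).
      apply: integral_le; first exact: L1_norm.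
        by apply: L1D; [apply: L1D; exact: L1Z|exact: L1Z].
      by move=> x; exact: pointwise.
    rewrite integral_add; [|by apply: L1D; exact: L1Z|exact: L1Z].
    rewrite integral_add; [|exact: L1Z..].
    rewrite !integral_scale//; apply: lerD; first apply: lerD.
    - apply: ler_wpM2l; first by rewrite !mulr_ge0// ltW.
      by apply: weak_partial_shift_le => //; exact: ltW.
    - by rewrite ler_wpM2l// mulr_ge0// ltW.
    - rewrite ler_wpM2l//; apply: weak_partial_diff_quotient => // t /andP[t0 th].
      by apply: Hd; rewrite ger0_norm// (le_trans th).
  have : h k * (L * K * h k * G) <= h k * (e' / 4) by rewrite ler_wpM2l// ltW.
  have : 0 <= h k * e' by rewrite mulr_ge0// ltW.
  have -> : L * K * h k * (h k * G) = h k * (L * K * h k * G) by ring.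
  have -> : 2 * h k * (e' / 8) = (h k * e') / 4 by field.
  have -> : 3 * (h k * (e' / 8)) = (h k * e') * 3 / 8 by field.
  have -> : h k * (e' / 4) = (h k * e') / 4 by field.
  by lra.
have qE : \int[mu]_x (F (V x) * q k x) =
    (h k)^-1 * \int[mu]_x ((F (V (x + h k *: 'e_j)) - F (V x)) * psi x).
  have -> : \int[mu]_x (F (V x) * q k x) =
      (h k)^-1 * \int[mu]_x (F (V x) * psi (x - h k *: 'e_j) - F (V x) * psi x).
    rewrite -integral_scale; last by apply: L1B; exact: L1M_test.
    by apply: eq_Rintegral => x _; rewrite /q; ring.
  congr (_ * _); rewrite integral_sub; [|exact: L1M_test..].
  under [RHS]eq_Rintegral do rewrite mulrBl.
  rewrite integral_sub; [|exact: L1M_test..]; congr (_ - _).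
  rewrite -(integral_shift (h k *: 'e_j)); last first.
    exact: L1_measurable (L1M_test LFV (tpk k)).
  by apply: eq_Rintegral => x _; rewrite addrK.
have H2 : `|\int[mu]_x (F (V x) * q k x) - \int[mu]_x (dF (V x) * g x * psi x)| <= e / 2.
  have -> : \int[mu]_x (F (V x) * q k x) - \int[mu]_x (dF (V x) * g x * psi x) =
    (h k)^-1 * \int[mu]_x ((F (V (x + h k *: 'e_j)) - F (V x) - h k * (dF (V x) * g x)) * psi x).
    rewrite qE.
    have -> : \int[mu]_x ((F (V (x + h k *: 'e_j)) - F (V x) - h k * (dF (V x) * g x)) * psi x) =
        \int[mu]_x ((F (V (x + h k *: 'e_j)) - F (V x)) * psi x - h k * (dF (V x) * g x * psi x)).
      by apply: eq_Rintegral => x _; ring.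
    rewrite integral_sub; [|by apply: L1M_test => //; exact: L1B|by apply: L1Z; exact: L1M_test].
    rewrite integral_scale; last exact: L1M_test.
    by rewrite mulrBr mulKf// gt_eqF.
  rewrite normrM gtr0_norm ?invr_gt0// ler_pdivrMl//.
  rewrite (le_trans (integral_norm _))//; first exact: L1M_test.
  apply: (@le_trans _ _ (M * (h k * e'))).
    apply: (@le_trans _ _ (\int[mu]_x (M * `|F (V (x + h k *: 'e_j)) - F (V x) -
        h k * (dF (V x) * g x)|))).
      apply: integral_le; [exact/L1_norm/L1M_test|exact/L1Z/L1_norm|].
      by move=> x; rewrite normrM mulrC ler_wpM2r.
    by rewrite integral_scale ?ler_wpM2l//; exact: L1_norm.
  rewrite mulrCA /e'; apply: ler_wpM2l; first exact: ltW.
  have -> : M * (e / (2 * (M + 1))) = e / 2 * (M / (M + 1)) by field; lra.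
  by rewrite ger_pMr// ler_pdivrMr// mul1r lerDl.
have -> : \int[mu]_x ((F \o V) x * partial j psi x) =
    - \int[mu]_x (F (V x) * - partial j psi x).
  rewrite -integral_opp; first by apply: eq_Rintegral => x _; rewrite mulrN opprK.
  under eq_fun do rewrite mulrN; apply: L1N; apply: L1M_test => //; exact: test_partial.
rewrite addrC -[X in `|X|](subrKA (\int[mu]_x (F (V x) * q k x))) [e]splitr.
rewrite addrC -opprB (le_trans (ler_normD _ _))// [leRHS]addrC.
by apply: lerD; rewrite ?opprB ?normrN// distrC.
Unshelve. all: by end_near. Qed.

End lipschitz_truncation.

(** A continuously differentiable truncation: [trunc l d] vanishes below the
    level [l] and tends to [fun t => (t - l)^+] as [d] tends to 0, while its
    linearization error is at most [d^-1] times the square of the increment,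
    as [weak_partial_comp] demands. *)
Definition trunc (l d t : R) : R :=
  if t <= l then 0 else (t - l) ^+ 2 / (t - l + d).

Definition dtrunc (l d t : R) : R :=
  if t <= l then 0 else 1 - d ^+ 2 / (t - l + d) ^+ 2.

Section trunc.
Variables (l d : R).
Hypotheses (l0 : 0 <= l) (d0 : 0 < d).

Let dpos (t : R) : l < t -> 0 < t - l + d.
Proof. by move=> lt; rewrite addr_gt0// subr_gt0. Qed.

Lemma trunc_gt (t : R) : l < t -> trunc l d t = (t - l) ^+ 2 / (t - l + d).
Proof. by move=> lt; rewrite /trunc leNgt lt. Qed.

Lemma trunc_le t : t <= l -> trunc l d t = 0.
Proof. by rewrite /trunc => ->. Qed.

Lemma dtrunc_gt (t : R) : l < t -> dtrunc l d t = 1 - d ^+ 2 / (t - l + d) ^+ 2.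
Proof. by move=> lt; rewrite /dtrunc leNgt lt. Qed.

Lemma dtrunc_le t : t <= l -> dtrunc l d t = 0.
Proof. by rewrite /dtrunc => ->. Qed.

Let truncE (t : R) : l < t -> trunc l d t = t - l - d + d ^+ 2 / (t - l + d).
Proof.
move=> lt; rewrite trunc_gt//; have := dpos lt => P.
by field; rewrite gt_eqF.
Qed.

Lemma dtrunc_ge0 t : 0 <= dtrunc l d t.
Proof.
rewrite /dtrunc; case: ifPn => //; rewrite -ltNge => lt; have P := dpos lt.
rewrite subr_ge0 ler_pdivrMr ?exprn_gt0// mul1r ler_sqr ?nnegrE ?ltW//.
by rewrite ltrDr subr_gt0.
Qed.

Lemma dtrunc_le1 t : dtrunc l d t <= 1.
Proof.
rewrite /dtrunc; case: ifPn => //; rewrite -ltNge => lt; have P := dpos lt.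
by rewrite lerBlDr lerDl divr_ge0// sqr_ge0.
Qed.

Lemma dtrunc_norm_le1 t : `|dtrunc l d t| <= 1.
Proof. by rewrite ger0_norm ?dtrunc_ge0// dtrunc_le1. Qed.

Lemma trunc_ge0 t : 0 <= trunc l d t.
Proof.
rewrite /trunc; case: ifPn => //; rewrite -ltNge => lt; have P := dpos lt.
by rewrite divr_ge0 ?sqr_ge0// ltW.
Qed.

Lemma trunc_0 : trunc l d 0 = 0.
Proof. by rewrite /trunc l0. Qed.

Let truncB s t : l < s -> l < t -> trunc l d s - trunc l d t =
  (s - t) * (1 - d ^+ 2 / ((s - l + d) * (t - l + d))).
Proof.
move=> ls lt; rewrite !truncE//; have Ps := dpos ls; have Pt := dpos lt.
by field; rewrite !gt_eqF.
Qed.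

Let trunc_le_sub t : l < t -> trunc l d t <= t - l.
Proof.
move=> lt; have P := dpos lt; rewrite trunc_gt// ler_pdivrMr// expr2.
by rewrite ler_wpM2l// ?subr_ge0 ?ltW// ltrDl.
Qed.

Lemma trunc_lipschitz s t : `|trunc l d s - trunc l d t| <= `|s - t|.
Proof.
wlog st : s t / t <= s.
  move=> H; have [/H//|/ltW/H] := leP t s.
  by rewrite distrC (distrC t).
have [ls|sl] := ltP l s; last first.
  by rewrite !trunc_le// ?subrr ?normr0// (le_trans st).
have [lt|tl] := ltP l t; last first.
  rewrite (trunc_le tl) subr0 ger0_norm ?trunc_ge0//.
  rewrite ger0_norm ?subr_ge0// (le_trans (trunc_le_sub ls))// lerB//.
rewrite truncB// normrM ler_piMr//.
have Ps := dpos ls; have Pt := dpos lt.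
have P : 0 < (s - l + d) * (t - l + d) by rewrite mulr_gt0.
have H : d ^+ 2 / ((s - l + d) * (t - l + d)) <= 1.
  by rewrite ler_pdivrMr// mul1r expr2 ler_pM ?ltW// ltrDr subr_gt0.
rewrite ger0_norm ?subr_ge0// lerBlDr lerDl divr_ge0 ?sqr_ge0// ltW//.
Qed.

Lemma trunc_quadratic s t :
  `|trunc l d s - trunc l d t - dtrunc l d t * (s - t)| <= d^-1 * (s - t) ^+ 2.
Proof.
have [ls|sl] := ltP l s; have [lt|tl] := ltP l t.
- have Ps := dpos ls; have Pt := dpos lt.
  rewrite truncB// dtrunc_gt//.
  have -> : (s - t) * (1 - d ^+ 2 / ((s - l + d) * (t - l + d))) -
      (1 - d ^+ 2 / (t - l + d) ^+ 2) * (s - t) =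
      d ^+ 2 / ((t - l + d) ^+ 2 * (s - l + d)) * (s - t) ^+ 2.
    by field; rewrite !gt_eqF.
  rewrite normrM [`|(s - t) ^+ 2|]ger0_norm ?sqr_ge0//.
  rewrite ler_wpM2r ?sqr_ge0// ger0_norm; last first.
    by rewrite divr_ge0 ?sqr_ge0// mulr_ge0 ?sqr_ge0// ltW.
  rewrite ler_pdivrMr ?mulr_gt0 ?exprn_gt0// ler_pdivlMl// mulrC -exprSr.
  rewrite exprSr ler_pM ?sqr_ge0 ?ltW//; last by rewrite ltrDr subr_gt0.
  by rewrite ltr_sqr ?nnegrE ?ltW// ltrDr subr_gt0.
- have Ps := dpos ls; rewrite dtrunc_le// (trunc_le tl) trunc_gt// mul0r !subr0.
  rewrite ger0_norm; last by rewrite divr_ge0 ?sqr_ge0// ltW.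
  rewrite mulrC ler_pM ?sqr_ge0 ?invr_ge0 ?(ltW Ps)//.
    by rewrite lef_pV2// lerDr subr_ge0 ltW.
  have H : 0 <= s - l <= s - t by lra.
  by have /andP[? ?] := H; rewrite ler_sqr// nnegrE; lra.
- have Pt := dpos lt; have Pt' : t - l + d != 0 by rewrite gt_eqF.
  have x0 : 0 < t - l by rewrite subr_gt0.
  have st : 0 < t - s by rewrite subr_gt0 (le_lt_trans sl).
  have xst : t - l <= t - s by rewrite lerB.
  rewrite dtrunc_gt// (trunc_le sl) trunc_gt// sub0r.
  have -> : - ((t - l) ^+ 2 / (t - l + d)) - (1 - d ^+ 2 / (t - l + d) ^+ 2) * (s - t) =
     (t - l) * ((t - s) * (t - l + 2 * d) - (t - l) * (t - l + d)) / (t - l + d) ^+ 2.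
    by field.
  have nn : 0 <= (t - s) * (t - l + 2 * d) - (t - l) * (t - l + d).
    have -> : (t - s) * (t - l + 2 * d) - (t - l) * (t - l + d) =
      (l - s) * (t - l + 2 * d) + (t - l) * d by ring.
    have ls : 0 <= l - s by rewrite subr_ge0.
    have d2 : 0 <= t - l + 2 * d by rewrite addr_ge0 ?mulr_ge0// ltW.
    by rewrite addr_ge0// mulr_ge0// ltW.
  rewrite ger0_norm; last by rewrite divr_ge0 ?mulr_ge0 ?sqr_ge0// ltW.
  rewrite ler_pdivrMr ?exprn_gt0// -(ler_pM2l d0) !mulrA divff ?gt_eqF// mul1r.
  have z0 : 0 <= l - s by rewrite subr_ge0.
  rewrite -subr_ge0 (_ : _ - _ = (t - l) ^+ 2 * ((t - l) ^+ 2 + 2 * (t - l) * d) +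
    2 * (t - l) ^+ 3 * (l - s) + 3 * (t - l) ^+ 2 * (l - s) * d +
    (l - s) ^+ 2 * (t - l + d) ^+ 2); last by ring.
  have x1 := ltW x0; have d1 := ltW d0.
  move: (t - l) (l - s) x1 z0 => x z x1 z0.
  by do ?[apply: addr_ge0|apply: mulr_ge0|apply: exprn_ge0].
- by rewrite dtrunc_le// !trunc_le// subrr mul0r subr0 normr0 mulr_ge0 ?sqr_ge0// invr_ge0 ltW.
Qed.

Lemma trunc_ge_half t : l = d -> 2 * l <= t -> l / 2 <= trunc l d t.
Proof.
move=> ld lt; have l1 : 0 < l by rewrite ld.
have lt' : l < t by lra.
have P := dpos lt'; rewrite trunc_gt// ler_pdivlMr//.
rewrite -ld in P *; rewrite subrK; nra.
Qed.

Lemma trunc_norm_le t : `|trunc l d t| <= `|t|.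
Proof. by have := trunc_lipschitz t 0; rewrite trunc_0 !subr0. Qed.

Lemma measurable_trunc : measurable_fun setT (trunc l d).
Proof.
apply: continuous_measurable_fun => t; apply/cvgrPdist_le => e e0.
apply/nbhs_ballP; exists e => //= s ts.
by rewrite (le_trans (trunc_lipschitz t s))// ltW.
Qed.

Lemma measurable_dtrunc : measurable_fun setT (dtrunc l d).
Proof.
rewrite (_ : dtrunc l d =
    fun t => 1 - d ^+ 2 * (((Num.max (t - l) 0 + d) `^ (-1)) ^+ 2)).
  apply: measurable_funB => //; apply: measurable_funM => //.
  apply: measurable_funX; apply: (measurableT_comp (measurable_powR _)).
  apply: measurable_funD => //; apply: measurable_maxr => //.
  exact: measurable_funB.
apply/funext => t; have [lt|tl] := ltP l t.
  have P := dpos lt; rewrite dtrunc_gt// max_l ?subr_ge0 ?(ltW lt)//.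
  by rewrite powR_inv1 ?ltW// exprVn.
rewrite dtrunc_le// max_r ?subr_le0// add0r powR_inv1 ?ltW//.
by rewrite -exprMn divff ?gt_eqF// expr1n subrr.
Qed.

Lemma weak_partial_trunc j V g : L1 mu V -> L1 mu g -> weak_partial j V g ->
  weak_partial j (trunc l d \o V) (fun x => dtrunc l d (V x) * g x).
Proof.
apply: (weak_partial_comp (L := d^-1)).
- exact: measurable_trunc.
- exact: measurable_dtrunc.
- exact: dtrunc_norm_le1.
- exact: trunc_0.
- by rewrite invr_ge0 ltW.
- exact: trunc_lipschitz.
- exact: trunc_quadratic.
Qed.

End trunc.

(** Let the parameter [d] of [trunc 0 d] tend to 0. Since [dtrunc 0 d]
    vanishes at 0, the set where [V] vanishes needs no separate argument. *)
Lemma weak_partial_pos_part j V g : L1 mu V -> L1 mu g -> weak_partial j V g ->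
  weak_partial j (fun x => Num.max (V x) 0) (fun x => if 0 < V x then g x else 0).
Proof.
move=> LV Lg Vg psi tp.
pose h (k : nat) : R := k.+1%:R^-1.
have h0 k : 0 < h k by rewrite invr_gt0.
have hc : h k @[k --> \oo] --> (0 : R) by exact: cvg_harmonic.
have H k := weak_partial_trunc (lexx 0) (h0 k) LV Lg Vg tp.
have mV := L1_measurable LV.
have Lm : L1 mu (fun x => V x * partial j psi x) by apply: L1M_test => //; exact: test_partial.
have Lp : L1 mu (fun x => g x * psi x) by exact: L1M_test.
have mp := test_measurable tp; have mdp := test_measurable (test_partial j tp).
have l1 : \int[mu]_x (trunc 0 (h k) (V x) * partial j psi x) @[k --> \oo] -->
    \int[mu]_x (Num.max (V x) 0 * partial j psi x).
  apply: (integral_dominated (g := fun x => `|V x * partial j psi x|)).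
  - move=> k; apply: measurable_funM => //.
    apply: (measurableT_comp (f := trunc 0 (h k))); last exact: L1_measurable LV.
    exact: measurable_trunc.
  - move=> x; apply: cvgMl; have [V0|V0] := ltP 0 (V x); last first.
      by apply: cvg_near_cst; apply: nearW => k; rewrite trunc_le.
    have -> : (fun k => trunc 0 (h k) (V x)) = fun k => V x ^+ 2 * (V x + h k)^-1.
      by apply/funext => k; rewrite trunc_gt// subr0.
    have E : V x = V x ^+ 2 * (V x + 0)^-1 by rewrite addr0 expr2 mulfK// gt_eqF.
    rewrite [X in _ --> X]E; apply: cvgMr; apply: cvgV; first by rewrite addr0 gt_eqF.
    by apply: cvgD => //; exact: cvg_cst.
  - exact: L1_norm.
  - by move=> k x; rewrite !normrM ler_wpM2r// trunc_norm_le.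
have l2 : \int[mu]_x (dtrunc 0 (h k) (V x) * g x * psi x) @[k --> \oo] -->
    \int[mu]_x ((if 0 < V x then g x else 0) * psi x).
  apply: (integral_dominated (g := fun x => `|g x * psi x|)).
  - move=> k; apply: measurable_funM => //; apply: measurable_funM; last exact: L1_measurable Lg.
    apply: (measurableT_comp (f := dtrunc 0 (h k))); last exact: L1_measurable LV.
    exact: measurable_dtrunc.
  - move=> x; apply: cvgMl; have [V0|V0] := ltP 0 (V x); last first.
      by apply: cvg_near_cst; apply: nearW => k; rewrite dtrunc_le// mul0r.
    have -> : (fun k => dtrunc 0 (h k) (V x) * g x) =
        fun k => (1 - h k * h k * ((V x + h k)^-1 * (V x + h k)^-1)) * g x.
      by apply/funext => k; rewrite dtrunc_gt// subr0 !expr2 invfM.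
    have E : g x = (1 - 0 * 0 * ((V x + 0)^-1 * (V x + 0)^-1)) * g x.
      by rewrite !mul0r subr0 mul1r.
    rewrite [X in _ --> X]E; apply: cvgMl; apply: cvgB; first exact: cvg_cst.
    have HV : (V x + h k)^-1 @[k --> \oo] --> (V x + 0)^-1.
      by apply: cvgV; [rewrite addr0 gt_eqF|apply: cvgD => //; exact: cvg_cst].
    by apply: cvgM; apply: cvgM.
  - exact: L1_norm.
  - move=> k x; rewrite -mulrA normrM ler_piMl//.
    exact: dtrunc_norm_le1.
have l2' := cvgN l2.
have E : (fun k => \int[mu]_x (trunc 0 (h k) (V x) * partial j psi x)) =
  (fun k => - \int[mu]_x (dtrunc 0 (h k) (V x) * g x * psi x)).
  by apply/funext => k; exact: H.
have e1 := cvg_lim (@Rhausdorff R) l1; have e2 := cvg_lim (@Rhausdorff R) (l2' _).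
by rewrite -e1 E; exact: e2.
Qed.

End chain_rule.

(** * The Sobolev inequality below the critical exponent *)

Section sobolev.
Context {R : realType} {n : nat}.
Local Notation mu := (@borel_lebesgue R n).
Local Notation X := 'rV[R]_n.
Local Notation "''e_' j" := (delta_mx ord0 j : 'rV[R]_n) (at level 8, j at level 2).
Implicit Types (f V : X -> R) (A E : set X) (j : 'I_n).

Lemma integral_indicator A : measurable A -> \int[mu]_x \1_A x = fine (mu A).
Proof. by move=> mA; rewrite /Rintegral integral_indic ?setIT. Qed.

Lemma measurable_level_gt f (c : R) : measurable_fun setT f -> measurable [set x | c < f x].
Proof.
move=> mf; rewrite (_ : [set _ | _] = f @^-1` `]c, +oo[).
  by rewrite -[X in measurable X]setTI; exact: mf.
by apply/seteqP; split => x; rewrite /= in_itv/= andbT.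
Qed.

Lemma measurable_support f : measurable_fun setT f -> measurable [set x | f x != 0].
Proof.
move=> mf; rewrite (_ : [set _ | _] = f @^-1` (~` [set 0])).
  by rewrite -[X in measurable X]setTI; apply: mf => //; exact: measurableC.
by apply/seteqP; split => x /= /eqP.
Qed.

Lemma row_sum_delta (y : X) : y = \sum_j y ord0 j *: 'e_j.
Proof. exact: row_sum_delta. Qed.

(** The translation is decomposed into translations along the axes. *)
Lemma weak_gradient_shift_le V (g : 'I_n -> X -> R) (y : X) : L1 mu V ->
  (forall j, L1 mu (g j)) -> (forall j, weak_partial j V (g j)) ->
  (forall j, 0 <= y ord0 j) ->
  \int[mu]_x `|V (x + y) - V x| <= \sum_j y ord0 j * \int[mu]_x `|g j x|.
Proof.
move=> LV Lg Vg y0; rewrite [y in X in X <= _]row_sum_delta.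
elim: (index_enum _) => [|j s IH].
  rewrite !big_nil; under eq_Rintegral do rewrite addr0 subrr normr0.
  by rewrite /Rintegral integral0.
rewrite !big_cons; set Y := \sum_(j <- s) _ in IH *.
have LY := L1_shift Y LV; have Lj := L1_shift (y ord0 j *: 'e_j) LV.
have LjY : L1 mu (fun x => V (x + (y ord0 j *: 'e_j + Y))).
  rewrite (_ : (fun x => _) = fun x => V (x + y ord0 j *: 'e_j + Y)); last first.
    by apply/funext => x; rewrite addrA.
  exact: (L1_shift (y ord0 j *: 'e_j) (f := fun x => V (x + Y))).
have L1' : L1 mu (fun x => `|V (x + y ord0 j *: 'e_j) - V x|) by exact/L1_norm/L1B.
have L1Y := L1_shift Y L1'.
apply: (@le_trans _ _ (\int[mu]_x (`|V (x + Y + y ord0 j *: 'e_j) - V (x + Y)| + `|V (x + Y) - V x|))).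
  apply: integral_le; first exact/L1_norm/L1B.
    by apply: L1D => //; exact/L1_norm/L1B.
  move=> x; rewrite -addrA (addrC Y).
  by rewrite -[X in `|X|](subrKA (V (x + Y))) ler_normD.
rewrite integral_add//; last exact/L1_norm/L1B.
apply: lerD => //.
rewrite (integral_shift Y (f := fun x => `|V (x + y ord0 j *: 'e_j) - V x|)); last exact: L1_measurable L1'.
exact: weak_partial_shift_le.
Qed.

(** Integrate [fun y => `|f (x + y) - f x|] over a cube that is larger than
    the set where [f] does not vanish, and exchange the integrals: from a
    point of [A], part of the cube leads out of [E], where the difference is
    at least [c]. *)
Lemma cube_average f A E (c h b : R) : L1 mu f -> measurable A -> measurable E ->
  (mu A < +oo)%E -> (mu E < +oo)%E -> 0 <= c -> 0 <= h ->
  fine (mu E) <= h ^+ n ->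
  (forall x, A x -> c <= f x) -> (forall x, ~ E x -> f x = 0) ->
  (forall y : X, cube h y -> \int[mu]_x `|f (x + y) - f x| <= b) ->
  c * fine (mu A) * (h ^+ n - fine (mu E)) <= h ^+ n * b.
Proof.
move=> Lf mA mE Aoo Eoo c0 h0 Eh fA fE fb.
have mf := L1_measurable Lf.
have mC := @measurable_cube R n h.
have Coo : (mu (@cube R n h) < +oo)%E by rewrite borel_lebesgue_cube// ltry.
have IC : \int[mu]_x \1_(@cube R n h) x = h ^+ n.
  by rewrite integral_indicator// borel_lebesgue_cube.
have LC : L1 mu (\1_(@cube R n h) : X -> R) by exact: L1_indic.
have LE : L1 mu (\1_E : X -> R) by exact: L1_indic.
have LA : L1 mu (\1_A : X -> R) by exact: L1_indic.
pose phi (z : X * X) := `|f (z.1 + z.2) - f z.1| * \1_(@cube R n h) z.2.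
have phi0 z : 0 <= phi z by rewrite mulr_ge0// indicE.
have mphi : measurable_fun setT phi.
  apply: measurable_funM; last exact: (measurableT_comp (measurable_indic _) measurable_snd).
  apply: measurableT_comp => //; apply: measurable_funB; last exact: (measurableT_comp mf measurable_fst).
  apply: (measurableT_comp mf); apply: measurable_to_rV => i.
  under eq_fun do rewrite mxE.
  apply: measurable_funD.
    exact: (measurableT_comp (@measurable_rV_coord R n i) measurable_fst).
  exact: (measurableT_comp (@measurable_rV_coord R n i) measurable_snd).
have mphiE : measurable_fun setT (EFin \o phi) by exact/measurable_EFinP.
have phi0E z : (0 <= (EFin \o phi) z)%E by rewrite lee_fin.
have mphi1 x : measurable_fun setT (fun y => phi (x, y)).
  by apply: (measurableT_comp mphi); exact: measurable_pair1.
have Lin x : L1 mu (fun y => phi (x, y)).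
  apply: (@L1_dom _ _ _ mu _ (fun y => `|f (y + x)| + `|f x| * \1_(@cube R n h) y)) => //.
    by apply: L1D; [exact/L1_norm/L1_shift|exact: L1Z].
  move=> y; rewrite ger0_norm//= /phi/= indicE [x + y]addrC.
  case: (y \in _); rewrite ?mulr1 ?mulr0 ?addr0//; exact: ler_normB.
have phiA x : c * (h ^+ n - fine (mu E)) * \1_A x <= \int[mu]_y phi (x, y).
  rewrite indicE; have [/set_mem xA|_] := boolP (x \in A); last first.
    by rewrite mulr0; exact: integral_pos.
  rewrite mulr1 -IC -(integral_indicator mE).
  have LEx := L1_shift x LE.
  rewrite -(integral_shift x (f := \1_E)); last exact: L1_measurable LE.
  rewrite -integral_sub// -integral_scale; last exact: L1B.
  apply: integral_le => //; first by apply: L1Z; exact: L1B.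
  move=> y; rewrite /phi/= !indicE [x + y]addrC.
  have [yC|_] := boolP (y \in _); last first.
    by rewrite mulr0 sub0r mulrN oppr_le0 mulr_ge0.
  rewrite mulr1; have [_|yE] := boolP (y + x \in E); first by rewrite subrr mulr0.
  move: yE; rewrite notin_setE => yE; rewrite (fE _ yE) sub0r normrN subr0 mulr1.
  by rewrite (le_trans (fA x xA))// ler_norm.
have key : (\int[mu]_x (c * (h ^+ n - fine (mu E)) * \1_A x)%:E <=
    \int[mu]_y (b * \1_(@cube R n h) y)%:E)%E.
  have e0 : 0 <= c * (h ^+ n - fine (mu E)) by rewrite mulr_ge0 ?subr_ge0.
  apply: (@le_trans _ _ (\int[mu]_x \int[mu]_y (phi (x, y))%:E)%E).
    apply: ge0_le_integral => //.
    - by move=> x _; rewrite lee_fin mulr_ge0// indicE.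
    - by apply/measurable_EFinP; apply: measurable_funM => //; exact: measurable_indic.
    - exact: (@measurable_fun_fubini_tonelli_F _ _ _ _ R mu _ mphiE phi0E).
    - move=> x _; rewrite (le_trans (y := (\int[mu]_y phi (x, y))%:E))//.
        by rewrite lee_fin.
      by rewrite -Rintegral_EFin.
  rewrite (@fubini_tonelli _ _ _ _ R mu mu _ mphiE phi0E).
  apply: ge0_le_integral => //.
  - by move=> x _; apply: integral_ge0 => y _; rewrite lee_fin.
  - exact: (@measurable_fun_fubini_tonelli_G _ _ _ _ R mu _ mphiE phi0E).
  - by apply/measurable_EFinP; apply: measurable_funM => //; exact: measurable_indic.
  - move=> y _; rewrite /fubini_G/= /phi/= indicE; have [/set_mem yC|yC] := boolP (y \in _); last first.
      by rewrite mulr0; under eq_integral do rewrite mulr0; rewrite integral0.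
    rewrite mulr1; under eq_integral do rewrite mulr1.
    rewrite Rintegral_EFin ?lee_fin; first exact: fb.
    by apply/L1_norm/L1B => //; exact: L1_shift.
rewrite !Rintegral_EFin ?lee_fin in key; [|exact: L1Z..].
by rewrite !integral_scale// IC integral_indicator// in key; rewrite mulrAC [leRHS]mulrC.
Qed.

(** On [E], [`|f|] is at most [|E|^(-1/p)] or at most [|E|^(1-1/p) * `|f|^p]. *)
Lemma integral_patch_powR f E (p : R) : 1 < p -> measurable E ->
  (mu E < +oo)%E -> 0 < fine (mu E) -> L1 mu f -> L1 mu (fun x => `|f x| `^ p) ->
  \int[mu]_x (`|f x| `^ p) <= 1 ->
  \int[mu]_x (`|f x| * \1_E x) <= 2 * fine (mu E) `^ (1 - p^-1).
Proof.
move=> p1 mE Eoo e0 Lf Lfp If; set e := fine (mu E) in e0 *.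
have p0 : 0 < p by exact: lt_trans p1.
have LE : L1 mu (\1_E : X -> R) by exact: L1_indic.
have LfE : L1 mu (fun x => `|f x| * \1_E x).
  apply: (L1M_bounded (M := 1)); [exact: L1_norm|exact: measurable_indic|].
  by move=> x; rewrite indicE; case: (_ \in _); rewrite ?normr1// normr0.
apply: (@le_trans _ _ (\int[mu]_x (e `^ (1 - p^-1) * `|f x| `^ p + e `^ (- p^-1) * \1_E x))).
  apply: integral_le => //; first by apply: L1D; exact: L1Z.
  move=> x; rewrite indicE; have [_|_] := boolP (x \in E); last first.
    by rewrite !mulr0 addr0 mulr_ge0// powR_ge0.
  rewrite !mulr1; have [le1|gt1] := leP `|f x| (e `^ (- p^-1)).
    by rewrite (le_trans le1)// lerDr mulr_ge0// powR_ge0.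
  have f0 : 0 < `|f x| by rewrite (le_lt_trans _ gt1)// powR_ge0.
  rewrite (le_trans (y := e `^ (1 - p^-1) * `|f x| `^ p))//; last by rewrite lerDl powR_ge0.
  have -> : e `^ (1 - p^-1) = (e `^ (- p^-1)) `^ (- (p - 1)).
    by rewrite -powRrM; congr (_ `^ _); field; rewrite gt_eqF.
  have -> : `|f x| `^ p = `|f x| `^ (p - 1) * `|f x|.
    by rewrite -[X in _ * X]powRr1// -powRD ?subrK// gt_eqF ?implybT.
  rewrite mulrA ler_peMl// powRN ler_pdivlMl ?mulr1; last by rewrite powR_gt0// powR_gt0.
  by apply: ge0_ler_powR; rewrite ?nnegrE ?powR_ge0 ?(ltW gt1)// subr_ge0 ltW.
rewrite integral_add; [|exact: L1Z..].
rewrite !integral_scale// integral_indicator//.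
rewrite mulr_natl mulr2n lerD//; first by rewrite ler_piMr// powR_ge0.
rewrite -/e -[X in _ * X](powRr1 (ltW e0)) -powRD; last by rewrite (gt_eqF e0) implybT.
by rewrite addrC.
Qed.

Lemma geometric_sum_le (q : R) (N : nat) : 0 <= q -> q < 1 ->
  \sum_(0 <= k < N) q ^+ k <= (1 - q)^-1.
Proof.
move=> q0 q1; have P : 0 < 1 - q by rewrite subr_gt0.
rewrite -[leRHS]mul1r ler_pdivlMr// big_mkord mulrC -opprB mulNr -subrX1 opprB.
by rewrite gerBl exprn_ge0.
Qed.

Section level_sets.
Variables (p : R) (V : X -> R) (g : 'I_n -> X -> R).
Hypotheses (n0 : (0 < n)%N) (p1 : 1 < p) (pn : p < n%:R).
Hypotheses (LV : L1 mu V) (Lg : forall j, L1 mu (g j)).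
Hypothesis Lgp : forall j, L1 mu (fun x => `|g j x| `^ p).
Hypothesis Ig : forall j, \int[mu]_x (`|g j x| `^ p) <= 1.
Hypothesis Vg : forall j, weak_partial j V (g j).

Let E (l : R) := [set x | l < V x].

Let mV : measurable_fun setT V. Proof. exact: L1_measurable LV. Qed.

Let mE l : measurable (E l).
Proof.
exact: measurable_level_gt.
Qed.

Let Eoo l : 0 < l -> (mu (E l) < +oo)%E.
Proof.
move=> l0.
have LVl : L1 mu (fun x => l^-1 * `|V x|) by exact/L1Z/L1_norm.
have : (\int[mu]_x (\1_(E l) x)%:E <= \int[mu]_x (l^-1 * `|V x|)%:E)%E.
  apply: ge0_le_integral => //.
  - exact/measurable_EFinP/measurable_indic.
  - by apply/measurable_EFinP; exact: L1_measurable LVl.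
  - move=> x _; rewrite lee_fin indicE; have [/set_mem|_] := boolP (_ \in _).
      by rewrite /E/= => lV; rewrite -ler_pdivrMl ?invr_gt0// invrK mulr1 (le_trans (ltW lV))// ler_norm.
    by rewrite mulr_ge0// invr_ge0 ltW.
rewrite integral_indic ?setIT// Rintegral_EFin// => /le_lt_trans; apply.
exact: ltry.
Qed.

Let e (l : R) : R := fine (mu (E l)).

Let e0 l : 0 <= e l. Proof. exact: fine_ge0. Qed.

(** On [E (2 * l)] the function [trunc l l \o V] is at least [l / 2], and it
    vanishes off [E l]. By [cube_average] it is enough to translate it by
    lengths comparable to [|E l|^(1/n)], and such a translation is controlled
    by the gradient on [E l]. *)
Lemma level_set_decay (l : R) : 0 < l ->
  e (2 * l) * l <= 16 * n%:R * e l `^ (1 - p^-1 + n%:R^-1).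
Proof.
move=> l0; have l2 : 0 < 2 * l by rewrite mulr_gt0.
have E2 : E (2 * l) `<=` E l.
  by move=> x; rewrite /E/= => /(lt_trans _); apply; rewrite ltr_pMl// ltr1n.
have e2 : e (2 * l) <= e l.
  by apply: fine_le; rewrite ?ge0_fin_numE ?Eoo//; apply: le_measure; rewrite ?inE.
have [el|el] := leP (e l) 0.
  rewrite (_ : e (2 * l) = 0); last by apply/eqP; rewrite eq_le e0 (le_trans e2).
  by rewrite mul0r !mulr_ge0// powR_ge0.
have nR : 0 < n%:R :> R by rewrite ltr0n.
(* a cube of twice the measure of [E l] *)
pose h := (2 * e l) `^ n%:R^-1.
have h0 : 0 < h by rewrite powR_gt0// mulr_gt0.
have hn : h ^+ n = 2 * e l.
  by rewrite -powR_mulrn ?ltW// -powRrM mulVf ?gt_eqF// powRr1// mulr_ge0// ltW.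
pose F := trunc l l \o V.
have LF : L1 mu F.
  apply: (L1_dom _ (L1_norm LV)).
    by apply: (measurableT_comp (f := trunc l l)) => //; exact: measurable_trunc.
  by move=> x; exact: (trunc_norm_le (ltW l0) l0).
have LdF j : L1 mu (fun x => dtrunc l l (V x) * g j x).
  apply: (L1_dom _ (L1_norm (Lg j))).
    apply: measurable_funM; last exact: L1_measurable (Lg j).
    by apply: (measurableT_comp (f := dtrunc l l)) => //; exact: measurable_dtrunc.
  by move=> x; rewrite normrM ler_piMl// dtrunc_norm_le1.
have wF j := weak_partial_trunc (ltW l0) l0 LV (Lg j) (@Vg j).
have := @cube_average F (E (2 * l)) (E l) (l / 2) h
  (h * (n%:R * (2 * e l `^ (1 - p^-1)))) LF (mE _) (mE _) (Eoo l2) (Eoo l0).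
move=> /(_ _ (ltW h0)).
have -> : fine (mu (E l)) = e l by [].
have -> : fine (mu (E (2 * l))) = e (2 * l) by [].
rewrite hn => /(_ _ _ _ _ _) H.
have {H} : l / 2 * e (2 * l) * (2 * e l - e l) <= 2 * e l * (h * (n%:R * (2 * e l `^ (1 - p^-1)))).
  apply: H.
  - by rewrite divr_ge0// ltW.
  - by rewrite ler_peMl ?ler1n// ltW.
  - by move=> x xE; apply: trunc_ge_half => //; exact: ltW.
  - by move=> x /negP; rewrite -leNgt; exact: trunc_le.
  - move=> y yh.
    rewrite (le_trans (weak_gradient_shift_le LF LdF wF _))//.
      by move=> j; have /andP[] := yh j.
    have -> : h * (n%:R * (2 * e l `^ (1 - p^-1))) = \sum_(j < n) h * (2 * e l `^ (1 - p^-1)).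
      by rewrite sumr_const card_ord -[RHS]mulr_natl mulrCA.
    apply: ler_sum => j _; have /andP[yj0 yjh] := yh j.
    apply: ler_pM => //; [exact: integral_pos|exact: ltW|].
    apply: le_trans (integral_patch_powR p1 (mE l) (Eoo l0) el (Lg j) (Lgp j) (Ig j)).
    apply: integral_le; [exact: L1_norm| |].
      apply: (L1M_bounded (M := 1)); [exact: L1_norm|exact: measurable_indic|].
      by move=> x; rewrite indicE; case: (_ \in _); rewrite ?normr1// normr0.
    move=> x; rewrite normrM indicE; have [_|] := boolP (_ \in _).
      by rewrite mulr1 ler_piMl// dtrunc_norm_le1.
    by rewrite notin_setE /E/= => /negP; rewrite -leNgt => Vl; rewrite dtrunc_le// normr0 mul0r mulr0.
have hE : h <= 2 * e l `^ n%:R^-1.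
  rewrite /h powRM ?(ltW el)//; apply: ler_wpM2r; first exact: powR_ge0.
  by rewrite -[leRHS]powRr1// ler_powR ?ler1n// invf_le1 ?ler1n.
rewrite (_ : 2 * e l - e l = e l); last by ring.
rewrite (_ : 2 * e l * _ = (4 * n%:R * h * e l `^ (1 - p^-1)) * e l); last by ring.
rewrite ler_pM2r// => H.
rewrite powRD; last by rewrite (gt_eqF el) implybT.
have : 4 * n%:R * h * e l `^ (1 - p^-1) <= 4 * n%:R * (2 * e l `^ n%:R^-1) * e l `^ (1 - p^-1).
  by rewrite ler_wpM2r ?powR_ge0// ler_wpM2l// mulr_ge0.
lra.
Qed.

Variable v0 : R.
Hypothesis Ev0 : (mu (E 0%R) <= v0%:E)%E.

Let ps : R := (p^-1 - n%:R^-1)^-1.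

Let ps0 : 0 < ps.
Proof. by rewrite invr_gt0 subr_gt0 ltf_pV2 ?posrE ?ltr0n// (lt_trans ltr01). Qed.

(** Large enough to start the induction of [dyadic_level_decay] and to be
    reproduced in its step. *)
Definition decay_constant : R :=
  Num.max (Num.max v0 1) ((16 * n%:R * 2 `^ ps) `^ ps).

Let M0 : 0 < decay_constant.
Proof. by rewrite !lt_max ltr01 orbT. Qed.

(** The exponents match: [level_set_decay] at the level [l] turns the critical
    decay [l^(-ps)] into the same decay at the level [2 * l], for [1 - 1/p +
    1/n] is [1 - 1/ps]. *)
Lemma dyadic_level_decay (i : nat) : e (2 ^+ i) <= decay_constant * (2 `^ (- ps)) ^+ i.
Proof.
elim: i => [|i IH].
  rewrite !expr0 mulr1 /decay_constant !le_max -orbA; apply/orP; left.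
  have E1 : E 1 `<=` E 0 by move=> x; exact: lt_trans.
  rewrite -lee_fin fineK ?ge0_fin_numE ?Eoo//; apply: le_trans Ev0.
  by apply: le_measure; rewrite ?inE.
have l0 : 0 < 2 ^+ i :> R by rewrite exprn_gt0.
have := level_set_decay l0; rewrite -exprS => H.
set a := 2 `^ (- ps) in IH *.
have a0 : 0 < a by rewrite powR_gt0.
have th0 : 0 <= 1 - p^-1 + n%:R^-1.
  by rewrite addr_ge0 ?invr_ge0// subr_ge0 invf_le1 ?ltW// (lt_trans ltr01).
rewrite -(ler_pM2r l0) (le_trans H)//.
apply: (@le_trans _ _ (16 * n%:R * (decay_constant * a ^+ i) `^ (1 - p^-1 + n%:R^-1))).
  rewrite ler_wpM2l// ?mulr_ge0//.
  by apply: ge0_ler_powR; rewrite ?nnegrE ?mulr_ge0 ?exprn_ge0 ?(ltW M0) ?(ltW a0).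
have thE : 1 - p^-1 + n%:R^-1 = 1 - ps^-1 by rewrite /ps invrK; ring.
rewrite thE powRM ?exprn_ge0 ?(ltW M0) ?(ltW a0)//.
have aE : (a ^+ i) `^ (1 - ps^-1) = a ^+ i * 2 ^+ i.
  rewrite powRD; last by rewrite (gt_eqF (exprn_gt0 _ a0)) implybT.
  rewrite powRr1 ?exprn_ge0 ?(ltW a0)//; congr (_ * _).
  rewrite -powR_mulrn ?(ltW a0)// /a -!powRrM -powR_mulrn//; congr (_ `^ _).
  by field; rewrite gt_eqF.
rewrite aE exprSr.
have -> : 16 * n%:R * (decay_constant `^ (1 - ps^-1) * (a ^+ i * 2 ^+ i)) =
  (16 * n%:R * decay_constant `^ (1 - ps^-1)) * (a ^+ i * 2 ^+ i) by ring.
have -> : decay_constant * (a ^+ i * a) * 2 ^+ i = decay_constant * a * (a ^+ i * 2 ^+ i) by ring.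
rewrite ler_wpM2r ?mulr_ge0 ?exprn_ge0 ?(ltW a0)//.
rewrite /a powRN ler_pdivlMr ?powR_gt0//.
rewrite powRD; last by rewrite (gt_eqF M0) implybT.
rewrite powRr1 ?(ltW M0)// powRN.
have D0 : 0 < decay_constant `^ ps^-1 by rewrite powR_gt0.
have : 16 * n%:R * 2 `^ ps <= decay_constant `^ ps^-1.
  have -> : 16 * n%:R * 2 `^ ps = ((16 * n%:R * 2 `^ ps) `^ ps) `^ ps^-1.
    by rewrite -powRrM mulfV ?gt_eqF// powRr1// !mulr_ge0// powR_ge0.
  apply: ge0_ler_powR; rewrite ?nnegrE ?powR_ge0 ?(ltW M0)//.
  - by rewrite invr_ge0 ltW.
  - by rewrite /decay_constant le_max lexx orbT.
move=> K; rewrite (_ : 16 * n%:R * _ * _ =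
  (16 * n%:R * 2 `^ ps) / decay_constant `^ ps^-1 * decay_constant); last by ring.
by rewrite ler_piMl ?(ltW M0)// ler_pdivrMr ?mul1r.
Qed.

Variable r : R.
Hypotheses (r0 : 0 < r) (rps : r < ps).

Let q : R := 2 `^ (r - ps).

Let q0 : 0 < q. Proof. by rewrite powR_gt0. Qed.
Let q1 : q < 1.
Proof.
rewrite /q -opprB powRN invf_lt1 ?powR_gt0//.
rewrite -[ltLHS](_ : 1 `^ (ps - r) = 1); last by rewrite powR1.
by apply: gt0_ltr_powR; rewrite ?nnegrE ?subr_gt0// ltr1n.
Qed.

Definition sobolev_constant0 : R := v0 + decay_constant * 2 `^ r / (1 - q).

(** Sum over the dyadic levels. Below the critical exponent the bounds of
    [dyadic_level_decay] form a convergent geometric series; the critical one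
    would require a stronger inequality than the decay of level sets. *)
Lemma integral_pos_part_powR :
  (\int[mu]_x (Num.max (V x) 0 `^ r)%:E <= sobolev_constant0%:E)%E.
Proof.
pose G (i : nat) (x : X) : \bar R :=
  if i is k.+1 then ((2 ^+ k.+1) `^ r * \1_(E (2 ^+ k)) x)%:E else (\1_(E 0) x)%:E.
have mG i : measurable_fun setT (G i).
  case: i => [|i]; apply/measurable_EFinP; first exact: measurable_indic.
  by apply: measurable_funM => //; exact: measurable_indic.
have G0 i x : (0 <= G i x)%E.
  by case: i => [|i]; rewrite lee_fin ?mulr_ge0 ?powR_ge0// indicE.
have pw x : ((Num.max (V x) 0 `^ r)%:E <= \sum_(0 <= i <oo) G i x)%E.
  have part (k : nat) : (G k x <= \sum_(0 <= i <oo) G i x)%E.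
    apply: (@le_trans _ _ (\sum_(0 <= i < k.+1) G i x)%E); last exact: nneseries_lim_ge.
    by rewrite big_nat_recr//= leeDr// sume_ge0.
  have [Vx0|V0] := leP (V x) 0.
    by rewrite powR0 ?gt_eqF// nneseries_ge0.
  have [k Vk mink] : exists2 k : nat, V x <= 2 ^+ k & forall i, V x <= 2 ^+ i -> (k <= i)%N.
    have ex : exists k : nat, V x <= 2 ^+ k.
      exists (Num.bound (V x)); exact/ltW/upper_nthrootP.
    by case: (ex_minnP ex) => k; exists k.
  apply: le_trans (part k); case: k Vk mink => [|k] Vk mink; rewrite /G lee_fin indicE mem_set//.
  - rewrite -[leRHS](_ : 1 `^ r = 1); last by rewrite powR1.
    by apply: ge0_ler_powR; rewrite ?nnegrE ?(ltW r0) ?(ltW V0).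
  - by rewrite mulr1; apply: ge0_ler_powR; rewrite ?nnegrE ?(ltW r0) ?(ltW V0) ?exprn_ge0.
  - rewrite /E/= ltNge; apply/negP => /mink.
    by rewrite ltnn.
apply: (@le_trans _ _ (\int[mu]_x \sum_(0 <= i <oo) G i x)%E).
  apply: ge0_le_integral => //.
  - by move=> x _; rewrite lee_fin powR_ge0.
  - apply/measurable_EFinP; apply: (measurableT_comp (measurable_powR _)).
    exact: measurable_maxr.
  - exact: (ge0_emeasurable_sum (P := xpredT)).
rewrite integral_nneseries//.
apply: lime_le; first by apply: is_cvg_nneseries => i _ _; exact: integral_ge0.
have v00 : 0 <= v0 by rewrite -lee_fin (le_trans _ Ev0).
have b0 : 0 <= decay_constant * 2 `^ r by rewrite mulr_ge0 ?powR_ge0 ?ltW.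
have I k : (\int[mu]_x G k.+1 x <= (decay_constant * 2 `^ r * q ^+ k)%:E)%E.
  have l0 : 0 < 2 ^+ k :> R by rewrite exprn_gt0.
  have LE : L1 mu (\1_(E (2 ^+ k)) : X -> R) by apply: L1_indic => //; exact: Eoo.
  rewrite Rintegral_EFin; last exact: L1Z.
  rewrite integral_scale// integral_indicator// lee_fin.
  have := dyadic_level_decay k; rewrite -/(e _) => H.
  apply: (le_trans (ler_wpM2l (powR_ge0 _ _) H)).
  rewrite le_eqVlt; apply/orP; left; apply/eqP.
  have -> : q = 2 `^ r * 2 `^ (- ps) by rewrite -powRD// pnatr_eq0 implybT.
  rewrite exprMn exprS powRM ?exprn_ge0//.
  have -> : (2 ^+ k) `^ r = (2 `^ r) ^+ k.
    by rewrite -powR_mulrn// -powRrM mulrC powRrM powR_mulrn// powR_ge0.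
  by ring.
apply: nearW => -[|N].
  rewrite big_nil lee_fin /sobolev_constant0 addr_ge0// divr_ge0//.
  by rewrite subr_ge0 ltW.
rewrite big_nat_recl// /sobolev_constant0 EFinD; apply: leeD.
  by rewrite integral_indic ?setIT.
apply: (@le_trans _ _ (\sum_(0 <= k < N) (decay_constant * 2 `^ r * q ^+ k)%:E)%E).
  by apply: lee_sum => k _; exact: I.
rewrite sumEFin lee_fin -mulr_sumr ler_wpM2l//; apply: geometric_sum_le => //.
exact: ltW.
Qed.

End level_sets.

Lemma weak_partial_scale (c : R) j V g : L1 mu V -> L1 mu g -> weak_partial j V g ->
  weak_partial j (fun x => c * V x) (fun x => c * g x).
Proof.
move=> LV Lg Vg psi tp.
under eq_Rintegral do rewrite -mulrA; under [in RHS]eq_Rintegral do rewrite -mulrA.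
rewrite !integral_scale ?Vg ?mulrN//; first exact: L1M_test.
by apply: L1M_test => //; exact: test_partial.
Qed.

(** [integral_pos_part_powR] applied to [V / N] and to [- V / N]. *)
Lemma sobolev_subcritical (p r v0 : R) : (0 < n)%N -> 1 < p -> p < n%:R ->
  0 < r -> r < (p^-1 - n%:R^-1)^-1 ->
  exists2 C, 0 < C & forall V (g : 'I_n -> X -> R) (N : R),
    L1 mu V -> (forall j, L1 mu (g j)) -> (forall j, weak_partial j V (g j)) ->
    (forall j, L1 mu (fun x => `|g j x| `^ p)) -> 0 < N ->
    (forall j, \int[mu]_x (`|g j x| `^ p) <= N `^ p) ->
    (mu [set x | (V x != 0)%R] <= v0%:E)%E ->
    (\int[mu]_x (`|V x| `^ r)%:E <= (C * N `^ r)%:E)%E.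
Proof.
move=> n0 p1 pn r0 rps; have p0 : 0 < p by exact: lt_trans p1.
pose C0 := sobolev_constant0 p v0 r.
exists (2 * `|C0| + 1) => [|V g N LV Lg Vg Lgp N0 Ig Vv0]; first by rewrite ltr_wpDl// mulr_ge0.
have mV := L1_measurable LV.
have half (s : R) : s = 1 \/ s = -1 ->
    (\int[mu]_x (Num.max (s * N^-1 * V x) 0 `^ r)%:E <= C0%:E)%E.
  move=> s1; have ns : `|s| = 1 by case: s1 => ->; rewrite ?normrN normr1.
  have LVs := L1Z (s * N^-1) LV.
  have gE j : (fun x => `|s * N^-1 * g j x| `^ p) = fun x => (N `^ p)^-1 * (`|g j x| `^ p).
    apply/funext => x; rewrite !normrM ns mul1r gtr0_norm ?invr_gt0//.
    by rewrite powRM ?invr_ge0 ?(ltW N0)// -powR_inv1 ?(ltW N0)// powRAC powR_inv1 ?powR_ge0.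
  apply: (@integral_pos_part_powR p _ (fun j x => s * N^-1 * g j x)) => //.
  - by move=> j; exact: L1Z.
  - by move=> j; rewrite gE; exact: L1Z.
  - move=> j; rewrite gE integral_scale// -ler_pdivlMl ?invr_gt0 ?powR_gt0// invrK mulr1.
    exact: Ig.
  - by move=> j; exact: weak_partial_scale.
  - apply: le_trans Vv0; apply: le_measure; rewrite ?inE.
    + exact: measurable_level_gt (L1_measurable LVs).
    + exact: measurable_support.
    + by move=> x /=; apply: contraTneq => ->; rewrite mulr0 ltxx.
have mh (s : R) : measurable_fun setT (fun x => (Num.max (s * N^-1 * V x) 0 `^ r)%:E).
  apply/measurable_EFinP/(measurableT_comp (measurable_powR _)).
  by apply: measurable_maxr => //; exact: L1_measurable (L1Z _ LV).
apply: (@le_trans _ _ (\int[mu]_x ((N `^ r)%:E * ((Num.max (1 * N^-1 * V x) 0 `^ r)%:E +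
    (Num.max (-1 * N^-1 * V x) 0 `^ r)%:E)))%E).
  apply: ge0_le_integral => //.
  - by apply/measurable_EFinP/(measurableT_comp (measurable_powR _)); exact: measurableT_comp.
  - by apply: measurable_funeM; apply: emeasurable_funD.
  - move=> x _; rewrite -EFinD -EFinM lee_fin mul1r mulN1r mulNr.
    have [V0|V0] := leP 0 (V x).
      have E0 : 0 <= N^-1 * V x by rewrite mulr_ge0 ?invr_ge0// ltW.
      rewrite (max_l E0) (@max_r _ _ _ 0) ?oppr_le0// powR0 ?gt_eqF// addr0.
      by rewrite -powRM ?(ltW N0)// ger0_norm// mulVKf// gt_eqF.
    have E0 : N^-1 * V x <= 0 by rewrite mulr_ge0_le0 ?invr_ge0// ltW.
    rewrite (max_r E0) max_l ?oppr_ge0// powR0 ?gt_eqF// add0r.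
    by rewrite -powRM ?oppr_ge0 ?(ltW N0)// ltr0_norm// mulrN mulVKf// gt_eqF.
rewrite ge0_integralZl//; last 3 first.
- by apply: emeasurable_funD.
- by move=> x _; rewrite -EFinD lee_fin addr_ge0// powR_ge0.
- by rewrite lee_fin powR_ge0.
rewrite ge0_integralD//; try by move=> x _; rewrite lee_fin powR_ge0.
rewrite [X in (_ <= X%:E)%E]mulrC [X in (_ <= X)%E]EFinM.
apply: lee_wpmul2l; first by rewrite lee_fin powR_ge0.
apply: (le_trans (leeD (half 1 _) (half (-1) _))); [by left|by right|].
by rewrite -EFinD lee_fin; have := ler_norm C0; lra.
Qed.

End sobolev.

(** * The oscillation of the integrand *)

Section enorm.
Context {R : realType} {n m : nat}.
Implicit Types A B : 'M[R]_(n, m).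

Lemma enorm_ge0 A : 0 <= enorm A.
Proof. exact: sqrtr_ge0. Qed.

Lemma enorm_sqr A : enorm A ^+ 2 = \sum_i \sum_j A i j ^+ 2.
Proof.
by rewrite sqr_sqrtr//; apply: sumr_ge0 => i _; apply: sumr_ge0 => j _; exact: sqr_ge0.
Qed.

Lemma enormZ (c : R) A : enorm (c *: A) = `|c| * enorm A.
Proof.
apply/eqP; rewrite -(eqrXn2 (n := 2))// ?enorm_ge0 ?mulr_ge0 ?enorm_ge0//; apply/eqP.
rewrite exprMn !enorm_sqr real_normK ?num_real// mulr_sumr; apply: eq_bigr => i _.
by rewrite mulr_sumr; apply: eq_bigr => j _; rewrite mxE exprMn.
Qed.

Lemma enormN A : enorm (- A) = enorm A.
Proof. by rewrite -scaleN1r enormZ normrN1 mul1r. Qed.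

Lemma enorm_coord_le A i j : `|A i j| <= enorm A.
Proof.
rewrite -(ler_pXn2r (n := 2))// ?nnegrE ?enorm_ge0// enorm_sqr real_normK ?num_real//.
rewrite (bigD1 i)//= (bigD1 j)//= -addrA lerDl addr_ge0//.
  by apply: sumr_ge0 => k _; exact: sqr_ge0.
by apply: sumr_ge0 => k _; apply: sumr_ge0 => l _; exact: sqr_ge0.
Qed.

Lemma enorm_cauchy_schwarz A B :
  \sum_i \sum_j A i j * B i j <= enorm A * enorm B.
Proof.
have [A0|A0] := leP (enorm A) 0.
  rewrite big1 ?mulr_ge0 ?enorm_ge0// => i _; apply: big1 => j _.
  have /normr0_eq0 -> : `|A i j| = 0.
    by apply/eqP; rewrite eq_le normr_ge0 andbT (le_trans (enorm_coord_le A i j)).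
  by rewrite mul0r.
have [B0|B0] := leP (enorm B) 0.
  rewrite big1 ?mulr_ge0 ?enorm_ge0// => i _; apply: big1 => j _.
  have /normr0_eq0 -> : `|B i j| = 0.
    by apply/eqP; rewrite eq_le normr_ge0 andbT (le_trans (enorm_coord_le B i j)).
  by rewrite mulr0.
set x := enorm A in A0 *; set y := enorm B in B0 *.
have : 0 <= \sum_i \sum_j (y * A i j - x * B i j) ^+ 2.
  by apply: sumr_ge0 => i _; apply: sumr_ge0 => j _; exact: sqr_ge0.
have -> : \sum_i \sum_j (y * A i j - x * B i j) ^+ 2 =
    y ^+ 2 * \sum_i \sum_j A i j ^+ 2 + x ^+ 2 * \sum_i \sum_j B i j ^+ 2
    - 2 * x * y * \sum_i \sum_j A i j * B i j.
  rewrite !mulr_sumr -big_split -sumrB; apply: eq_bigr => i _.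
  rewrite !mulr_sumr -big_split -sumrB; apply: eq_bigr => j _ /=.
  by ring.
rewrite -!enorm_sqr -/x -/y => H.
have xy : 0 < x * y by rewrite mulr_gt0.
by rewrite -(ler_pM2l xy); nra.
Qed.

Lemma enormD A B : enorm (A + B) <= enorm A + enorm B.
Proof.
rewrite -(ler_pXn2r (n := 2))// ?nnegrE ?addr_ge0 ?enorm_ge0//.
have -> : enorm (A + B) ^+ 2 = enorm A ^+ 2 + 2 * (\sum_i \sum_j A i j * B i j) + enorm B ^+ 2.
  rewrite !enorm_sqr mulr_sumr -!big_split; apply: eq_bigr => i _ /=.
  rewrite mulr_sumr -!big_split; apply: eq_bigr => j _ /=.
  by rewrite mxE; ring.
by have := enorm_cauchy_schwarz A B; nra.
Qed.

Lemma enormB A B : enorm (A - B) <= enorm A + enorm B.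
Proof. by rewrite -[enorm B]enormN enormD. Qed.

Lemma enorm_le_sum A : enorm A <= \sum_i \sum_j `|A i j|.
Proof.
have P (I : finType) (F : I -> R) : (forall i, 0 <= F i) -> \sum_i F i ^+ 2 <= (\sum_i F i) ^+ 2.
  move=> F0; rewrite expr2 mulr_suml; apply: ler_sum => i _; rewrite expr2 ler_wpM2l//.
  by rewrite (bigD1 i)//= lerDl sumr_ge0.
have S0 i : 0 <= \sum_j `|A i j| by exact: sumr_ge0.
rewrite -(ler_pXn2r (n := 2))// ?nnegrE ?enorm_ge0 ?sumr_ge0// enorm_sqr.
apply: le_trans (P _ _ S0); apply: ler_sum => i _; apply: le_trans (P _ _ _) => //.
by apply: ler_sum => j _; rewrite real_normK// num_real.
Qed.

Lemma enorm_delta i j : enorm (delta_mx i j : 'M[R]_(n, m)) = 1.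
Proof.
apply/eqP; rewrite -(eqrXn2 (n := 2))// ?enorm_ge0// expr1n enorm_sqr.
rewrite (bigD1 i)//= (bigD1 j)//= mxE !eqxx expr1n !big1 ?addr0// => [k ki|k kj].
  by apply: big1 => l _; rewrite mxE (negbTE ki) expr0n.
by rewrite mxE (negbTE kj) andbF expr0n.
Qed.

End enorm.

Section oscillation.
Context {R : realType}.
Implicit Types a b S T : R.

(** Up to a factor, [x] may be replaced by a comparable [T] whatever the sign
    of the exponent. *)
Lemma powR_between (q x T : R) : 0 < T -> T <= x <= 5 * T -> x `^ q <= 5 `^ `|q| * T `^ q.
Proof.
move=> T0 /andP[Tx x5]; have x0 : 0 < x by exact: lt_le_trans Tx.
have [q0|q0] := leP 0 q.
  by rewrite ger0_norm// -powRM ?(ltW T0)//; apply: ge0_ler_powR; rewrite ?nnegrE ?(ltW x0) ?mulr_ge0 ?(ltW T0).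
rewrite (le_trans (y := T `^ q))//; last first.
  by rewrite ler_peMl ?powR_ge0// -[leLHS](powRr0 5) ler_powR ?ler1n.
have -> : q = - (- q) by rewrite opprK.
rewrite !(powRN _ (- q)) lef_pV2 ?posrE ?powR_gt0//.
by apply: ge0_ler_powR; rewrite ?nnegrE ?(ltW T0) ?(ltW x0)// oppr_ge0 ltW.
Qed.

Section far_point.
Context {n m : nat}.
Variables (G : 'rV[R]_m -> 'M[R]_(n, m) -> R) (a b q1 q2 alpha beta : R).
Hypotheses (m0 : (0 < m)%N) (n0 : (0 < n)%N).
Hypotheses (a0 : 0 <= a) (b0 : 0 <= b) (alpha0 : 0 < alpha) (beta0 : 0 < beta).
Hypothesis HG : forall s1 s2 xi1 xi2, `|G s1 xi1 - G s2 xi2| <=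
  a * enorm (s1 - s2) `^ alpha * (enorm xi1 + enorm xi2 + 1) `^ q1 +
  b * (enorm s1 + enorm s2 + 1) `^ q2 * enorm (xi1 - xi2) `^ beta.

(** Both points are compared with a single far point, of norm comparable to
    [S] and [T]. The bound then holds for all large [S] and [T], although [q1]
    or [q2] may be negative: at the far point negative powers of the norms are
    small. *)
Lemma far_point_oscillation s1 s2 xi1 xi2 (S T : R) :
  1 + enorm s1 + enorm s2 <= S -> 1 + enorm xi1 + enorm xi2 <= T ->
  `|G s1 xi1 - G s2 xi2| <= 2 * 5 `^ (alpha + beta + `|q1| + `|q2|) *
    (a * S `^ alpha * T `^ q1 + b * S `^ q2 * T `^ beta).
Proof.
move=> HS HT.
(* the factor 3 keeps the sums of norms below between [S] and [5 * S], and
   between [T] and [5 * T] *)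
pose s3 : 'rV[R]_m := (3 * S) *: delta_mx ord0 (Ordinal m0).
pose xi3 : 'M[R]_(n, m) := (3 * T) *: delta_mx (Ordinal n0) (Ordinal m0).
have [s10 s20 x10 x20] := And4 (enorm_ge0 s1) (enorm_ge0 s2) (enorm_ge0 xi1) (enorm_ge0 xi2).
have S0 : 0 < S by lra.
have T0 : 0 < T by lra.
have s3E : enorm s3 = 3 * S by rewrite enormZ enorm_delta mulr1 gtr0_norm// mulr_gt0.
have x3E : enorm xi3 = 3 * T by rewrite enormZ enorm_delta mulr1 gtr0_norm// mulr_gt0.
have half s xi : enorm s <= S - 1 -> enorm xi <= T - 1 -> `|G s xi - G s3 xi3| <=
    5 `^ (alpha + beta + `|q1| + `|q2|) *
    (a * S `^ alpha * T `^ q1 + b * S `^ q2 * T `^ beta).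
  move=> hs hx; apply: (le_trans (HG _ _ _ _)).
  have ns := enorm_ge0 s; have nx := enorm_ge0 xi.
  have bs : enorm (s - s3) `^ alpha <= 5 `^ alpha * S `^ alpha.
    rewrite -powRM ?(ltW S0)//; apply: ge0_ler_powR; rewrite ?nnegrE ?enorm_ge0 ?(ltW alpha0)//.
      by rewrite mulr_ge0// ltW.
    by rewrite (le_trans (enormB _ _))// s3E; lra.
  have bx : enorm (xi - xi3) `^ beta <= 5 `^ beta * T `^ beta.
    rewrite -powRM ?(ltW T0)//; apply: ge0_ler_powR; rewrite ?nnegrE ?enorm_ge0 ?(ltW beta0)//.
      by rewrite mulr_ge0// ltW.
    by rewrite (le_trans (enormB _ _))// x3E; lra.
  have cx : (enorm xi + enorm xi3 + 1) `^ q1 <= 5 `^ `|q1| * T `^ q1.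
    by apply: powR_between => //; rewrite x3E; lra.
  have cs : (enorm s + enorm s3 + 1) `^ q2 <= 5 `^ `|q2| * S `^ q2.
    by apply: powR_between => //; rewrite s3E; lra.
  have K5 (x y : R) : x <= y -> 5 `^ x <= 5 `^ y by move=> xy; rewrite ler_powR// ler1n.
  have k1 : alpha + `|q1| <= alpha + beta + `|q1| + `|q2|.
    by have := normr_ge0 q2; have := beta0; lra.
  have k2 : beta + `|q2| <= alpha + beta + `|q1| + `|q2|.
    by have := normr_ge0 q1; have := alpha0; lra.
  rewrite mulrDr lerD//.
    apply: (@le_trans _ _ (a * (5 `^ alpha * S `^ alpha) * (5 `^ `|q1| * T `^ q1))).
      by apply: ler_pM; rewrite ?mulr_ge0 ?powR_ge0// ler_wpM2l.
    have -> : a * (5 `^ alpha * S `^ alpha) * (5 `^ `|q1| * T `^ q1) =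
      5 `^ (alpha + `|q1|) * (a * S `^ alpha * T `^ q1).
      by rewrite powRD ?pnatr_eq0 ?implybT//; ring.
    rewrite ler_wpM2r ?mulr_ge0 ?powR_ge0// ?K5//.
  apply: (@le_trans _ _ (b * (5 `^ `|q2| * S `^ q2) * (5 `^ beta * T `^ beta))).
    by apply: ler_pM; rewrite ?mulr_ge0 ?powR_ge0// ler_wpM2l.
  have -> : b * (5 `^ `|q2| * S `^ q2) * (5 `^ beta * T `^ beta) =
    5 `^ (beta + `|q2|) * (b * S `^ q2 * T `^ beta).
    by rewrite powRD ?pnatr_eq0 ?implybT//; ring.
  rewrite ler_wpM2r ?mulr_ge0 ?powR_ge0// ?K5//.
rewrite -[G s1 xi1 - _](subrKA (G s3 xi3)) (le_trans (ler_normD _ _))// -mulrA mulr_natl mulr2n.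
apply: lerD; last rewrite distrC; apply: half; lra.
Qed.

End far_point.

(** In logarithmic coordinates the two terms of [far_point_oscillation] are
    affine in [(s, t)]. Starting at [(f, g)], one coordinate is increased
    along which the exponent of the larger term is negative, if there is one,
    until both terms agree; the common value is a convex combination of the
    two terms. If the exponent that it has in the other coordinate is negative
    as well, it can be made nonpositive; otherwise it is [v], with nonnegative
    exponents [mu] and [nu]. *)
Definition balanced (A B alpha beta q1 q2 f g s t : R) :=
  [/\ f <= s, g <= t &
  (A + alpha * s + q1 * t <= 0 /\ B + q2 * s + beta * t <= 0) \/
  exists2 th, 0 <= th <= 1 &
    let mu := th * alpha + (1 - th) * q2 in
    let nu := th * q1 + (1 - th) * beta in
    let v := th * A + (1 - th) * B + mu * f + nu * g in
    [/\ 0 <= mu, 0 <= nu, A + alpha * s + q1 * t <= v & B + q2 * s + beta * t <= v]].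

Let balance_half (A B alpha beta q1 q2 f g : R) : 0 < alpha -> 0 < beta ->
  A + alpha * f + q1 * g <= B + q2 * f + beta * g ->
  exists s t, balanced A B alpha beta q1 q2 f g s t.
Proof.
move=> al0 be0 XY; have [q20|q20] := leP 0 q2.
  exists f, g; split=> //; right; exists 0; first by rewrite lexx ler01.
  by split; rewrite ?mul0r ?subr0 ?mul1r ?add0r ?(ltW be0)//.
pose D := alpha - q2; have D0 : 0 < D by rewrite /D; lra.
pose th := - q2 / D.
have th01 : 0 <= th <= 1.
  apply/andP; split; first by rewrite divr_ge0 ?ltW// oppr_gt0.
  by rewrite ler_pdivrMr// mul1r /D; lra.
have muE : th * alpha + (1 - th) * q2 = 0.
  by rewrite /th /D; field; rewrite -/D gt_eqF.
pose nu := th * q1 + (1 - th) * beta.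
(* the two terms agree on the line [s = sol t], and [th] is chosen so that
   their convex combination there does not depend on [s] *)
pose sol t := (B - A + (beta - q1) * t) / D.
have v1 t : A + alpha * sol t + q1 * t = th * A + (1 - th) * B + nu * t.
  by rewrite /sol /nu /th /D; field; rewrite -/D gt_eqF.
have v2 t : B + q2 * sol t + beta * t = th * A + (1 - th) * B + nu * t.
  by rewrite /sol /nu /th /D; field; rewrite -/D gt_eqF.
have sol_ge t : (beta - q1) * g <= (beta - q1) * t -> f <= sol t.
  by move=> H; rewrite /sol ler_pdivlMr// /D; lra.
have [nu0|nu0] := leP 0 nu.
  exists (sol g), g; split=> //; first exact: sol_ge.
  by right; exists th => //=; rewrite muE -/nu mul0r addr0 v1 v2.
have q10 : q1 < 0.
  rewrite ltNge; apply/negP => q10; move: nu0; rewrite ltNge => /negP; apply.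
  by have /andP[? ?] := th01; rewrite /nu addr_ge0// mulr_ge0// ?subr_ge0// ltW.
pose t := Num.max g (- (th * A + (1 - th) * B) / nu).
have v0 : th * A + (1 - th) * B + nu * t <= 0.
  have : - (th * A + (1 - th) * B) / nu <= t by rewrite /t le_max lexx orbT.
  by rewrite ler_ndivrMr// mulrC; lra.
have gt : g <= t by rewrite le_max lexx.
exists (sol t), t; split => //; last by left; rewrite v1 v2.
by apply: sol_ge; rewrite ler_wpM2l// subr_ge0; lra.
Qed.

Lemma exists_balanced (A B alpha beta q1 q2 f g : R) : 0 < alpha -> 0 < beta ->
  exists s t, balanced A B alpha beta q1 q2 f g s t.
Proof.
move=> al0 be0.
have [XY|YX] := leP (A + alpha * f + q1 * g) (B + q2 * f + beta * g).
  exact: balance_half.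
have YX' : B + beta * g + q2 * f <= A + q1 * g + alpha * f by lra.
have [t [s [gt fs H]]] := balance_half be0 al0 YX'.
exists s, t; split => //; case: H => [[h1 h2]|[th /andP[th0 th1]/= [h1 h2 h3 h4]]].
  by left; split; lra.
right; exists (1 - th); first by apply/andP; split; lra.
have E : 1 - (1 - th) = th by lra.
by rewrite /= E; split; lra.
Qed.

Lemma powR_expR (x y : R) : expR x `^ y = expR (y * x).
Proof. by rewrite /powR gt_eqF ?expR_gt0// expRK. Qed.

(** Here [t] stands for the measure of the set over which the bound is
    integrated, and [N] for the size of the gradient of the competitor. At a
    balanced point both terms are a product of nonnegative powers of [a], [b],
    [Phi] and [Psi], with exponents that interpolate between the two terms.
    With [M] the sum in the last line, each factor is at most a power of [M /
    t], times a power of [N] for the last two; the conditions on the exponents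
    bound the total power of [M / t] by [e], that of [N] by [p]. *)
Lemma oscillation_young (a b q1 q2 alpha beta sigma1 sigma2 p r e N t Phi Psi : R) :
  0 < a -> 0 < b -> 0 < alpha -> 0 < beta -> 0 < sigma1 -> 0 < sigma2 ->
  0 < p -> 0 < r -> 0 <= e -> e <= 1 ->
  q1 / p + alpha / r + sigma1^-1 <= e -> beta / p + q2 / r + sigma2^-1 <= e ->
  alpha + q1 <= p -> beta + q2 <= p ->
  1 <= N -> 0 < t -> t <= 1 -> 1 <= Phi -> 1 <= Psi ->
  exists S T, [/\ Phi <= S, Psi <= T &
    a * S `^ alpha * T `^ q1 + b * S `^ q2 * T `^ beta <=
    2 * N `^ p * t `^ (- e) *
    (t * a `^ sigma1 + t * b `^ sigma2 + t * (Phi / N) `^ r + t * (Psi / N) `^ p + 1)].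
Proof.
move=> a0 b0 al0 be0 s10 s20 p0 r0 e0 e1 E1 E2 aq bq N1 t0 t1 Ph1 Ps1.
have N0 : 0 < N by lra.
have Ph0 : 0 < Phi by lra.
have Ps0 : 0 < Psi by lra.
set x1 := t * a `^ sigma1; set x2 := t * b `^ sigma2.
set x3 := t * (Phi / N) `^ r; set x4 := t * (Psi / N) `^ p.
have x10 : 0 <= x1 by rewrite mulr_ge0 ?powR_ge0 ?ltW.
have x20 : 0 <= x2 by rewrite mulr_ge0 ?powR_ge0 ?ltW.
have x30 : 0 <= x3 by rewrite mulr_ge0 ?powR_ge0 ?ltW.
have x40 : 0 <= x4 by rewrite mulr_ge0 ?powR_ge0 ?ltW.
set M := x1 + x2 + x3 + x4 + 1; have M1 : 1 <= M by rewrite /M; lra.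
have xM1 : x1 <= M by rewrite /M; lra.
have xM2 : x2 <= M by rewrite /M; lra.
have xM3 : x3 <= M by rewrite /M; lra.
have xM4 : x4 <= M by rewrite /M; lra.
have Np1 : 1 <= N `^ p by rewrite -[leLHS](powRr0 N) ler_powR// ltW.
have te1 : 1 <= t `^ (- e).
  by rewrite -[leLHS](powRr0 t); apply: ger_powR; [rewrite t0|rewrite oppr_le0].
have [ls [lt [hs ht H]]] := exists_balanced (ln a) (ln b) q1 q2 (ln Phi) (ln Psi) al0 be0.
exists (expR ls), (expR lt); split.
- by rewrite -[leLHS]lnK ?posrE// ler_expR.
- by rewrite -[leLHS]lnK ?posrE// ler_expR.
have Ea : a * expR ls `^ alpha * expR lt `^ q1 = expR (ln a + alpha * ls + q1 * lt).
  by rewrite !powR_expR !expRD lnK ?posrE.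
have Eb : b * expR ls `^ q2 * expR lt `^ beta = expR (ln b + q2 * ls + beta * lt).
  by rewrite !powR_expR !expRD lnK ?posrE.
rewrite Ea Eb.
suff [K1 K2] : expR (ln a + alpha * ls + q1 * lt) <= N `^ p * t `^ (- e) * M /\
    expR (ln b + q2 * ls + beta * lt) <= N `^ p * t `^ (- e) * M.
  by rewrite -!mulrA mulr_natl mulr2n !mulrA lerD.
case: H => [[h1 h2]|[th /andP[th0 th1]/=]].
  have K : 1 <= N `^ p * t `^ (- e) * M by rewrite !mulr_ege1.
  by split; apply: le_trans K; rewrite -[leRHS]expR0 ler_expR.
set mu := th * alpha + _; set nu := th * q1 + _ => -[mu0 nu0 h1 h2].
suff K : expR (th * ln a + (1 - th) * ln b + mu * ln Phi + nu * ln Psi) <=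
    N `^ p * t `^ (- e) * M.
  by split; apply: le_trans K; rewrite ler_expR.
pose lM := ln (M / t).
have Mt1 : 1 <= M / t by rewrite ler_pdivlMr// mul1r (le_trans t1).
have lM0 : 0 <= lM by rewrite ln_ge0.
have B1 (x c : R) : 0 < x -> 0 < c -> t * x `^ c <= M -> ln x <= lM / c.
  move=> x0 c0 H; rewrite ler_pdivlMr// mulrC -ln_powR ler_ln ?posrE ?powR_gt0//.
    by rewrite ler_pdivlMr// mulrC.
  by rewrite (lt_le_trans _ Mt1).
have y1 : ln a <= lM / sigma1 by exact: B1.
have y2 : ln b <= lM / sigma2 by exact: B1.
have y3 : ln Phi <= ln N + lM / r.
  rewrite -lerBlDl -ln_div ?posrE//; by apply: B1; rewrite ?divr_gt0.
have y4 : ln Psi <= ln N + lM / p.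
  rewrite -lerBlDl -ln_div ?posrE//; by apply: B1; rewrite ?divr_gt0.
have lN0 : 0 <= ln N by rewrite ln_ge0.
have -> : N `^ p * t `^ (- e) * M = expR (p * ln N + - e * ln t + ln M).
  by rewrite !expRD lnK ?posrE ?(lt_le_trans _ M1)// /powR !gt_eqF.
rewrite ler_expR.
have lME : lM = ln M - ln t by rewrite /lM ln_div ?posrE ?(lt_le_trans _ M1).
have lt0 : ln t <= 0 by rewrite ln_le0.
have lm0 : 0 <= ln M by rewrite ln_ge0.
have th1' : 0 <= 1 - th by rewrite subr_ge0.
apply: (@le_trans _ _ (th * (lM / sigma1) + (1 - th) * (lM / sigma2) +
    mu * (ln N + lM / r) + nu * (ln N + lM / p))).
  by rewrite !lerD// ler_wpM2l.
have -> : th * (lM / sigma1) + (1 - th) * (lM / sigma2) +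
    mu * (ln N + lM / r) + nu * (ln N + lM / p) =
    (th * (alpha + q1) + (1 - th) * (beta + q2)) * ln N +
    (th * (q1 / p + alpha / r + sigma1^-1) + (1 - th) * (beta / p + q2 / r + sigma2^-1)) * lM.
  by rewrite /mu /nu; ring.
have cv (x y z : R) : x <= z -> y <= z -> th * x + (1 - th) * y <= z.
  move=> xz yz; have -> : z = th * z + (1 - th) * z by ring.
  by rewrite lerD// ler_wpM2l.
have h3 : (th * (alpha + q1) + (1 - th) * (beta + q2)) * ln N <= p * ln N.
  by rewrite ler_wpM2r// cv.
have h4 : (th * (q1 / p + alpha / r + sigma1^-1) +
    (1 - th) * (beta / p + q2 / r + sigma2^-1)) * lM <= e * lM.
  by rewrite ler_wpM2r// cv.
apply: (le_trans (lerD h3 h4)); rewrite lME mulrBr mulNr -addrA lerD2l [leRHS]addrC lerD2r.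
by rewrite ler_piMl.
Qed.

End oscillation.

(** * Weak derivatives with respect to Lebesgue measure *)

Section monotone_integral.
Context d (T : measurableType d) {R : realType}.
Variable mu : {measure set T -> \bar R}.
Implicit Types f g : T -> R.
Local Open Scope ereal_scope.

Let nnintegral_le (f g : T -> \bar R) : (forall x, 0 <= f x) ->
  (forall x, f x <= g x) -> \int[mu]_x f x <= \int[mu]_x g x.
Proof.
move=> f0 fg; have g0 x : 0 <= g x by exact: le_trans (fg x).
rewrite !ge0_integralTE//; apply: ge_ereal_sup => _ [h hf <-].
by apply: ereal_sup_ubound; exists h => // x; exact: le_trans (fg x).
Qed.

(** No measurability is asked of [f]: the integral of a nonnegative function
    is a supremum over simple functions below it, hence monotone. The energy
    of a competitor can thus be estimated although its integrand need not be
    known to be measurable. *)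
Lemma integral_ae_le_integrable f g : L1 mu g ->
  {ae mu, forall x, (f x <= g x)%R} ->
  \int[mu]_x (f x)%:E <= \int[mu]_x (g x)%:E.
Proof.
move=> Lg [M [mM M0 HM]].
have fg x : ~ M x -> (f x <= g x)%R.
  by move=> Mx; apply: contrapT => H; apply/Mx/HM.
have mg := L1_measurable Lg.
have mgE : measurable_fun setT (EFin \o g) by exact/measurable_EFinP.
have mif (c : \bar R) (k : T -> \bar R) : measurable_fun setT k ->
    measurable_fun setT (fun x => if x \in M then c else k x).
  move=> mk; apply: measurable_fun_ifT => //.
  by apply: (measurable_fun_bool true); rewrite setTI preimage_mem_true.
have aeE (c : \bar R) (k : T -> \bar R) :
    ae_eq mu setT k (fun x => if x \in M then c else k x).
  exists M; split => // x /=; apply: contra_notP => Mx _.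
  by case: ifPn => // /set_mem.
rewrite integralE [leRHS]integralE; apply: leeB.
- rewrite [leRHS](ge0_ae_eq_integral _ _ _ _ _ (aeE +oo _))//; first last.
  + by move=> x _; case: ifP => // _; exact: funepos_ge0.
  + by apply: mif; exact: measurable_funepos.
  + exact: measurable_funepos.
  apply: nnintegral_le => // x; case: ifPn => [_|]; first by rewrite leey.
  rewrite notin_setE => /fg H; rewrite !funeposE/= -!EFin_max lee_fin.
  by rewrite ge_max !le_max H lexx orbT.
- rewrite [leLHS](ge0_ae_eq_integral _ _ _ _ _ (aeE 0 _))//; first last.
  + by move=> x _; case: ifP => // _; exact: funeneg_ge0.
  + by apply: mif; exact: measurable_funeneg.
  + exact: measurable_funeneg.
  apply: nnintegral_le => x; first by case: ifPn => // _; exact: funeneg_ge0.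
  case: ifPn => [_|]; first exact: funeneg_ge0.
  rewrite notin_setE => /fg H; rewrite !funenegE/= -!EFin_max lee_fin.
  by rewrite ge_max !le_max lerN2 H lexx orbT.
Qed.

End monotone_integral.

Section lebesgue_weak_derivatives.
Context {R : realType} {n : nat}.
Local Notation mu := (@borel_lebesgue R n).
Local Notation la := (@lebesgue R n).
Local Notation X := 'rV[R]_n.
Implicit Types (f g V psi zeta : X -> R) (j : 'I_n).

Lemma integral_borel_version f f' (M : set X) :
  measurable_fun [set: Rn R n] (f : Rn R n -> R) -> measurable_fun setT f' ->
  measurable M -> mu M = 0%E -> (forall x, ~ M x -> f x = f' x) ->
  (\int[la]_x (f x)%:E = \int[mu]_x (f' x)%:E)%E.
Proof.
move=> mf mf' mM M0 E; rewrite -(integral_lebesgueE (f := EFin \o f')); last exact/measurable_EFinP.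
apply: ae_eq_integral; [exact: measurableT|exact/measurable_EFinP| |].
  by apply/measurable_EFinP; exact: measurable_fun_Rn.
exists M; split; [exact: measurable_Rn|by rewrite lebesgueE|].
by move=> x /=; apply: contra_notP => Mx _; rewrite /= E.
Qed.

Lemma L1_borel_version f f' (M : set X) :
  measurable_fun [set: Rn R n] (f : Rn R n -> R) -> measurable_fun setT f' ->
  measurable M -> mu M = 0%E -> (forall x, ~ M x -> f x = f' x) ->
  L1 la f <-> L1 mu f'.
Proof.
move=> mf mf' mM M0 E.
have H : (\int[la]_x (`|f x|)%:E = \int[mu]_x (`|f' x|)%:E)%E.
  have na : measurable_fun [set: Rn R n] ((fun x => `|f x|) : Rn R n -> R).
    exact: (measurableT_comp (@normr_measurable R setT) mf).
  have nb : measurable_fun setT (fun x => `|f' x|).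
    exact: (measurableT_comp (@normr_measurable R setT) mf').
  apply: (integral_borel_version na nb mM M0).
  by move=> x /E ->.
split=> /integrableP[_ Hoo]; apply/integrableP; split; try exact/measurable_EFinP.
  by move: Hoo => /=; rewrite H.
by move: Hoo => /=; rewrite H.
Qed.

Definition lebesgue_weak_partial j V g := forall psi, test_function setT psi ->
  \int[la]_x (V x * partial j psi x) = - \int[la]_x (g x * psi x).

Lemma lebesgue_weak_partialP j V g V' g' (M : set X) :
  L1 la V -> L1 la g -> measurable_fun setT V' -> measurable_fun setT g' ->
  measurable M -> mu M = 0%E ->
  (forall x, ~ M x -> V x = V' x) -> (forall x, ~ M x -> g x = g' x) ->
  lebesgue_weak_partial j V g <-> weak_partial j V' g'.
Proof.
move=> LV Lg mV' mg' mM M0 EV Eg.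
have H (f f' psi : X -> R) : L1 la f -> measurable_fun setT f' ->
    (forall x, ~ M x -> f x = f' x) -> measurable_fun setT psi ->
    \int[la]_x (f x * psi x) = \int[mu]_x (f' x * psi x).
  move=> Lf mf' E mp; congr fine.
  have na : measurable_fun [set: Rn R n] ((fun x => f x * psi x) : Rn R n -> R).
    by apply: measurable_funM; [exact: L1_measurable Lf|exact: measurable_fun_Rn].
  apply: (integral_borel_version na (measurable_funM mf' mp) mM M0).
  by move=> x /E ->.
split=> W psi tp; have mp := test_measurable tp; have mdp := test_measurable (test_partial j tp).
  by rewrite -(H V)// -(H g)// W.
by rewrite (H V V')// (H g g')// W.
Qed.

(** One null set serves for the function and its derivatives. The
    representative vanishes wherever [V] does, so that bounds on the measure
    of the support pass to it. *)
Lemma borel_versions V (g : 'I_n -> X -> R) : L1 la V -> (forall j, L1 la (g j)) ->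
  exists (M : set X) V' (g' : 'I_n -> X -> R), [/\ measurable M, mu M = 0%E,
    measurable_fun setT V', forall j, measurable_fun setT (g' j) &
    [/\ forall x, ~ M x -> V x = V' x, forall j x, ~ M x -> g j x = g' j x &
      forall x, V' x != 0 -> V x != 0]].
Proof.
move=> LV Lg.
have [M0 [mM0 nM0 mV]] := borel_version (L1_measurable LV).
have /choice[M HM] : forall j, exists M : set X, [/\ measurable M, mu M = 0%E &
    measurable_fun setT ((g j) \_ (~` M))].
  by move=> j; exact: borel_version (L1_measurable (Lg j)).
pose G (k : nat) := if insub k is Some j then M j else set0.
pose MM := M0 `|` \bigcup_k G k.
exists MM, (V \_ (~` M0)), (fun j => (g j) \_ (~` M j)); split.
- apply: measurableU; first exact: mM0.
  by apply: bigcupT_measurable => k; rewrite /G; case: insubP => // j _ _; have [] := HM j.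
- have : mu.-negligible MM.
    apply: negligibleU; first exact/negligibleP.
    apply: negligible_bigcup => k; rewrite /G; case: insubP => [j _ _|_].
      by have [mMj nMj _] := HM j; exact/negligibleP.
    exact: negligible_set0.
  move/measure_negligible; apply; apply: measurableU; first exact: mM0.
  by apply: bigcupT_measurable => k; rewrite /G; case: insubP => // j _ _; have [] := HM j.
- by [].
- by move=> j; have [] := HM j.
- split.
  + by move=> x nM; rewrite patchE mem_set// => Mx; apply: nM; left.
  + move=> j x nM; rewrite patchE mem_set// => Mx; apply: nM; right.
    by exists j => //; rewrite /G insubT//= => lt_jn; rewrite (_ : Sub _ _ = j)//; exact: val_inj.
  + by move=> x; rewrite patchE; case: ifP => // _; rewrite eqxx.
Qed.

Lemma lebesgue_weak_partial_pos_part j V g : L1 la V -> L1 la g ->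
  lebesgue_weak_partial j V g ->
  lebesgue_weak_partial j (fun x => Num.max (V x) 0) (fun x => if 0 < V x then g x else 0).
Proof.
move=> LV Lg W.
have [M [V' [g' [mM M0 mV' mg' [EV Eg _]]]]] := borel_versions LV (fun=> Lg).
have LV' : L1 mu V' by apply/(L1_borel_version (L1_measurable LV) mV' mM M0 EV).
have Lg' : L1 mu (g' j) by apply/(L1_borel_version (L1_measurable Lg) (mg' j) mM M0 (Eg j)).
have W' : weak_partial j V' (g' j).
  by apply/(lebesgue_weak_partialP j LV Lg mV' (mg' j) mM M0 EV (Eg j)).
apply/(@lebesgue_weak_partialP j _ _ (fun x => Num.max (V' x) 0)
  (fun x => if 0 < V' x then g' j x else 0) M) => //.
- apply: L1_dom (L1_norm LV) _.
    by apply: measurable_maxr; [exact: L1_measurable LV|exact: measurable_cst].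
  move=> x; rewrite ger0_norm ?le_max ?lexx ?orbT// ge_max ler_norm normr_ge0//.
- apply: L1_dom (L1_norm Lg) _.
    apply: measurable_fun_ifT; [|exact: L1_measurable Lg|exact: measurable_cst].
    by apply: measurable_fun_ltr; [exact: measurable_cst|exact: L1_measurable LV].
  by move=> x; case: ifP; rewrite // normr0.
- exact: measurable_maxr.
- by apply: measurable_fun_ifT => //; exact: measurable_fun_ltr.
- by move=> x /EV ->.
- by move=> x Mx; rewrite EV// (Eg j).
- exact: weak_partial_pos_part.
Qed.

Definition sobolev_bound (p r v0 C : R) := forall V (g : 'I_n -> X -> R) (N : R),
  L1 la V -> (forall j, L1 la (g j)) -> (forall j, lebesgue_weak_partial j V (g j)) ->
  (forall j, L1 la (fun x => `|g j x| `^ p)) -> 0 < N ->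
  (forall j, \int[la]_x (`|g j x| `^ p) <= N `^ p) ->
  (la [set x | (V x != 0)%R] <= v0%:E)%E ->
  (\int[la]_x (`|V x| `^ r)%:E <= (C * N `^ r)%:E)%E.

Lemma lebesgue_sobolev (p r v0 : R) : (0 < n)%N -> 1 < p -> p < n%:R ->
  0 < r -> r < (p^-1 - n%:R^-1)^-1 -> exists2 C, 0 < C & sobolev_bound p r v0 C.
Proof.
move=> n0 p1 pn r0 rps; have [C C0 H] := @sobolev_subcritical R n p r v0 n0 p1 pn r0 rps.
exists C => // V g N LV Lg W Lgp N0 Ig Vv0.
have [M [V' [g' [mM M0 mV' mg' [EV Eg V'V]]]]] := borel_versions LV Lg.
have mp q f : measurable_fun setT f -> measurable_fun setT (fun x : X => `|f x| `^ q).
  by move=> mf; apply: (measurableT_comp (measurable_powR _)); exact: measurableT_comp.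
have mp' q f : measurable_fun setT (f : Rn R n -> R) -> measurable_fun setT (fun x : Rn R n => `|f x| `^ q).
  by move=> mf; apply: (measurableT_comp (measurable_powR _)); exact: measurableT_comp.
have Egp j x : ~ M x -> `|g j x| `^ p = `|g' j x| `^ p by move=> Mx; rewrite Eg.
have mgp j := mp' p _ (L1_measurable (Lg j)).
rewrite (integral_borel_version (f' := fun x => `|V' x| `^ r) _ _ mM M0); first last.
- by move=> x Mx; rewrite EV.
- exact: mp.
- by apply: mp'; exact: L1_measurable LV.
apply: (H _ g' _ _ _ _ _ N0).
- by apply/(L1_borel_version (L1_measurable LV) mV' mM M0 EV).
- by move=> j; apply/(L1_borel_version (L1_measurable (Lg j)) (mg' j) mM M0 (Eg j)).
- by move=> j; apply/(lebesgue_weak_partialP j LV (Lg j) mV' (mg' j) mM M0 EV (Eg j)).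
- by move=> j; apply/(L1_borel_version (mgp j) (mp p _ (mg' j)) mM M0 (Egp j)).
- move=> j; rewrite /Rintegral -(integral_borel_version (mgp j) (mp p _ (mg' j)) mM M0 (Egp j)).
  exact: Ig.
- apply: le_trans Vv0; rewrite -lebesgueE; last exact: measurable_support.
  by apply: (le_outer_measure (mu_ext mu)) => x; exact: V'V.
Qed.

End lebesgue_weak_derivatives.

Arguments sobolev_bound {R} n p r v0 C.

Section cutoff.
Context {R : realType} {n : nat}.
Local Notation mu := (@borel_lebesgue R n).
Local Notation la := (@lebesgue R n).
Local Notation X := 'rV[R]_n.
Local Notation "''e_' j" := (delta_mx ord0 j : 'rV[R]_n) (at level 8, j at level 2).
Implicit Types (f g psi zeta : X -> R) (j : 'I_n) (Omega : set X).

Lemma LpP Omega (p : R) f : 0 < p ->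
  Lp Omega p f <-> measurable_fun [set: Rn R n] (f \_ Omega : Rn R n -> R) /\
    L1 la (fun x => `|(f \_ Omega) x| `^ p).
Proof.
move=> p0; set g := f \_ Omega.
have E : ('N[la]_p%:E[EFin \o (g : Rn R n -> R)] =
    (\int[la]_x (`|g x| `^ p)%:E) `^ p^-1)%E.
  by rewrite unlock.
have I0 : (0 <= \int[la]_x (`|g x| `^ p)%:E)%E by apply: integral_ge0 => x _; rewrite lee_fin powR_ge0.
have EL : (measurable_fun [set: Rn R n] (g : Rn R n -> R)) ->
    (\int[la]_x (`|g x| `^ p)%:E < +oo)%E <-> L1 la (fun x => `|g x| `^ p).
  have E2 : (\int[la]_x `|(`|g x| `^ p)%:E| = \int[la]_x (`|g x| `^ p)%:E)%E.
    by apply: eq_integral => x _; rewrite gee0_abs// lee_fin powR_ge0.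
  move=> mg; split=> [H|/integrableP[_]]; last by rewrite /= E2.
  apply/integrableP; split; last by rewrite /= E2.
  apply/measurable_EFinP; apply: (measurableT_comp (measurable_powR _)).
  exact: (measurableT_comp (@normr_measurable R setT) mg).
rewrite /Lp -/g; split.
  rewrite inE/= => /andP[]; rewrite inE/= => mg; rewrite inE/= /finite_norm E => H; split => //.
  by apply/(EL mg); apply: lty_poweRy H; rewrite invr_eq0 gt_eqF.
move=> [mg /(EL mg) H]; rewrite inE/=; apply/andP; split; first by rewrite inE.
by rewrite inE/= /finite_norm E poweR_lty.
Qed.

(** Translations preserve the integral, so every difference quotient of [psi]
    has integral 0. *)
Lemma integral_test_partial psi j : test_function setT psi ->
  \int[la]_x partial j psi x = 0.
Proof.
move=> tp; have sp := test_smooth tp.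
have tdp := test_partial j tp; have mdp := test_measurable tdp.
have -> : \int[la]_x partial j psi x = \int[mu]_x partial j psi x.
  by congr fine; apply: (integral_lebesgueE (f := EFin \o partial j psi)); exact/measurable_EFinP.
have [M M0 HM] := test_bounded tdp; have /test_functionP[_ [N HN]] := tp.
pose h (k : nat) : R := k.+1%:R^-1.
have h0 k : 0 < h k by rewrite invr_gt0.
pose q (k : nat) (x : X) := (h k)^-1 * (psi (x + h k *: 'e_j) - psi x).
have tq k : test_function setT (fun x => psi (x + h k *: 'e_j)) by exact: test_shift.
have q0 k : \int[mu]_x q k x = 0.
  rewrite integral_scale; last by apply: L1B; exact: L1_test.
  rewrite integral_sub; [|exact: L1_test..].
  by rewrite integral_shift ?subrr ?mulr0//; exact: test_measurable.
have ne : `|'e_j| <= 1.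
  have [->//|x0] := eqVneq `|'e_j| 0.
  have [[i k] /= E] := mx_norm_neq0 x0.
  by rewrite [leLHS]E mxE; case: (_ && _); rewrite ?normr1// normr0.
have LB : L1 mu (\1_(nball (N + 1)) : X -> R).
  by apply: L1_indic; [exact: measurable_nball|exact: nball_finite].
have lim : \int[mu]_x q k x @[k --> \oo] --> \int[mu]_x partial j psi x.
  apply: (integral_dominated (g := fun x => M * \1_(nball (N + 1)) x)).
  - by move=> k; apply: measurable_funM => //; apply: measurable_funB; exact: test_measurable.
  - move=> x; have hN : (forall k, h k != 0) /\ (h k @[k --> \oo] --> (0:R)).
      by split=> [k|]; [rewrite gt_eqF|exact: cvg_harmonic].
    have /cvgr_dnbhsP/(_ _ hN) := @partial_cvg R n psi j x sp.
    apply: cvg_trans; apply: near_eq_cvg; near=> k.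
    by rewrite /q /= [_ + x]addrC.
  - exact: L1Z.
  - move=> k x; have [xB|xB] := boolP (x \in nball (N + 1)).
      rewrite indicE xB mulr1 /q normrM gtr0_norm ?invr_gt0// ler_pdivrMl//.
      by rewrite (le_trans (smooth_lipschitz x (h k) sp HM))// mulrC gtr0_norm.
    have nx : N + 1 < `|x| by move: xB; rewrite notin_setE /nball/= => /negP; rewrite -ltNge.
    have px : psi x = 0.
      by apply/eqP; apply: contraTT nx => /HN H; rewrite -leNgt (le_trans H)// lerDl.
    have pxh : psi (x + h k *: 'e_j) = 0.
      apply/eqP; apply: contraTT nx => /HN H; rewrite -leNgt.
      rewrite -[x](addrK (h k *: 'e_j)) (le_trans (ler_normB _ _))// lerD//.
      by rewrite normrZ mulr_ile1// gtr0_norm// invf_le1// ler1n.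
    by rewrite /q px pxh subrr mulr0 normr0 mulr_ge0// indicE.
have E0 : (fun k => \int[mu]_x q k x) = fun=> 0 by exact/funext.
rewrite E0 in lim.
by rewrite -(cvg_lim (@Rhausdorff R) lim) lim_cst.
Unshelve. all: by end_near. Qed.

Section product_rule.
Variables (Omega : set X) (p : R) (f : X -> R) (F : 'I_n -> X -> R).
Hypotheses (p1 : 1 < p) (Lf : Lp Omega p f) (LF : forall j, Lp Omega p (F j)).
Hypothesis W : forall phi, test_function Omega phi -> forall j,
  (\int[la]_(x in Omega) (f x * partial j phi x)%:E =
   - \int[la]_(x in Omega) (F j x * phi x)%:E)%E.

Let p0 : 0 < p. Proof. exact: lt_trans p1. Qed.

Lemma Lp_test_L1 g psi : Lp Omega p g -> test_function setT psi ->
  L1 la (fun x => (g \_ Omega) x * psi x).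
Proof.
move=> /(LpP _ _ p0)[mg Lg] tp; have [M M0 HM] := test_bounded tp.
have mp := test_measurable tp.
have Lp : L1 la psi by apply/(integrable_lebesgueE (f := EFin \o psi)); [exact/measurable_EFinP|exact: L1_test].
apply: (@L1_dom _ _ _ la _ (fun x => `|psi x| + M * (`|(g \_ Omega) x| `^ p))).
- by apply: measurable_funM => //; exact: measurable_fun_Rn.
- by apply: L1D; [exact: L1_norm|exact: L1Z].
- move=> x; rewrite normrM; set t := `|(g \_ Omega) x|.
  have [t1|t1] := leP t 1.
    by rewrite (le_trans (ler_piMl _ t1))// lerDl mulr_ge0// powR_ge0.
  rewrite (le_trans (y := M * (t `^ p)))//; last by rewrite lerDr.
  by rewrite mulrC ler_pM ?normr_ge0// le1r_powR ?(ltW p1) ?(ltW t1).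
Qed.

Lemma test_functionS zeta : test_function Omega zeta -> test_function setT zeta.
Proof. by move=> [? ? _]; split. Qed.

Lemma test_outside zeta x : test_function Omega zeta -> ~ Omega x -> zeta x = 0.
Proof.
move=> [_ _ sO] nO; apply: contrapT => /eqP zx; apply/nO/sO.
by apply: subset_closure; split.
Qed.

Let testM_Omega zeta psi : test_function Omega zeta -> test_function setT psi ->
  test_function Omega (fun x => zeta x * psi x).
Proof.
move=> tz tp; have [sz cz zO] := tz; have sp := test_smooth tp.
have sub : supp setT (fun x => zeta x * psi x) `<=` supp setT zeta.
  by apply: closure_subset => x [_]; rewrite mulf_eq0 negb_or => /andP[zx _].
split; [exact: smoothM| |exact: subset_trans sub zO].
by apply: (subclosed_compact _ cz) => //; exact: closed_closure.
Qed.

(** The function [zeta * psi] is admissible in the definition of the weak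
    gradient on [Omega], whatever the test function [psi] on the whole space.
    The constant [k] contributes only the integral of a partial derivative of
    [zeta * psi], which is 0. *)
Lemma weak_partial_cutoff zeta (s k : R) j : test_function Omega zeta ->
  lebesgue_weak_partial j (fun x => s * (zeta x * ((f \_ Omega) x - k)))
    (fun x => s * (zeta x * (F j \_ Omega) x + ((f \_ Omega) x - k) * partial j zeta x)).
Proof.
move=> tz psi tp; have tz' := test_functionS tz.
have sz := test_smooth tz'; have sp := test_smooth tp.
have tzp := testM_Omega tz tp; have tzp' := test_functionS tzp.
have tdp := test_partial j tp; have tdz := test_partial j tz'.
have tdzp := test_partial j tzp'.
have LT phi : test_function setT phi -> L1 la phi.
  move=> tphi; apply/(integrable_lebesgueE (f := EFin \o phi)); last exact: L1_test.
  by apply/measurable_EFinP; exact: test_measurable.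
have WR : \int[la]_x ((f \_ Omega) x * partial j (fun x => zeta x * psi x) x) =
    - \int[la]_x ((F j \_ Omega) x * (zeta x * psi x)).
  have := W tzp j; rewrite integral_mkcond [in X in _ = X]integral_mkcond.
  have P (g phi : X -> R) : (fun x => (g x * phi x)%:E) \_ Omega = (fun x => ((g \_ Omega) x * phi x)%:E).
    by apply/funext => x; rewrite !patchE; case: ifP => // _; rewrite mul0r.
  rewrite !P => H; rewrite /Rintegral H fineN//.
have I0 := integral_test_partial j tzp'.
have L1a := Lp_test_L1 Lf tdzp; have L1b := Lp_test_L1 (LF j) tzp'.
have tA : test_function setT (fun x => partial j zeta x * psi x) by apply: testM; [exact: smooth_partial|].
have L1c := Lp_test_L1 Lf tA.
have -> : \int[la]_x (s * (zeta x * ((f \_ Omega) x - k)) * partial j psi x) =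
  \int[la]_x (s * ((f \_ Omega) x * partial j (fun x => zeta x * psi x) x -
     (f \_ Omega) x * (partial j zeta x * psi x) - k * partial j (fun x => zeta x * psi x) x +
     k * (partial j zeta x * psi x))).
  by apply: eq_Rintegral => x _; rewrite partialM//; ring.
have -> : \int[la]_x (s * (zeta x * (F j \_ Omega) x + ((f \_ Omega) x - k) * partial j zeta x) * psi x) =
  \int[la]_x (s * ((F j \_ Omega) x * (zeta x * psi x) + (f \_ Omega) x * (partial j zeta x * psi x) -
     k * (partial j zeta x * psi x))).
  by apply: eq_Rintegral => x _; ring.
have Lk1 := L1Z k (LT _ tdzp); have Lk2 := L1Z k (LT _ tA).
rewrite !integral_scale; first last.
- by apply: L1D; first apply: L1B; first apply: L1B.
- by apply: L1B; first apply: L1D.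
rewrite (integral_add (L1B (L1B L1a L1c) Lk1) Lk2) (integral_sub (L1B L1a L1c) Lk1).
rewrite (integral_sub L1a L1c) (integral_sub (L1D L1b L1c) Lk2) (integral_add L1b L1c).
rewrite (integral_scale k (LT _ tdzp)) I0 WR; ring.
Qed.

End product_rule.

End cutoff.

(** * Cutoff functions *)

Section cutoff_function.
Context {R : realType} {n : nat}.
Local Notation X := 'rV[R]_n.
Implicit Types (x : X) (r : R) (j : 'I_n).

Lemma sqnorm_enorm x : sqnorm x = enorm x ^+ 2.
Proof. by rewrite enorm_sqr big_ord1. Qed.

Definition ceball (x0 : X) r : set X := [set x | enorm (x - x0) <= r].

Lemma closed_ceball (x0 : X) r : 0 <= r -> closed (ceball x0 r).
Proof.
move=> r0; rewrite (_ : ceball x0 r = (fun x => sqnorm (x + - x0)) @^-1` [set t | t <= r ^+ 2]).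
  apply: closed_comp => [x _|]; last exact: closed_le.
  by apply/smooth_continuous/smooth_shift; exact: smooth_sqnorm.
by apply/seteqP; split => x /=; rewrite sqnorm_enorm ler_sqr// nnegrE enorm_ge0.
Qed.

Lemma compact_ceball (x0 : X) r : 0 <= r -> compact (ceball x0 r).
Proof.
move=> r0; apply: (subclosed_compact (closed_ceball r0) (@compact_nball R n (`|x0| + r)) _).
move=> x /= xr; rewrite /nball/= -[x](subrKC x0) (le_trans (ler_normD _ _))// lerD2l.
rewrite (le_trans _ xr)// -(ler_pXn2r (n := 2))// ?nnegrE ?enorm_ge0// -sqnorm_enorm.
exact: sqnorm_ge.
Qed.

(** On the inner ball this is not 1 but only bounded below, by [expR (-1)]. In
    exchange, the [p]-th power of its gradient is bounded by its power [p -
    1], see [cutoff_grad], which dispenses with an iteration over radii. *)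
Definition cutoff (x0 : X) (rho r : R) (x : X) : R :=
  flat 0 ((r ^+ 2 - sqnorm (x + - x0)) / (r ^+ 2 - rho ^+ 2)).

Definition cutoff_constant (p : R) : R := 2 `^ p * ((Num.bound (2 * p))`!)%:R.

(** The left-hand side is a power of [t^-1] times [expR (- p / t)], and the
    spare factor [expR (- t^-1)] beats every power. *)
Lemma flat2_powR (p t : R) : 1 < p ->
  flat 2 t `^ p <= ((Num.bound (2 * p))`!)%:R * flat 0 t `^ (p - 1).
Proof.
move=> p1; have p0 : 0 < p by lra.
have [t0|t0] := leP t 0.
  rewrite !flat_le0// powR0 ?gt_eqF// powR0 ?mulr0// gt_eqF// subr_gt0//.
rewrite !flat_gt0// expr0 mul1r; set y := t^-1; have y0 : 0 < y by rewrite invr_gt0.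
rewrite powRM ?exprn_ge0 ?expR_ge0 ?(ltW y0)// !powR_expR.
have -> : p * - y = - y + (p - 1) * - y by ring.
rewrite expRD mulrA ler_wpM2r ?expR_ge0//.
set m := Num.bound (2 * p).
have yE : (y ^+ 2) `^ p = y `^ (2 * p) by rewrite -powR_mulrn ?(ltW y0)// -powRrM.
have [y1|y1] := leP y 1.
  rewrite yE (@le_trans _ _ 1)//; last by rewrite ler1n fact_gt0.
  apply: mulr_ile1; rewrite ?powR_ge0 ?expR_ge0//.
    rewrite -[leRHS](_ : 1 `^ (2 * p) = 1); last by rewrite powR1.
    apply: ge0_ler_powR; rewrite ?nnegrE ?(ltW y0)//.
    by rewrite mulr_ge0 ?(ltW p0).
  by rewrite -[leRHS]expR0 ler_expR oppr_le0 ltW.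
apply: le_trans (expRN_expn_le m (ltW y0)); rewrite ler_wpM2r ?expR_ge0// yE.
rewrite -powR_mulrn ?(ltW y0)//; apply: ler_powR; first exact: ltW.
by apply: ltW; apply: archi_boundP; rewrite mulr_ge0 ?(ltW p0).
Qed.

Section properties.
Variables (x0 : X) (rho r : R).
Hypotheses (rho0 : 0 < rho) (rhor : rho < r).

Let r0 : 0 < r. Proof. exact: lt_trans rhor. Qed.
Let D0 : 0 < r ^+ 2 - rho ^+ 2.
Proof. by rewrite subr_gt0 ltr_sqr ?nnegrE ?ltW. Qed.

Lemma cutoff_smooth : smooth (cutoff x0 rho r).
Proof.
apply: smooth_flat_comp.
rewrite (_ : (fun x => _) = fun x => (r ^+ 2 - sqnorm (x + - x0)) * cst (r ^+ 2 - rho ^+ 2)^-1 x).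
  apply: smoothM; last exact: smooth_cst.
  by apply: (smoothB (smooth_cst _)); apply: smooth_shift; exact: smooth_sqnorm.
by [].
Qed.

Lemma cutoff_ge0 x : 0 <= cutoff x0 rho r x. Proof. exact: flat_ge0. Qed.
Lemma cutoff_le1 x : cutoff x0 rho r x <= 1. Proof. exact: flat0_le1. Qed.

Lemma cutoff_gt0 x : (0 < cutoff x0 rho r x) = (enorm (x - x0) < r).
Proof.
have E : (enorm (x - x0) < r) = (0 < (r ^+ 2 - sqnorm (x + - x0)) / (r ^+ 2 - rho ^+ 2)).
  by rewrite pmulr_lgt0 ?invr_gt0// subr_gt0 sqnorm_enorm ltr_sqr// nnegrE ?enorm_ge0 ?ltW.
rewrite E /cutoff; have [t0|t0] := ltP 0 ((r ^+ 2 - sqnorm (x + - x0)) / (r ^+ 2 - rho ^+ 2)).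
  by rewrite flat_gt0// mulr_gt0 ?expR_gt0// exprn_gt0// invr_gt0.
by rewrite flat_le0// ltxx.
Qed.

Lemma cutoff_ge x : enorm (x - x0) < rho -> expR (-1) <= cutoff x0 rho r x.
Proof.
move=> xr; have q1 : 1 <= (r ^+ 2 - sqnorm (x + - x0)) / (r ^+ 2 - rho ^+ 2).
  rewrite ler_pdivlMr// mul1r lerD2l lerN2 sqnorm_enorm ler_sqr ?nnegrE ?enorm_ge0 ?ltW//.
rewrite /cutoff flat_gt0 ?(lt_le_trans ltr01)// expr0 mul1r ler_expR lerN2.
by rewrite invf_le1// (lt_le_trans ltr01).
Qed.

Lemma cutoff_supp x : cutoff x0 rho r x != 0 -> ceball x0 r x.
Proof. by move=> H; apply/ltW; rewrite -cutoff_gt0 lt_def H cutoff_ge0. Qed.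

Lemma cutoff_test (Omega : set X) : ceball x0 r `<=` Omega ->
  test_function Omega (cutoff x0 rho r).
Proof.
move=> sub; have S : supp setT (cutoff x0 rho r) `<=` ceball x0 r.
  rewrite [X in _ `<=` X]((closure_id _).1 (closed_ceball (ltW r0))).
  by apply: closure_subset => x [_ /cutoff_supp].
split; [exact: cutoff_smooth| |exact: subset_trans S sub].
have C := @compact_ceball x0 r (ltW r0).
by apply: (subclosed_compact _ C S); exact: closed_closure.
Qed.

Lemma partial_sqnorm j x : partial j (@sqnorm R n) x = 2 * x ord0 j.
Proof.
have H i : is_derive x (delta_mx ord0 j) (fun y : X => y ord0 i ^+ 2) (2 * x ord0 i * (i == j)%:R).
  have := @is_deriveX _ _ (fun y : X => y ord0 i) 2 x (delta_mx ord0 j) _ (is_derive_coord x i j).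
  by rewrite expr1.
have [_ E] := is_derive_sum (h := fun i (y : X) => y ord0 i ^+ 2) H.
rewrite /partial (_ : @sqnorm R n = \sum_(i < n) (fun y : X => y ord0 i ^+ 2)); last first.
  by apply/funext => y; rewrite fct_sumE.
rewrite E (bigD1 j)//= eqxx mulr1 big1 ?addr0// => i /negbTE ->.
by rewrite mulr0.
Qed.

(** The derivative of [flat 0] is [flat 2], and the inner derivative is at
    most [2 * r / (r^2 - rho^2)], which is at most [2 / (r - rho)]. *)
Lemma cutoff_grad (p : R) x : 1 < p ->
  enorm (\col_j partial j (cutoff x0 rho r) x) `^ p <=
  cutoff_constant p * cutoff x0 rho r x `^ (p - 1) / (r - rho) `^ p.
Proof.
move=> p1; have p0 : 0 < p by lra.
set q := fun x => (r ^+ 2 - sqnorm (x + - x0)) / (r ^+ 2 - rho ^+ 2).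
have dq j : partial j (cutoff x0 rho r) x =
    flat 2 (q x) * (- 2 / (r ^+ 2 - rho ^+ 2)) * (x - x0) ord0 j.
  have dS : is_derive x (delta_mx ord0 j) (fun x => sqnorm (x + - x0)) (2 * (x - x0) ord0 j).
    have := partial_shift (- x0) j (@smooth_sqnorm R n).
    move=> /(congr1 (fun f => f x)); rewrite partial_sqnorm => <-.
    exact/smooth_is_derive/smooth_shift/smooth_sqnorm.
  have qE : q = (r ^+ 2 - rho ^+ 2)^-1 \*: (cst (r ^+ 2) - (fun x => sqnorm (x + - x0))).
    by apply/funext => y; rewrite /q mulrC.
  have sq : smooth q.
    rewrite (_ : q = fun x => (r ^+ 2 - sqnorm (x + - x0)) * cst (r ^+ 2 - rho ^+ 2)^-1 x)//.
    apply: smoothM; last exact: smooth_cst.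
    by apply: (smoothB (smooth_cst _)); apply: smooth_shift; exact: smooth_sqnorm.
  rewrite /cutoff -/q (partial_flat_comp 0 j x sq) mul0r subr0 -mulrA; congr (_ * _).
  have [_] := is_deriveZ (r ^+ 2 - rho ^+ 2)^-1 (is_deriveB (is_derive_cst (r ^+ 2) x (delta_mx ord0 j)) dS).
  by rewrite -qE -/(partial j q x) => ->; rewrite sub0r -[_ *: _]/(_ * _); ring.
have E : \col_j partial j (cutoff x0 rho r) x =
    (flat 2 (q x) * (- 2 / (r ^+ 2 - rho ^+ 2))) *: (x - x0)^T.
  by apply/colP => j; rewrite !mxE dq !mxE.
have ET : enorm (x - x0)^T = enorm (x - x0).
  rewrite /enorm exchange_big; congr Num.sqrt; apply: eq_bigr => i _.
  by apply: eq_bigr => k _; rewrite mxE.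
have rr : 0 < r - rho by rewrite subr_gt0.
have G : enorm (\col_j partial j (cutoff x0 rho r) x) <= 2 * flat 2 (q x) / (r - rho).
  rewrite E enormZ ET normrM (ger0_norm (flat_ge0 _ _)).
  rewrite normrM normrN normr_nat (gtr0_norm (_ : 0 < (r ^+ 2 - rho ^+ 2)^-1)) ?invr_gt0//.
  have [xr|xr] := leP r (enorm (x - x0)).
    have q0 : q x <= 0.
      by rewrite /q pmulr_lle0 ?invr_gt0// subr_le0 sqnorm_enorm ler_sqr ?nnegrE ?enorm_ge0// ltW.
    by rewrite flat_le0// !(mul0r, mulr0).
  have rs : 0 < r + rho by rewrite addr_gt0.
  have -> : flat 2 (q x) * (2 / (r ^+ 2 - rho ^+ 2)) * enorm (x - x0) =
      2 * flat 2 (q x) / (r - rho) * (enorm (x - x0) / (r + rho)).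
    by field; rewrite !gt_eqF//; rewrite (_ : r ^+ 2 - rho ^+ 2 = (r - rho) * (r + rho)) ?mulr_gt0//; ring.
  rewrite ler_piMr ?divr_ge0 ?mulr_ge0 ?flat_ge0 ?(ltW rr)//.
  by rewrite ler_pdivrMr// mul1r (le_trans (ltW xr))// lerDl ltW.
rewrite (le_trans (y := (2 * flat 2 (q x) / (r - rho)) `^ p))//.
  by apply: ge0_ler_powR; rewrite ?nnegrE ?enorm_ge0 ?(ltW p0)// divr_ge0 ?mulr_ge0 ?flat_ge0// ltW.
rewrite powRM ?mulr_ge0 ?flat_ge0 ?invr_ge0 ?(ltW rr)// powRM ?flat_ge0//.
rewrite -(powR_inv1 (ltW rr)) powRAC powR_inv1 ?powR_ge0//.
rewrite ler_wpM2r ?invr_ge0 ?powR_ge0// /cutoff_constant -mulrA ler_wpM2l ?powR_ge0//.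
exact: flat2_powR.
Qed.

End properties.

End cutoff_function.

(** * The variation and the energy comparison *)

Section powR_inequalities.
Context {R : realType}.

Lemma powRD_le (p x y : R) : 0 <= p -> 0 <= x -> 0 <= y ->
  (x + y) `^ p <= 2 `^ p * (x `^ p + y `^ p).
Proof.
move=> p0; wlog xy : x y / x <= y.
  by move=> H x0 y0; have [/H|/ltW/H] := leP x y; [|rewrite addrC [X in _ * X]addrC]; apply.
move=> x0 y0; apply: (@le_trans _ _ (2 `^ p * y `^ p)).
  rewrite -powRM//; apply: ge0_ler_powR; rewrite ?nnegrE ?addr_ge0 ?mulr_ge0//.
  by rewrite mulr_natl mulr2n lerD2r.
by rewrite ler_wpM2l ?powR_ge0// lerDr powR_ge0.
Qed.

Lemma powR_convex (p z x y : R) : 1 <= p -> 0 <= z <= 1 -> 0 <= x -> 0 <= y ->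
  ((1 - z) * x + z * y) `^ p <= (1 - z) * x `^ p + z * y `^ p.
Proof.
move=> p1 /andP[z0 z1] x0 y0.
rewrite addrC [leRHS]addrC.
by apply: (convex_powR p1 (Itv01 z0 z1)); rewrite ?inE/= ?in_itv/= ?andbT.
Qed.

(** The vector is a convex combination of [A] and of [- (w / z) *: B], and
    convexity leaves the factor [z^(1-p)], which the hypothesis on [B]
    compensates. *)
Lemma convex_gradient (n : nat) (p z w c : R) (A B : 'cV[R]_n) : 1 < p ->
  0 < z -> z <= 1 -> 0 <= w -> enorm B `^ p <= c * z `^ (p - 1) ->
  enorm ((1 - z) *: A - w *: B) `^ p <= (1 - z) * enorm A `^ p + c * w `^ p.
Proof.
move=> p1 z0 z1 w0 HB; have p0 : 0 < p by lra.
have nA := enorm_ge0 A; have nB := enorm_ge0 B.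
apply: (@le_trans _ _ (((1 - z) * enorm A + z * (w * enorm B / z)) `^ p)).
  apply: ge0_ler_powR; rewrite ?nnegrE ?enorm_ge0 ?(ltW p0)//.
    by rewrite addr_ge0// mulr_ge0 ?subr_ge0// ?(ltW z0)// divr_ge0 ?mulr_ge0// ltW.
  rewrite (le_trans (enormB _ _))// !enormZ !ger0_norm ?subr_ge0//.
  by rewrite mulrCA divff ?mulr1// gt_eqF.
rewrite (le_trans (powR_convex _ _ _ _))// ?(ltW p1)//.
- by rewrite (ltW z0).
- by rewrite divr_ge0 ?mulr_ge0// ltW.
rewrite lerD2l !powRM ?mulr_ge0 ?invr_ge0 ?(ltW z0)//.
have zp : z * (z^-1 `^ p) = (z `^ (p - 1))^-1.
  rewrite -(powR_inv1 (ltW z0)) -powRrM mulN1r powRN -[X in X / _](powRr1 (ltW z0)).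
  by rewrite -powRN -powRD ?(gt_eqF z0) ?implybT// -powRN; congr (_ `^ _); ring.
rewrite mulrCA zp -mulrA [c * _]mulrC ler_wpM2l ?powR_ge0//.
by rewrite ler_pdivrMr ?powR_gt0.
Qed.

End powR_inequalities.

Section p_integrable.
Context {R : realType} {n : nat}.
Local Notation la := (@lebesgue R n).
Local Notation X := 'rV[R]_n.
Implicit Types (f g psi : X -> R).

Definition p_integrable (p : R) f := measurable_fun [set: Rn R n] (f : Rn R n -> R) /\
  L1 la (fun x => `|f x| `^ p).

Variable p : R.
Hypothesis p0 : 0 < p.

Let measurable_p f : measurable_fun [set: Rn R n] (f : Rn R n -> R) ->
  measurable_fun [set: Rn R n] ((fun x => `|f x| `^ p) : Rn R n -> R).
Proof.
move=> mf; apply: (measurableT_comp (measurable_powR _)).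
exact: (measurableT_comp (@normr_measurable R setT) mf).
Qed.

Lemma p_integrable_dom f g : measurable_fun [set: Rn R n] (f : Rn R n -> R) ->
  p_integrable p g -> (forall x, `|f x| <= `|g x|) -> p_integrable p f.
Proof.
move=> mf [mg Lg] fg; split => //; apply: (L1_dom _ Lg); first exact: measurable_p.
move=> x; rewrite ger0_norm ?powR_ge0//.
by apply: ge0_ler_powR; rewrite ?nnegrE ?(ltW p0).
Qed.

Lemma p_integrableD f g : p_integrable p f -> p_integrable p g ->
  p_integrable p (fun x => f x + g x).
Proof.
move=> [mf Lf] [mg Lg].
have mfg : measurable_fun [set: Rn R n] ((fun x => f x + g x) : Rn R n -> R).
  exact: measurable_funD.
split => //; apply: (@L1_dom _ _ _ la _ (fun x => 2 `^ p * (`|f x| `^ p + `|g x| `^ p))).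
- exact: measurable_p.
- by apply: L1Z; exact: L1D.
- move=> x; rewrite ger0_norm ?powR_ge0//.
  apply: le_trans (powRD_le (ltW p0) (normr_ge0 _) (normr_ge0 _)).
  by apply: ge0_ler_powR; rewrite ?nnegrE ?(ltW p0)// ?addr_ge0// ler_normD.
Qed.

Lemma p_integrableZ (c : R) f : p_integrable p f -> p_integrable p (fun x => c * f x).
Proof.
move=> [mf Lf]; split; first by apply: measurable_funM => //; exact: measurable_cst.
rewrite (_ : (fun x => _) = fun x => `|c| `^ p * `|f x| `^ p); first exact: L1Z.
by apply/funext => x; rewrite normrM powRM.
Qed.

Lemma p_integrable0 : p_integrable p (fun=> 0).
Proof.
split; first exact: measurable_cst.
rewrite (_ : (fun x => _) = fun=> 0); first exact: L10.
by apply/funext => x; rewrite normr0 powR0// gt_eqF.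
Qed.

Lemma p_integrable_indic (A : set X) : measurable A -> (borel_lebesgue n A < +oo)%E ->
  p_integrable p (\1_A : X -> R).
Proof.
move=> mA Aoo; split; first exact/measurable_fun_Rn/measurable_indic.
rewrite (_ : (fun x => _) = \1_A).
  by apply: L1_indic; [exact: measurable_Rn|rewrite lebesgueE].
apply/funext => x; rewrite indicE; case: (_ \in _); rewrite ?normr1 ?powR1//.
by rewrite normr0 powR0// gt_eqF.
Qed.

Lemma p_integrable_test psi : test_function setT psi -> p_integrable p psi.
Proof.
move=> tp; have [M M0 HM] := test_bounded tp; have /test_functionP[_ [N HN]] := tp.
have B := p_integrable_indic (@measurable_nball R n N) (@nball_finite R n N).
apply: (p_integrable_dom _ (p_integrableZ M B)).
  by apply: measurable_fun_Rn; exact: test_measurable.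
move=> x; have [->|/HN xN] := eqVneq (psi x) 0; first by rewrite normr0.
by rewrite indicE mem_set// mulr1 (ger0_norm M0).
Qed.

Lemma p_integrableM_test f psi : p_integrable p f -> test_function setT psi ->
  p_integrable p (fun x => f x * psi x).
Proof.
move=> [mf Lf] tp; have [M M0 HM] := test_bounded tp.
apply: (@p_integrable_dom _ (fun x => M * f x)); last first.
- by move=> x; rewrite !normrM mulrC ler_wpM2r// (ger0_norm M0).
- by apply: p_integrableZ.
- by apply: measurable_funM => //; apply: measurable_fun_Rn; exact: test_measurable.
Qed.

Lemma p_integrable_norm f : p_integrable p f -> p_integrable p (fun x => `|f x|).
Proof.
move=> Hf; have [mf _] := Hf; apply: (p_integrable_dom _ Hf) => [|x].
  exact: (measurableT_comp (@normr_measurable R setT) mf).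
by rewrite normr_id.
Qed.

Lemma p_integrable_sum (J : Type) (t : seq J) (F : J -> X -> R) :
  (forall j, p_integrable p (F j)) -> p_integrable p (fun x => \sum_(j <- t) F j x).
Proof.
move=> HF; elim: t => [|j t IH].
  by under eq_fun do rewrite big_nil; exact: p_integrable0.
by under eq_fun do rewrite big_cons; exact: p_integrableD.
Qed.

Lemma Lp_p_integrable (Omega : set X) f : Lp Omega p f <-> p_integrable p (f \_ Omega).
Proof. exact: LpP. Qed.

End p_integrable.

Lemma energy_increment {R : realFieldType} (A A' S g g' z B H : R) :
  A' <= (1 - z) * A + B -> g' - g <= H ->
  A' + S + g' <= A + S + g + (- (z * A) + B + H).
Proof. lra. Qed.

Section variation.
Context {R : realType} {n m : nat}.
Local Notation la := (@lebesgue R n).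
Local Notation X := 'rV[R]_n.
Variables (p : R) (Omega : set X) (u : X -> 'rV[R]_m) (Du : X -> 'M[R]_(n, m)).
Hypotheses (p1 : 1 < p) (oO : open Omega) (Wu : W1p p Omega u Du).
Variables (zeta : X -> R) (s k : R) (i : 'I_m).
Hypotheses (tz : test_function Omega zeta) (z0 : forall x, 0 <= zeta x)
  (z1 : forall x, zeta x <= 1) (s1 : `|s| = 1).

Let p0 : 0 < p. Proof. exact: lt_trans p1. Qed.

(** Extended by 0, as in the definition of [Lp]. *)
Definition component (l : 'I_m) : X -> R := (fun x => u x ord0 l) \_ Omega.
Definition dcomponent (j : 'I_n) (l : 'I_m) : X -> R := (fun x => Du x j l) \_ Omega.

(** The sign [s] is 1 for superlevel and -1 for sublevel sets, which are thus
    treated together. *)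
Definition excess (x : X) : R := s * (zeta x * (component i x - k)).
Definition dexcess (j : 'I_n) (x : X) : R :=
  s * (zeta x * dcomponent j i x + (component i x - k) * partial j zeta x).
Definition dexcess_pos (j : 'I_n) (x : X) : R := if 0 < excess x then dexcess j x else 0.

(** On the side of the level [k] that [s] selects, the component [i] is
    replaced by a convex combination of itself and of [k], with weights [1 -
    zeta] and [zeta]; elsewhere nothing changes. *)
Definition variation (x : X) : 'rV[R]_m := (- s * Num.max (excess x) 0) *: delta_mx ord0 i.
Definition dvariation (x : X) : 'M[R]_(n, m) :=
  \matrix_(j, l) (if l == i then - s * dexcess_pos j x else 0).

Let tz' := test_functionS tz.
Let tdz j := test_partial j tz'.

Lemma p_integrable_component l : p_integrable p (component l).
Proof. by case: Wu => H _ _; apply/(Lp_p_integrable p0); exact: H. Qed.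

Lemma p_integrable_dcomponent j l : p_integrable p (dcomponent j l).
Proof. by case: Wu => _ H _; apply/(Lp_p_integrable p0); exact: H. Qed.

Lemma p_integrable_excess : p_integrable p excess.
Proof.
rewrite (_ : excess = fun x => s * (component i x * zeta x + - k * zeta x)).
  apply: p_integrableZ; apply: (p_integrableD p0).
    by exact: (p_integrableM_test p0 (p_integrable_component i) _).
  by apply: p_integrableZ; exact: (p_integrable_test p0).
by apply/funext => x; rewrite /excess; ring.
Qed.

Lemma p_integrable_dexcess j : p_integrable p (dexcess j).
Proof.
rewrite (_ : dexcess j = fun x => s * (dcomponent j i x * zeta x +
    (component i x * partial j zeta x + - k * partial j zeta x))).
  apply: p_integrableZ; apply: (p_integrableD p0); last apply: (p_integrableD p0).
  - by exact: (p_integrableM_test p0 (p_integrable_dcomponent j i) _).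
  - by exact: (p_integrableM_test p0 (p_integrable_component i) _).
  - by apply: p_integrableZ; exact: (p_integrable_test p0).
by apply/funext => x; rewrite /dexcess; ring.
Qed.

Lemma excess_outside x : ~ Omega x -> excess x = 0.
Proof. by move=> nO; rewrite /excess (test_outside tz nO) mul0r mulr0. Qed.

Lemma L1_excess : L1 la excess.
Proof.
rewrite (_ : excess = fun x => s * (component i x * zeta x - k * zeta x)); last first.
  by apply/funext => x; rewrite /excess; ring.
have [Lu _ _] := Wu.
apply: L1Z; apply: L1B; first exact: (Lp_test_L1 p1 (Lu i) tz').
apply: L1Z; apply/(integrable_lebesgueE (f := EFin \o zeta)); last exact: L1_test.
by apply/measurable_EFinP; exact: test_measurable.
Qed.

Lemma L1_dexcess j : L1 la (dexcess j).
Proof.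
rewrite (_ : dexcess j = fun x => s * (dcomponent j i x * zeta x +
    (component i x * partial j zeta x - k * partial j zeta x))); last first.
  by apply/funext => x; rewrite /dexcess; ring.
have [Lu LD _] := Wu.
apply: L1Z; apply: L1D; first exact: (Lp_test_L1 p1 (LD j i) tz').
apply: L1B; first exact: (Lp_test_L1 p1 (Lu i) (tdz j)).
apply: L1Z; apply/(integrable_lebesgueE (f := EFin \o partial j zeta)); last exact: L1_test.
by apply/measurable_EFinP; exact: test_measurable.
Qed.

Lemma weak_partial_excess j : lebesgue_weak_partial j excess (dexcess j).
Proof.
have [Lu LD W] := Wu.
apply: (weak_partial_cutoff p1 (Lu i) (fun j => LD j i)) => // phi tphi l.
exact: W.
Qed.

Lemma weak_partial_excess_pos j :
  lebesgue_weak_partial j (fun x => Num.max (excess x) 0) (dexcess_pos j).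
Proof.
apply: lebesgue_weak_partial_pos_part; [exact: L1_excess|exact: L1_dexcess|].
exact: weak_partial_excess.
Qed.

Let mexcess : measurable_fun [set: Rn R n] (excess : Rn R n -> R).
Proof. exact: L1_measurable L1_excess. Qed.

Lemma measurable_excess_ite (f g : X -> R) : measurable_fun [set: Rn R n] (f : Rn R n -> R) ->
  measurable_fun [set: Rn R n] (g : Rn R n -> R) ->
  measurable_fun [set: Rn R n] ((fun x => if 0 < excess x then f x else g x) : Rn R n -> R).
Proof.
move=> mf mg; apply: measurable_fun_ifT; [|exact: mf|exact: mg].
by apply: measurable_fun_ltr; [exact: measurable_cst|exact: mexcess].
Qed.

Lemma p_integrable_excess_pos : p_integrable p (fun x => Num.max (excess x) 0).
Proof.
apply: (p_integrable_dom p0 _ p_integrable_excess).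
  by apply: measurable_maxr; [exact: mexcess|exact: measurable_cst].
by move=> x; rewrite ger0_norm ?le_max ?lexx ?orbT// ge_max ler_norm normr_ge0.
Qed.

Lemma p_integrable_dexcess_pos j : p_integrable p (dexcess_pos j).
Proof.
apply: (p_integrable_dom p0 _ (p_integrable_dexcess j)).
  apply: measurable_excess_ite; last exact: measurable_cst.
  exact: L1_measurable (L1_dexcess j).
by move=> x; rewrite /dexcess_pos; case: ifP => // _; rewrite normr0.
Qed.

Lemma L1_excess_pos : L1 la (fun x => Num.max (excess x) 0).
Proof.
apply: L1_dom (L1_norm L1_excess) _.
  by apply: measurable_maxr; [exact: mexcess|exact: measurable_cst].
by move=> x; rewrite ger0_norm ?le_max ?lexx ?orbT// ge_max ler_norm normr_ge0.
Qed.

Lemma L1_dexcess_pos j : L1 la (dexcess_pos j).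
Proof.
apply: L1_dom (L1_norm (L1_dexcess j)) _.
  apply: measurable_excess_ite; last exact: measurable_cst.
  exact: L1_measurable (L1_dexcess j).
by move=> x; rewrite /dexcess_pos; case: ifP => // _; rewrite normr0.
Qed.

Lemma variation0 x : excess x <= 0 -> variation x = 0 /\ dvariation x = 0.
Proof.
move=> H; split; first by rewrite /variation (max_r H) mulr0 scale0r.
apply/matrixP => j l; rewrite !mxE; case: ifP => // _.
by rewrite /dexcess_pos ltNge H mulr0.
Qed.

Let patch0 (f : X -> R) : (forall x, ~ Omega x -> f x = 0) -> f \_ Omega = f.
Proof.
move=> f0; apply/funext => x; rewrite patchE; case: ifPn => //.
by rewrite notin_setE => /f0 ->.
Qed.

Let dexcess_pos_outside j x : ~ Omega x -> dexcess_pos j x = 0.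
Proof. by move=> /excess_outside H; rewrite /dexcess_pos H ltxx. Qed.

Lemma variation_W1p : W1p p Omega variation dvariation.
Proof.
split.
- move=> l; apply/(Lp_p_integrable p0).
  rewrite patch0; last first.
    by move=> x /excess_outside H; rewrite (variation0 _).1 ?H// mxE.
  rewrite (_ : (fun x => _) = fun x => (- s * (l == i)%:R) * Num.max (excess x) 0).
    by apply: p_integrableZ; exact: p_integrable_excess_pos.
  by apply/funext => x; rewrite !mxE eqxx/=; ring.
- move=> j l; apply/(Lp_p_integrable p0).
  rewrite patch0; last first.
    by move=> x /excess_outside H; rewrite (variation0 _).2 ?H// mxE.
  rewrite (_ : (fun x => _) = fun x => (- s * (l == i)%:R) * dexcess_pos j x).
    by apply: p_integrableZ; exact: p_integrable_dexcess_pos.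
  by apply/funext => x; rewrite !mxE; case: ifP => _; rewrite ?mulr1 ?mulr0 ?mul0r.
- move=> phi tphi j l; have tphi' := test_functionS tphi.
  rewrite integral_mkcond [in X in _ = X]integral_mkcond.
  have -> : (fun x => (variation x ord0 l * partial j phi x)%:E) \_ Omega =
      fun x => (- s * (l == i)%:R * (Num.max (excess x) 0 * partial j phi x))%:E.
    apply/funext => x; rewrite patchE; case: ifPn => [_|].
      by rewrite !mxE eqxx/=; congr EFin; ring.
    by rewrite notin_setE => /excess_outside ->; rewrite max_l// mul0r mulr0.
  have -> : (fun x => (dvariation x j l * phi x)%:E) \_ Omega =
      fun x => (- s * (l == i)%:R * (dexcess_pos j x * phi x))%:E.
    apply/funext => x; rewrite patchE; case: ifPn => [_|].
      by rewrite !mxE; case: ifP => _; rewrite ?mulr1 ?mulr0 ?mul0r ?mulrA.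
    by rewrite notin_setE => /dexcess_pos_outside ->; rewrite mul0r mulr0.
  have LT (f psi : X -> R) : L1 la f -> test_function setT psi -> L1 la (fun x => f x * psi x).
    move=> Lf tp; have [M _ HM] := test_bounded tp.
    apply: (@L1M_bounded _ _ _ la f psi M Lf _ HM).
    by apply: measurable_fun_Rn; exact: test_measurable.
  have La := LT _ _ L1_excess_pos (test_partial j tphi').
  have Lb := LT _ _ (L1_dexcess_pos j) tphi'.
  rewrite !Rintegral_EFin ?integral_scale//; [|exact: L1Z..].
  by rewrite weak_partial_excess_pos// -EFinN mulrN.
Qed.

Lemma variation_supp : supp Omega variation `<=` supp setT zeta.
Proof.
apply: closure_subset => x [_ vx]; split => //; apply: contraNneq vx => zx.
by rewrite (variation0 _).1// /excess zx mul0r mulr0.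
Qed.

Lemma compact_variation_supp : compact (supp Omega variation).
Proof.
have [_ cz _] := tz.
by apply: (subclosed_compact _ cz variation_supp); exact: closed_closure.
Qed.

Lemma variation_suppS : supp Omega variation `<=` Omega.
Proof. by have [_ _ sub] := tz; exact: subset_trans variation_supp sub. Qed.

Definition gradient_norm (l : 'I_m) (x : X) : R := enorm (\col_j dcomponent j l x).

Lemma gradient_normE l x : Omega x -> gradient_norm l x = enorm (col l (Du x)).
Proof.
move=> Ox; rewrite /gradient_norm; congr enorm; apply/colP => j.
by rewrite !mxE /dcomponent patchE mem_set.
Qed.

Lemma p_integrable_gradient_norm l : p_integrable p (gradient_norm l).
Proof.
have S : p_integrable p (fun x => \sum_j `|dcomponent j l x|).
  apply: (p_integrable_sum p0) => j.
  exact: (p_integrable_norm p0 (p_integrable_dcomponent j l)).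
apply: (p_integrable_dom p0 _ S); last first.
  move=> x; rewrite (ger0_norm (enorm_ge0 _)) ger0_norm ?sumr_ge0//.
  rewrite (le_trans (enorm_le_sum _))//; apply: ler_sum => j _.
  by rewrite big_ord1 mxE.
rewrite (_ : gradient_norm l = Num.sqrt \o (fun x => \sum_j dcomponent j l x ^+ 2)); last first.
  by apply/funext => x /=; congr Num.sqrt; apply: eq_bigr => j _; rewrite big_ord1 mxE.
have ms : measurable_fun setT (@Num.sqrt R).
  by apply: continuous_measurable_fun; exact: sqrt_continuous.
apply: (measurableT_comp ms).
apply: measurable_sum => j; apply: measurable_funX.
by have [] := p_integrable_dcomponent j l.
Qed.

Lemma L1_gradient_norm l : L1 la (fun x => gradient_norm l x `^ p).
Proof.
have [_] := p_integrable_gradient_norm l.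
by congr (L1 la _); apply/funext => x; rewrite ger0_norm// enorm_ge0.
Qed.

Lemma excess_gt0 x : 0 < excess x ->
  [/\ Omega x, 0 < zeta x & 0 < s * (component i x - k)].
Proof.
move=> H; have zx : 0 < zeta x.
  rewrite lt_def z0 andbT; apply: contraTneq H => zx.
  by rewrite /excess zx mul0r mulr0 ltxx.
split => //; first by apply: contrapT => /excess_outside E; move: H; rewrite E ltxx.
by move: H; rewrite /excess mulrCA pmulr_rgt0.
Qed.

Lemma p_integrable_level_difference :
  p_integrable p (fun x => if 0 < excess x then component i x - k else 0).
Proof.
have /test_functionP[_ [N HN]] := tz'.
have B : p_integrable p (fun x => `|component i x| + `|k| * \1_(nball N) x).
  apply: (p_integrableD p0).
    exact: (p_integrable_norm p0 (p_integrable_component i)).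
  apply: p_integrableZ; apply: (p_integrable_indic p0); first exact: measurable_nball.
  exact: nball_finite.
apply: (p_integrable_dom p0 _ B).
  apply: measurable_excess_ite; last exact: measurable_cst.
  apply: measurable_funB; last exact: measurable_cst.
  by have [] := p_integrable_component i.
move=> x; rewrite [X in _ <= X]ger0_norm ?addr_ge0 ?mulr_ge0// ?indicE//.
case: ifPn => [/excess_gt0[_ zx _]|_]; last by rewrite normr0 addr_ge0 ?mulr_ge0.
by rewrite mem_set ?mulr1 ?ler_normB//; apply: HN; rewrite gt_eqF.
Qed.

Variable G : X -> 'rV[R]_m -> 'M[R]_(n, m) -> R.
Hypothesis min_u : local_minimizer p Omega G u Du.

(** Where the excess is positive, the gradient of the competitor is the vector
    of [convex_gradient], with [zeta] as weight, and only the energy of the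
    component [i] changes. The energy of [u] over the support of the variation
    is finite, so it can be subtracted from both sides of the minimality
    inequality, which leaves the gain on the left. *)
Lemma variation_energy (c : R) (H : X -> R) :
  (forall x, 0 < zeta x ->
    enorm (\col_j partial j zeta x) `^ p <= c * zeta x `^ (p - 1)) ->
  L1 la (fun x => if 0 < excess x then H x else 0) ->
  {ae la, forall x, 0 < excess x ->
    `|G x (u x + variation x) (Du x + dvariation x) - G x (u x) (Du x)| <= H x} ->
  \int[la]_x (if 0 < excess x then zeta x * gradient_norm i x `^ p else 0) <=
  c * \int[la]_x (if 0 < excess x then `|component i x - k| `^ p else 0) +
  \int[la]_x (if 0 < excess x then H x else 0).
Proof.
move=> Hc LH aeH; have [_ LG minu] := min_u.
set E := supp Omega variation.
have mE : measurable (E : set (Rn R n)).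
  by apply: measurable_Rn; apply: closed_measurable_rV; exact: closed_closure.
pose f1 x := \sum_(l < m) enorm (col l (Du x)) `^ p + G x (u x) (Du x).
pose f2 x := \sum_(l < m) enorm (col l (Du x + dvariation x)) `^ p +
  G x (u x + variation x) (Du x + dvariation x).
have ss : s * s = 1.
  by rewrite -expr2 -real_normK ?num_real// s1 expr1n.
have mz : measurable_fun [set: Rn R n] (zeta : Rn R n -> R).
  by apply: measurable_fun_Rn; exact: test_measurable.
have La : L1 la (fun x => if 0 < excess x then zeta x * gradient_norm i x `^ p else 0).
  apply: L1_dom (L1_gradient_norm i) _.
    apply: measurable_excess_ite; last exact: measurable_cst.
    exact: (measurable_funM mz (L1_measurable (L1_gradient_norm i))).
  move=> x; case: ifP => _; last by rewrite normr0 powR_ge0.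
  by rewrite ger0_norm ?mulr_ge0 ?powR_ge0// ler_piMl ?powR_ge0.
have Lb : L1 la (fun x => if 0 < excess x then `|component i x - k| `^ p else 0).
  have [_] := p_integrable_level_difference; congr (L1 la _); apply/funext => x.
  by case: ifP => // _; rewrite normr0 powR0// gt_eqF.
pose h x := - (if 0 < excess x then zeta x * gradient_norm i x `^ p else 0) +
  c * (if 0 < excess x then `|component i x - k| `^ p else 0) +
  (if 0 < excess x then H x else 0).
have Lh : L1 la h by apply: L1D => //; apply: L1D; [exact: L1N|exact: L1Z].
have Lf1 : L1 la (f1 \_ E).
  have LGE : L1 la ((fun x => G x (u x) (Du x)) \_ E).
    have [mG LG1] : p_integrable 1 ((fun x => G x (u x) (Du x)) \_ E).
      apply/(Lp_p_integrable ltr01).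
      by apply: LG; [exact: compact_variation_supp|exact: variation_suppS].
    by apply: (L1_dom mG LG1) => x; rewrite powRr1.
  have -> : f1 \_ E = fun x => ((fun x => \sum_(l < m) gradient_norm l x `^ p) \_ E) x +
      ((fun x => G x (u x) (Du x)) \_ E) x.
    apply/funext => x; rewrite !patchE; case: ifPn => [/set_mem Ex|_]; last by rewrite addr0.
    have Ox : Omega x by exact: variation_suppS Ex.
    have E1 : \sum_(l < m) enorm (col l (Du x)) `^ p = \sum_(l < m) gradient_norm l x `^ p.
      by apply: eq_bigr => l _; rewrite (gradient_normE l Ox).
    by rewrite /f1 E1.
  apply: L1D => //; apply: L1_patch => //; apply: L1_sum => l.
  exact: L1_gradient_norm.
have patchEF (f : X -> R) : (fun x => (f x)%:E) \_ E = fun x => ((f \_ E) x)%:E.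
  by apply/funext => x; rewrite !patchE; case: ifP.
have minE : (\int[la]_x ((f1 \_ E) x)%:E <= \int[la]_x ((f2 \_ E) x)%:E)%E.
  rewrite -!patchEF -!integral_mkcond.
  have := minu _ _ variation_W1p compact_variation_supp variation_suppS.
  exact.
have cmp : (\int[la]_x ((f2 \_ E) x)%:E <= \int[la]_x ((f1 \_ E) x + h x)%:E)%E.
  apply: integral_ae_le_integrable; first exact: L1D.
  case: aeH => N [mN N0 HN]; exists N; split => // x /= Hx; apply: HN => /= aex; apply: Hx.
  have [ex|ex] := ltP 0 (excess x); last first.
    have [v0 dv0] := variation0 ex.
    rewrite /h ltNge ex/= mulr0 oppr0 !addr0 !patchE; case: ifP => // _.
    by rewrite /f2 v0 dv0 !addr0.
  have [Ox zx wx] := excess_gt0 ex.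
  have Ex : E x.
    apply: subset_closure; split => //=; apply/negP => /eqP/(congr1 (fun v : 'rV[R]_m => v ord0 i)).
    rewrite !mxE !eqxx mulr1 (max_l (ltW ex)) => /eqP; rewrite mulf_eq0 oppr_eq0.
    by rewrite (gt_eqF ex) orbF -normr_eq0 s1 oner_eq0.
  rewrite /h ex !patchE mem_set//.
  have nw : `|component i x - k| = s * (component i x - k).
    by rewrite -[LHS]mul1r -s1 -normrM gtr0_norm.
  have aG := aex ex.
  have colE : col i (Du x + dvariation x) =
      (1 - zeta x) *: col i (Du x) - (s * (component i x - k)) *: (s *: \col_j partial j zeta x).
    apply/colP => j; rewrite !mxE eqxx /dexcess_pos ex /dexcess.
    have -> : dcomponent j i x = Du x j i by rewrite /dcomponent patchE mem_set.
    have E1 (t : R) : - s * (s * t) = - t by rewrite mulrA mulNr ss mulN1r.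
    have E2 (t t' : R) : s * t * (s * t') = t * t' by rewrite mulrACA ss mul1r.
    by rewrite E1 E2; ring.
  have colE' l : l != i -> col l (Du x + dvariation x) = col l (Du x).
    by move=> li; apply/colP => j; rewrite !mxE (negbTE li) addr0.
  rewrite /f1 /f2 (bigD1 i)//= [X in _ <= X + _ + _](bigD1 i)//=.
  rewrite (eq_bigr (fun l => enorm (col l (Du x)) `^ p)); last by move=> l li; rewrite colE'.
  have cv : enorm (col i (Du x + dvariation x)) `^ p <=
      (1 - zeta x) * gradient_norm i x `^ p + c * `|component i x - k| `^ p.
    rewrite colE nw gradient_normE//; apply: convex_gradient => //; first exact: ltW.
    by rewrite enormZ s1 mul1r; exact: Hc.
  rewrite gradient_normE// in cv *.
  have g_le := le_trans (ler_norm _) aG.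
  exact: (energy_increment _ cv g_le).
have := le_trans minE cmp.
have Lf1h := L1D Lf1 Lh.
rewrite !Rintegral_EFin// lee_fin integral_add// lerDl /h integral_add//; last first.
  by apply: L1D; [exact: L1N|exact: L1Z].
rewrite integral_add; [|exact: L1N|exact: L1Z].
rewrite integral_opp// integral_scale//; lra.
Qed.

End variation.

(** * Local bounds near a compact set *)

Section compact_neighbourhood.
Context {R : realType} {n : nat}.
Local Notation X := 'rV[R]_n.
Implicit Types (x y : X) (Omega Sigma : set X).

Lemma norm_le_enorm x : `|x| <= enorm x.
Proof.
rewrite -(ler_pXn2r (n := 2))// ?nnegrE ?enorm_ge0// -sqnorm_enorm.
exact: sqnorm_ge.
Qed.

Lemma exists_compact_neighbourhood Omega Sigma : open Omega -> compact Sigma ->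
  Sigma `<=` Omega -> exists d K, [/\ 0 < d, compact K, K `<=` Omega &
    forall x0, Sigma x0 -> ceball x0 d `<=` K].
Proof.
move=> oO cS SO.
have : \forall d \near (0 : R)^'+, Sigma `<=` [set x | ceball x d `<=` Omega].
  move/compact_near_coveringP : cS; apply => x Sx.
  have /nbhs_ballP[e /= e0 He] : nbhs x Omega by apply: open_nbhs_nbhs; split => //; exact: SO.
  have e2 : 0 < e / 2 by rewrite divr_gt0.
  exists (ball x (e / 2), [set d : R | d < e / 2]) => /=.
    split; first exact: nbhsx_ballx.
    exact: nbhs_right_lt.
  move=> [y d] /= [xy de] z /= yz; apply: He.
  rewrite -ball_normE/= (le_lt_trans (ler_distD y _ _))// [e]splitr ltrD//.
    by rewrite -ball_normE/= in xy.
  by rewrite distrC (le_lt_trans (norm_le_enorm _))// (le_lt_trans yz).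
move=> Hd; have [d [d0 HS]] : exists d : R, 0 < d /\ Sigma `<=` [set x | ceball x d `<=` Omega].
  near (0 : R)^'+ => d; exists d; split; first by near: d; exact: nbhs_right_gt.
  by near: d.
pose K := (fun z : X * X => z.1 + z.2) @` (Sigma `*` ceball 0 d).
exists d, K; split => //.
- apply: continuous_compact; last by apply: compact_setX => //; exact: compact_ceball (ltW d0).
  by apply: continuous_subspaceT => z; exact: add_continuous.
- move=> _ [[x y] [/= Sx yd] <-]; apply: (HS x Sx); rewrite /ceball/= addrC addKr.
  by move: yd; rewrite /ceball/= subr0.
- move=> x Sx y xy; exists (x, y - x) => /=; last by rewrite subrKC.
  by split => //=; rewrite /ceball/= subr0.
Unshelve. all: by end_near. Qed.

Lemma open_eball (x0 : X) (d : R) : open (eball x0 d).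
Proof.
rewrite (_ : eball x0 d = (fun x => Num.sqrt (sqnorm (x + - x0))) @^-1` [set t | t < d]).
  apply: open_comp => [x _|]; last exact: open_lt.
  apply: (@continuous_comp _ _ _ (fun x => sqnorm (x + - x0)) Num.sqrt); last exact: sqrt_continuous.
  by apply/smooth_continuous/smooth_shift; exact: smooth_sqnorm.
by apply/seteqP; split => x; rewrite /eball/= /enorm big_ord1.
Qed.

Lemma measurable_eball (x0 : X) (d : R) : measurable (eball x0 d : set (Rn R n)).
Proof. by apply: measurable_Rn; apply: open_measurable_rV; exact: open_eball. Qed.

(** The ball lies in a cube of side [3 * d]; a half-open cube of side [2 * d]
    would miss part of its boundary. *)
Lemma lebesgue_ceball (x0 : X) (d : R) : 0 < d ->
  (@borel_lebesgue R n (ceball x0 d) <= ((3 * d) ^+ n)%:E)%E.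
Proof.
move=> d0; pose v : X := const_mx d - x0.
have d3 : 0 <= 3 * d by rewrite mulr_ge0// ltW.
rewrite -(@borel_lebesgue_cube R n _ d3) -(borel_lebesgue_shift v (@measurable_cube R n (3 * d))).
apply: le_measure; rewrite ?inE.
- by apply: closed_measurable_rV; exact: closed_ceball (ltW d0).
- rewrite -[X in measurable X]setTI; apply: measurable_shift_rV => //.
  exact: measurable_cube.
- move=> x xd i; rewrite !mxE.
  have : `|(x - x0) ord0 i| <= d by rewrite (le_trans (enorm_coord_le _ _ _)).
  by rewrite !mxE ler_norml => /andP[? ?]; apply/andP; split; lra.
Qed.

End compact_neighbourhood.

Section local_integrability.
Context {R : realType} {n m : nat}.
Local Notation la := (@lebesgue R n).
Local Notation X := 'rV[R]_n.
Variables (p r : R) (Omega : set X) (u : X -> 'rV[R]_m) (Du : X -> 'M[R]_(n, m)).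
Hypotheses (n0 : (0 < n)%N) (p1 : 1 < p) (pn : p < n%:R).
Hypotheses (r0 : 0 < r) (rps : r < (p^-1 - n%:R^-1)^-1).
Hypotheses (oO : open Omega) (Wu : W1p p Omega u Du).

Let p0 : 0 < p. Proof. exact: lt_trans p1. Qed.

(** The Sobolev inequality for a cutoff function times the component. *)
Lemma p_integrable_component_ball (x0 : X) (d : R) l : 0 < d -> ceball x0 d `<=` Omega ->
  p_integrable r ((component Omega u l) \_ (eball x0 (d / 2))).
Proof.
move=> d0 sub; have d2 : 0 < d / 2 by rewrite divr_gt0.
have dd : d / 2 < d by rewrite ltr_pdivrMr// ltr_pMr// ltr1n.
pose zeta := cutoff x0 (d / 2) d.
have tz : test_function Omega zeta by exact: cutoff_test.
pose V := excess Omega u zeta 1 0 l.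
pose g := dexcess Omega u Du zeta 1 0 l.
have z0 x : 0 <= zeta x by exact: cutoff_ge0.
have LV : L1 la V by exact: (L1_excess p1 Wu).
have Lg j : L1 la (g j) by exact: (L1_dexcess p1 Wu).
have [C C0 HC] := @lebesgue_sobolev R n p r ((3 * d) ^+ n) n0 p1 pn r0 rps.
pose B := 1 + \sum_j \int[la]_x (`|g j x| `^ p).
have I0 j : 0 <= \int[la]_x (`|g j x| `^ p) by apply: integral_pos => x; exact: powR_ge0.
have B0 : 0 < B by rewrite ltr_pwDl// sumr_ge0.
have HV := HC V g (B `^ p^-1) LV Lg.
have {}HV : (\int[la]_x (`|V x| `^ r)%:E <= (C * B `^ p^-1 `^ r)%:E)%E.
  apply: HV.
  - by move=> j; exact: (weak_partial_excess p1 Wu).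
  - by move=> j; have [] := p_integrable_dexcess p1 Wu 1 0 l tz j.
  - by rewrite powR_gt0.
  - move=> j; rewrite -powRrM mulVf ?gt_eqF// powRr1 ?(ltW B0)//.
    by rewrite /B (bigD1 j)//= addrCA lerDl addr_ge0// sumr_ge0.
  - apply: le_trans (lebesgue_ceball x0 d0); rewrite -lebesgueE; last first.
      by apply: closed_measurable_rV; exact: closed_ceball (ltW d0).
    apply: (le_outer_measure (mu_ext (@borel_lebesgue R n))) => x /= Vx.
    apply: (@cutoff_supp _ _ x0 (d / 2) d d2 dd); apply: contraNneq Vx => zx.
    by rewrite /V /excess -/zeta /zeta zx mul0r mulr0.
have mV := L1_measurable LV.
have mVr : measurable_fun [set: Rn R n] ((fun x => `|V x| `^ r) : Rn R n -> R).
  apply: (measurableT_comp (measurable_powR _)).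
  exact: (measurableT_comp (@normr_measurable R setT) mV).
have PV : p_integrable r V.
  split => //; apply/integrableP; split; first exact/measurable_EFinP.
  under eq_integral do rewrite gee0_abs ?lee_fin ?powR_ge0//.
  by apply: le_lt_trans HV _; exact: ltry.
have mB := @measurable_eball R n x0 (d / 2).
have [mU _] := p_integrable_component p1 Wu l.
apply: (p_integrable_dom r0 _ (p_integrableZ (expR 1) PV)).
  by apply/measurable_restrict => //; rewrite setTI; exact: measurable_funTS.
move=> x; rewrite patchE; case: ifPn => [/set_mem/= xd|_]; last by rewrite normr0.
rewrite /V /excess mul1r subr0 !normrM gtr0_norm ?expR_gt0// mulrA ler_peMl//.
have zx : expR (-1) <= zeta x by exact: cutoff_ge.
rewrite ger0_norm//; apply: (@le_trans _ _ (expR 1 * expR (-1))).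
  by rewrite -expRD subrr expR0.
by rewrite ler_wpM2l// expR_ge0.
Qed.

Lemma p_integrable_component_compact (K : set X) l : compact K -> K `<=` Omega ->
  p_integrable r ((component Omega u l) \_ K).
Proof.
move=> cK KO.
have [d [K' [d0 _ K'O HK']]] := exists_compact_neighbourhood oO cK KO.
have Hd x : K x -> ceball x d `<=` Omega by move=> Kx; exact: subset_trans (HK' x Kx) K'O.
have mK : measurable (K : set (Rn R n)).
  by apply: measurable_Rn; apply: closed_measurable_rV; exact: compact_closed.
(* finitely many balls cover [K] *)
move: (cK); rewrite compact_cover => /(_ X K (fun x => eball x (d / 2))) [].
- by move=> x _; exact: open_eball.
- move=> x Kx; exists x => //; rewrite /eball/= subrr.
  by rewrite /enorm big1 ?sqrtr0 ?divr_gt0// => j _; apply: big1 => l' _; rewrite mxE expr0n.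
move=> D DK KU.
have S : p_integrable r (fun y => \sum_(x <- finmap.enum_fset D)
    (if x \in finmap.enum_fset D then `|((component Omega u l) \_ (eball x (d / 2))) y| else 0)).
  apply: (p_integrable_sum r0) => x /=.
  have [xD|_] := boolP (x \in finmap.enum_fset D); last exact: p_integrable0.
  apply: (p_integrable_norm r0); apply: p_integrable_component_ball => //.
  by apply: Hd; have := DK x xD; rewrite inE.
have [mU _] := p_integrable_component p1 Wu l.
apply: (p_integrable_dom r0 _ S).
  by apply/measurable_restrict => //; rewrite setTI; exact: measurable_funTS.
have S0 y x : 0 <= (if x \in finmap.enum_fset D then `|((component Omega u l) \_ (eball x (d / 2))) y| else 0).
  by case: ifP.
move=> y; rewrite [leRHS]ger0_norm ?sumr_ge0// patchE; case: ifPn => [/set_mem Ky|_]; last first.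
  by rewrite normr0 sumr_ge0.
have [x xD xy] := KU y Ky.
have xD' : x \in finmap.enum_fset D by [].
rewrite (big_rem x)//= xD' patchE mem_set// lerDl.
by apply: sumr_ge0 => z _; exact: S0.
Qed.

End local_integrability.

(** * The Caccioppoli inequality *)

Section one_sided.
Context {R : realType} {n m : nat}.
Local Notation la := (@lebesgue R n).
Local Notation X := 'rV[R]_n.
Variables (p r e : R) (Omega K : set X) (d : R).
Variables (u : X -> 'rV[R]_m) (Du : X -> 'M[R]_(n, m)).
Variables (G : X -> 'rV[R]_m -> 'M[R]_(n, m) -> R) (a b : X -> R).
Variables (q1 q2 alpha beta sigma1 sigma2 : R).
Hypotheses (n0 : (0 < n)%N) (p1 : 1 < p) (pn : p < n%:R).
Hypotheses (r0 : 0 < r) (rps : r < (p^-1 - n%:R^-1)^-1).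
Hypotheses (oO : open Omega) (cK : compact K) (KO : K `<=` Omega) (d0 : 0 < d).
Hypothesis (min_u : local_minimizer p Omega G u Du).
Hypothesis aeG : {ae la, forall x, Omega x ->
  forall (s1 s2 : 'rV[R]_m) (xi1 xi2 : 'M[R]_(n, m)),
    `|G x s1 xi1 - G x s2 xi2| <=
      a x * enorm (s1 - s2) `^ alpha * (enorm xi1 + enorm xi2 + 1) `^ q1
    + b x * (enorm s1 + enorm s2 + 1) `^ q2 * enorm (xi1 - xi2) `^ beta}.
Hypotheses (alpha0 : 0 < alpha) (beta0 : 0 < beta).
Hypotheses (sigma10 : 0 < sigma1) (sigma20 : 0 < sigma2).
Hypotheses (La : Lp_loc Omega sigma1 a) (Lb : Lp_loc Omega sigma2 b).
Hypotheses (a0 : forall x, Omega x -> 0 <= a x) (b0 : forall x, Omega x -> 0 <= b x).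
Hypotheses (e0 : 0 <= e) (e1 : e <= 1).
Hypotheses (E1 : q1 / p + alpha / r + sigma1^-1 <= e) (E2 : beta / p + q2 / r + sigma2^-1 <= e).
Hypotheses (aq : alpha + q1 <= p) (bq : beta + q2 <= p).

Let p0 : 0 < p. Proof. exact: lt_trans p1. Qed.
Let Wu : W1p p Omega u Du. Proof. by case: min_u. Qed.

Let mK : measurable K.
Proof. by apply: closed_measurable_rV; exact: compact_closed. Qed.

Let Koo : (borel_lebesgue n K < +oo)%E.
Proof.
have [N [_ HN]] := compact_bounded cK.
apply: le_lt_trans (nball_finite (`|N| + 1)); apply: le_measure; rewrite ?inE.
- exact: mK.
- exact: measurable_nball.
- by move=> x Kx; apply: HN => //; rewrite ltr_pwDr// ler_norm.
Qed.

Definition value_norm (x : X) : R := enorm (\row_l component Omega u l x).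
Definition jacobian_norm (x : X) : R := enorm (\matrix_(j, l) dcomponent Omega Du j l x).

Let measurable_sqrt' : measurable_fun setT (@Num.sqrt R).
Proof. by apply: continuous_measurable_fun; exact: sqrt_continuous. Qed.

Let p_integrable_1K (q : R) : 0 < q -> p_integrable q (\1_K : X -> R).
Proof. by move=> q0; exact: (p_integrable_indic q0). Qed.

(** Together with the variation, [phiK] and [psiK] dominate the quantities
    [Phi] and [Psi] of [oscillation_young], that is, 1 plus the norms of both
    arguments of the integrand. They belong to fixed Lebesgue classes on [K]. *)
Definition phiK (x : X) : R := \1_K x + 2 * (value_norm \_ K) x.
Definition psiK (x : X) : R := \1_K x + 2 * (jacobian_norm \_ K) x.

Let measurable_restrictK (f : X -> R) : measurable_fun [set: Rn R n] (f : Rn R n -> R) ->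
  measurable_fun [set: Rn R n] ((f \_ K) : Rn R n -> R).
Proof.
move=> mf; apply/measurable_restrict; [exact: measurable_Rn|exact: measurableT|].
by rewrite setTI; exact: measurable_funTS.
Qed.

Let p_integrable_phiK : p_integrable r phiK.
Proof.
apply: (p_integrableD r0); first exact: p_integrable_1K.
apply: p_integrableZ.
have S : p_integrable r (fun x => \sum_l `|((component Omega u l) \_ K) x|).
  apply: (p_integrable_sum r0) => l; apply: (p_integrable_norm r0).
  exact: (p_integrable_component_compact n0 p1 pn r0 rps oO Wu).
apply: (p_integrable_dom r0 _ S).
  apply: measurable_restrictK.
  rewrite (_ : value_norm = Num.sqrt \o (fun x => \sum_l component Omega u l x ^+ 2)); last first.
    apply/funext => x /=; congr Num.sqrt; rewrite big_ord1.
    by apply: eq_bigr => l _; rewrite mxE.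
  apply: (measurableT_comp measurable_sqrt').
  apply: measurable_sum => l; apply: measurable_funX.
  by have [] := p_integrable_component p1 Wu l.
move=> x; rewrite [leRHS]ger0_norm ?sumr_ge0// patchE; case: ifPn => [/set_mem Kx|_]; last first.
  by rewrite normr0 sumr_ge0.
rewrite ger0_norm ?enorm_ge0// (le_trans (enorm_le_sum _))// big_ord1.
by apply: ler_sum => l _; rewrite mxE patchE mem_set.
Qed.

Let p_integrable_psiK : p_integrable p psiK.
Proof.
apply: (p_integrableD p0); first exact: p_integrable_1K.
apply: p_integrableZ.
have S : p_integrable p (fun x => \sum_j \sum_l `|dcomponent Omega Du j l x|).
  apply: (p_integrable_sum p0) => j; apply: (p_integrable_sum p0) => l.
  by apply: (p_integrable_norm p0); exact: (p_integrable_dcomponent p1 Wu).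
apply: (p_integrable_dom p0 _ S).
  apply: measurable_restrictK.
  rewrite (_ : jacobian_norm = Num.sqrt \o (fun x => \sum_j \sum_l dcomponent Omega Du j l x ^+ 2)); last first.
    apply/funext => x /=; congr Num.sqrt.
    by apply: eq_bigr => j _; apply: eq_bigr => l _; rewrite mxE.
  apply: (measurableT_comp measurable_sqrt').
  apply: measurable_sum => j; apply: measurable_sum => l; apply: measurable_funX.
  by have [] := p_integrable_dcomponent p1 Wu j l.
have S0 x : 0 <= \sum_j \sum_l `|dcomponent Omega Du j l x|.
  by apply: sumr_ge0 => j _; exact: sumr_ge0.
move=> x; rewrite [leRHS]ger0_norm// patchE; case: ifPn => [/set_mem Kx|_]; last first.
  by rewrite normr0.
rewrite ger0_norm ?enorm_ge0// (le_trans (enorm_le_sum _))//.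
by apply: ler_sum => j _; apply: ler_sum => l _; rewrite mxE.
Qed.

(** The coefficient is increased by 1 on [K], so that its logarithm can be
    taken in [oscillation_young]. *)
Definition weight (f : X -> R) (x : X) : R := (f \_ K) x + \1_K x.

Let p_integrable_weight (q : R) (f : X -> R) : 0 < q -> Lp_loc Omega q f ->
  p_integrable q (weight f).
Proof.
move=> q0 Lf; apply: (p_integrableD q0); last exact: p_integrable_1K.
by apply/(Lp_p_integrable q0); exact: Lf.
Qed.

(** [data_mass] and [energy_constant] depend on [u] and on the data of the
    problem near the compact set only, not on the ball, the level or the
    component. *)
Definition data_mass (C : R) : R :=
  \int[la]_x (`|weight a x| `^ sigma1) + \int[la]_x (`|weight b x| `^ sigma2) +
  2 `^ r * (\int[la]_x (`|phiK x| `^ r) + C) +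
  2 `^ p * (\int[la]_x (`|psiK x| `^ p) + 1) + 1.

Definition osc_constant : R := 2 * 5 `^ (alpha + beta + `|q1| + `|q2|).

Definition energy_constant (C : R) : R := osc_constant * 2 * 4 `^ p * data_mass C.

Lemma data_mass_ge0 (C : R) : 0 <= C -> 0 <= data_mass C.
Proof.
move=> C0; rewrite /data_mass !addr_ge0 ?mulr_ge0 ?powR_ge0 ?addr_ge0// ?integral_pos//.
all: by move=> x; exact: powR_ge0.
Qed.

Lemma energy_constant_ge0 (C : R) : 0 <= C -> 0 <= energy_constant C.
Proof. by move=> C0; rewrite !mulr_ge0 ?powR_ge0 ?data_mass_ge0. Qed.

Section ball.
Variables (x0 : X) (rho ro s k : R) (i : 'I_m).
Hypotheses (rho0 : 0 < rho) (rhor : rho < ro) (s1 : `|s| = 1).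
Hypotheses (ballK : ceball x0 ro `<=` K) (rod : ro <= d).

Let zeta := cutoff x0 rho ro.
Let ex := excess Omega u zeta s k i.
Let gp := dexcess_pos Omega u Du zeta s k i.
Let tz : test_function Omega zeta.
Proof. by apply: cutoff_test => //; exact: subset_trans ballK KO. Qed.

Definition level_gradient (x : X) : R := enorm (\col_j gp j x).

Definition cutoff_energy : R :=
  \int[la]_x (if 0 < ex x then zeta x * gradient_norm Omega Du i x `^ p else 0).
Definition level_power : R :=
  \int[la]_x (if 0 < ex x then `|component Omega u i x - k| `^ p else 0).

Let c : R := cutoff_constant p / (ro - rho) `^ p.

Let c0 : 0 <= c.
Proof. by rewrite divr_ge0 ?powR_ge0// mulr_ge0 ?powR_ge0. Qed.

Lemma zeta_grad x : enorm (\col_j partial j zeta x) `^ p <= c * zeta x `^ (p - 1).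
Proof. by rewrite mulrAC; exact: cutoff_grad. Qed.

Let L1_energy : L1 la (fun x => if 0 < ex x then zeta x * gradient_norm Omega Du i x `^ p else 0).
Proof.
have Lg := L1_gradient_norm p1 Wu i.
apply: (L1_dom _ Lg).
  apply: (measurable_excess_ite p1 Wu); [exact: tz| |exact: measurable_cst].
  apply: (measurable_funM _ (L1_measurable Lg)).
  by apply: measurable_fun_Rn; exact: (test_measurable (test_functionS tz)).
move=> x; case: ifP => _; last by rewrite normr0 powR_ge0.
by rewrite ger0_norm ?mulr_ge0 ?powR_ge0 ?cutoff_ge0// ler_piMl ?powR_ge0 ?cutoff_le1.
Qed.

Let L1_level : L1 la (fun x => if 0 < ex x then `|component Omega u i x - k| `^ p else 0).
Proof.
have [_] := p_integrable_level_difference p1 Wu (zeta := zeta) s k i tz (@cutoff_ge0 _ _ x0 rho ro).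
congr (L1 la _); apply/funext => x.
by rewrite -/ex; case: ifP => // _; rewrite normr0 powR0// gt_eqF.
Qed.

(** The product rule; for the term with the gradient of [zeta] use [zeta_grad]
    and [zeta <= 1]. *)
Lemma level_gradient_le x : level_gradient x `^ p <=
  2 `^ p * ((if 0 < ex x then zeta x * gradient_norm Omega Du i x `^ p else 0) +
     c * (if 0 < ex x then `|component Omega u i x - k| `^ p else 0)).
Proof.
rewrite /level_gradient /gp /dexcess_pos; rewrite -/ex.
case: ifPn => [xp|_]; last first.
  rewrite (_ : \col_j _ = 0); last by apply/colP => j; rewrite !mxE.
  rewrite /enorm big1; last by move=> j _; apply: big1 => l _; rewrite mxE expr0n.
  by rewrite sqrtr0 powR0 ?gt_eqF// mulr0 addr0 mulr0.
set A := \col_j dcomponent Omega Du j i x; set B := \col_j partial j zeta x.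
have zx0 : 0 <= zeta x by exact: cutoff_ge0.
have zx1 : zeta x <= 1 by exact: cutoff_le1.
have w0 := normr_ge0 (component Omega u i x - k).
have -> : \col_j dexcess Omega u Du zeta s k i j x =
    s *: (zeta x *: A + (component Omega u i x - k) *: B).
  by apply/colP => j; rewrite !mxE.
rewrite enormZ s1 mul1r.
have -> : gradient_norm Omega Du i x = enorm A by [].
have nA := enorm_ge0 A; have nB := enorm_ge0 B.
apply: (@le_trans _ _ ((zeta x * enorm A + `|component Omega u i x - k| * enorm B) `^ p)).
  apply: ge0_ler_powR; rewrite ?nnegrE ?enorm_ge0 ?(ltW p0) ?addr_ge0 ?mulr_ge0//.
  by rewrite (le_trans (enormD _ _))// !enormZ (ger0_norm zx0).
rewrite (le_trans (powRD_le (ltW p0) _ _))// ?mulr_ge0//.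
rewrite ler_wpM2l ?powR_ge0// !powRM// lerD//.
  rewrite ler_wpM2r ?powR_ge0//.
  have [->|zn] := eqVneq (zeta x) 0; first by rewrite powR0// gt_eqF.
  by apply: ge1r_powR; [rewrite lt_def zn zx0|exact: ltW].
rewrite mulrC ler_wpM2r ?powR_ge0// (le_trans (zeta_grad x))// ler_piMr//.
have pp : 0 <= p - 1 by rewrite subr_ge0 ltW.
rewrite -[leRHS](_ : 1 `^ (p - 1) = 1); last by rewrite powR1.
by apply: ge0_ler_powR; rewrite ?nnegrE.
Qed.

Let p_integrable_level_gradient : p_integrable p level_gradient.
Proof.
have S : p_integrable p (fun x => \sum_j `|gp j x|).
  apply: (p_integrable_sum p0) => j; apply: (p_integrable_norm p0).
  exact: (p_integrable_dexcess_pos p1 Wu).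
apply: (p_integrable_dom p0 _ S).
  rewrite (_ : level_gradient = Num.sqrt \o (fun x => \sum_j gp j x ^+ 2)); last first.
    apply/funext => x /=; congr Num.sqrt; apply: eq_bigr => j _.
    by rewrite big_ord1 mxE.
  apply: (measurableT_comp measurable_sqrt').
  apply: measurable_sum => j; apply: measurable_funX.
  by have [] := p_integrable_dexcess_pos p1 Wu s k i tz j.
move=> x; rewrite [leRHS]ger0_norm ?sumr_ge0// ger0_norm ?enorm_ge0//.
by rewrite (le_trans (enorm_le_sum _))//; apply: ler_sum => j _; rewrite big_ord1 mxE.
Qed.

Definition gradient_mass : R := \int[la]_x (level_gradient x `^ p).

Let L1_level_gradient : L1 la (fun x => level_gradient x `^ p).
Proof.
have [_] := p_integrable_level_gradient; congr (L1 la _); apply/funext => x.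
by rewrite ger0_norm ?enorm_ge0.
Qed.

Lemma gradient_mass_ge0 : 0 <= gradient_mass.
Proof. by apply: integral_pos => x; exact: powR_ge0. Qed.

Lemma gradient_mass_le : gradient_mass <= 2 `^ p * (cutoff_energy + c * level_power).
Proof.
rewrite /cutoff_energy /level_power -integral_scale// -integral_add//; last exact: L1Z.
rewrite -integral_scale; last by apply: L1D => //; exact: L1Z.
apply: integral_le => //; last exact: level_gradient_le.
by apply: L1Z; apply: L1D => //; exact: L1Z.
Qed.

(** A bound for the [p]-norm of the gradient of the variation, kept above 1. *)
Let N : R := 1 + gradient_mass `^ p^-1.

Let N1 : 1 <= N. Proof. by rewrite lerDl powR_ge0. Qed.
Let N0 : 0 < N. Proof. exact: lt_le_trans N1. Qed.

Let massN : gradient_mass <= N `^ p.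
Proof.
have -> : gradient_mass = (gradient_mass `^ p^-1) `^ p.
  by rewrite -powRrM mulVf ?gt_eqF// powRr1// gradient_mass_ge0.
by apply: ge0_ler_powR; rewrite ?nnegrE ?powR_ge0 ?(ltW p0) ?(ltW N0)// lerDr.
Qed.

Let N_le : N `^ p <= 4 `^ p * (1 + cutoff_energy + c * level_power).
Proof.
have H := gradient_mass_le; have S0 := gradient_mass_ge0.
apply: (le_trans (powRD_le (ltW p0) _ _)) => //; first exact: powR_ge0.
rewrite powR1 -powRrM mulVf ?gt_eqF// powRr1//.
have -> : 4 = 2 * 2 :> R by ring.
rewrite powRM// -mulrA ler_wpM2l ?powR_ge0//.
have p2 : 1 <= 2 `^ p by rewrite -[leLHS](powRr0 2) ler_powR ?ler1n// ltW.
by rewrite -addrA mulrDr lerD// mulr1.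
Qed.

Let Vp (x : X) : R := Num.max (ex x) 0.

Lemma excess_pos_sobolev (C : R) :
  sobolev_bound n p r ((3 * d) ^+ n) C ->
  p_integrable r Vp /\ \int[la]_x (`|Vp x| `^ r) <= C * N `^ r.
Proof.
move=> HC; have LV : L1 la Vp by exact: (L1_excess_pos p1 Wu).
have Lgj j : L1 la (fun x => `|gp j x| `^ p).
  by have [] := p_integrable_dexcess_pos p1 Wu s k i tz j.
have H : (\int[la]_x (`|Vp x| `^ r)%:E <= (C * N `^ r)%:E)%E.
  apply: (HC _ gp N LV _ _ Lgj N0).
  - by move=> j; exact: (L1_dexcess_pos p1 Wu).
  - by move=> j; exact: (weak_partial_excess_pos p1 Wu).
  - move=> j; apply: le_trans massN; apply: integral_le => // x.
    apply: ge0_ler_powR; rewrite ?nnegrE ?enorm_ge0 ?(ltW p0)//.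
    by have := enorm_coord_le (\col_j gp j x) j ord0; rewrite mxE.
  - apply: le_trans (lebesgue_ceball x0 d0); rewrite -lebesgueE; last first.
      by apply: closed_measurable_rV; exact: closed_ceball (ltW d0).
    apply: (le_outer_measure (mu_ext (@borel_lebesgue R n))) => x /= Vx.
    have Ex : 0 < ex x.
      by rewrite ltNge; apply: contra Vx => /max_r H; rewrite /Vp H.
    have [_ zx _] := excess_gt0 tz (@cutoff_ge0 _ _ x0 rho ro) Ex.
    by move: zx; rewrite cutoff_gt0// /ceball/= => /ltW/le_trans; apply.
have mV := L1_measurable LV.
have mVr : measurable_fun [set: Rn R n] ((fun x => `|Vp x| `^ r) : Rn R n -> R).
  apply: (measurableT_comp (measurable_powR _)).
  exact: (measurableT_comp (@normr_measurable R setT) mV).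
have LVr : L1 la (fun x => `|Vp x| `^ r).
  apply/integrableP; split; first exact/measurable_EFinP.
  under eq_integral do rewrite gee0_abs ?lee_fin ?powR_ge0//.
  by apply: le_lt_trans H _; exact: ltry.
by split; [split|rewrite -lee_fin -Rintegral_EFin].
Qed.

Let A : set X := [set x | 0 < ex x].

Let mA : measurable (A : set (Rn R n)).
Proof.
have mex := L1_measurable (L1_excess p1 Wu s k i tz).
rewrite (_ : A = (ex : Rn R n -> R) @^-1` `]0, +oo[).
  by rewrite -[X in measurable X]setTI; exact: mex.
by apply/seteqP; split => x; rewrite /A/= in_itv/= andbT.
Qed.

Let AK : A `<=` K.
Proof.
move=> x /(excess_gt0 tz (@cutoff_ge0 _ _ x0 rho ro))[_ zx _]; apply: ballK.
by move: zx; rewrite cutoff_gt0// => /ltW.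
Qed.

Lemma level_set_finite : (la A < +oo)%E.
Proof.
apply: le_lt_trans Koo; rewrite -lebesgueE; last exact: mK.
by apply: (le_outer_measure (mu_ext (@borel_lebesgue R n))); exact: AK.
Qed.

Let t : R := fine (la A).

Let L1_A : L1 la (\1_A : X -> R).
Proof. by apply: L1_indic => //; exact: level_set_finite. Qed.

Let integral_A : \int[la]_x \1_A x = t.
Proof. by rewrite /Rintegral integral_indic ?setIT. Qed.

Section estimate.
Variable (C : R).
Hypotheses (C0 : 0 <= C) (t0 : 0 < t) (t1 : t <= 1).
Hypothesis sobolev_C : p_integrable r Vp /\ \int[la]_x (`|Vp x| `^ r) <= C * N `^ r.

(** The right-hand side of [oscillation_young] as a function of the point. The
    terms that contain the variation are divided by [N] to the matching power,
    which makes their integrals bounded; every term carries the factor [t] or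
    integrates to [t]. *)
Let majorant (x : X) : R :=
  t * `|weight a x| `^ sigma1 + t * `|weight b x| `^ sigma2 +
  t * 2 `^ r * (`|phiK x| `^ r + (N `^ r)^-1 * `|Vp x| `^ r) +
  t * 2 `^ p * (`|psiK x| `^ p + (N `^ p)^-1 * level_gradient x `^ p) + \1_A x.

Let La1 := (p_integrable_weight sigma10 La).2.
Let Lb1 := (p_integrable_weight sigma20 Lb).2.
Let Lphi := p_integrable_phiK.2.
Let Lpsi := p_integrable_psiK.2.
Let LVp := sobolev_C.1.2.

Let L1_majorant : L1 la majorant.
Proof.
apply: L1D => //; apply: L1D; first apply: L1D; first apply: L1D.
- exact: L1Z.
- exact: L1Z.
- by apply: L1Z; apply: L1D => //; exact: L1Z.
- by apply: L1Z; apply: L1D => //; exact: L1Z.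
Qed.

Let integral_majorant : \int[la]_x majorant x <= t * data_mass C.
Proof.
have L3 : L1 la (fun x => t * 2 `^ r * (`|phiK x| `^ r + (N `^ r)^-1 * `|Vp x| `^ r)).
  by apply: L1Z; apply: L1D => //; exact: L1Z.
have L4 : L1 la (fun x => t * 2 `^ p * (`|psiK x| `^ p + (N `^ p)^-1 * level_gradient x `^ p)).
  by apply: L1Z; apply: L1D => //; exact: L1Z.
rewrite (integral_add (L1D (L1D (L1D (L1Z t La1) (L1Z t Lb1)) L3) L4) L1_A).
rewrite (integral_add (L1D (L1D (L1Z t La1) (L1Z t Lb1)) L3) L4).
rewrite (integral_add (L1D (L1Z t La1) (L1Z t Lb1)) L3) (integral_add (L1Z t La1) (L1Z t Lb1)).
rewrite (integral_scale _ La1) (integral_scale _ Lb1).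
rewrite (integral_scale _ (L1D Lphi (L1Z (N `^ r)^-1 LVp))).
rewrite (integral_scale _ (L1D Lpsi (L1Z (N `^ p)^-1 L1_level_gradient))).
rewrite (integral_add Lphi (L1Z (N `^ r)^-1 LVp)).
rewrite (integral_add Lpsi (L1Z (N `^ p)^-1 L1_level_gradient)).
rewrite (integral_scale _ LVp) (integral_scale _ L1_level_gradient) integral_A.
have h1 : (N `^ r)^-1 * \int[la]_x (`|Vp x| `^ r) <= C.
  by rewrite ler_pdivrMl ?powR_gt0// mulrC; exact: sobolev_C.2.
have h2 : (N `^ p)^-1 * \int[la]_x (level_gradient x `^ p) <= 1.
  by rewrite ler_pdivrMl ?powR_gt0// mulr1.
have t0' := ltW t0; have tr q : 0 <= t * 2 `^ q by rewrite mulr_ge0 ?powR_ge0.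
rewrite /data_mass !(mulrDr t) mulr1 !mulrA lerD2r.
by apply: lerD; [rewrite lerD2l|]; apply: ler_wpM2l => //; rewrite lerD2l.
Qed.

Let kappa : R := osc_constant * (2 * N `^ p * t `^ (- e)).

Let kappa0 : 0 <= kappa.
Proof. by rewrite !mulr_ge0 ?powR_ge0. Qed.

Let phi := variation Omega u zeta s k i.
Let dphi := dvariation Omega u Du zeta s k i.

Let enorm_phi x : enorm (phi x) = Vp x.
Proof.
rewrite /phi /variation enormZ enorm_delta mulr1 normrM normrN s1 mul1r ger0_norm//.
by rewrite le_max lexx orbT.
Qed.

Let enorm_dphi x : enorm (dphi x) = level_gradient x.
Proof.
rewrite /enorm; congr Num.sqrt; apply: eq_bigr => j _.
rewrite big_ord1 (bigD1 i)//= big1 ?addr0 => [|l li].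
  by rewrite !mxE eqxx exprMn sqrrN -real_normK ?num_real// s1 expr1n mul1r.
by rewrite !mxE (negbTE li) expr0n.
Qed.

(** [far_point_oscillation] at almost every point, with the [S] and [T] that
    [oscillation_young] provides there. *)
Lemma oscillation_le_majorant : {ae la, forall x, 0 < ex x ->
  `|G x (u x + phi x) (Du x + dphi x) - G x (u x) (Du x)| <= kappa * majorant x}.
Proof.
case: aeG => Z [mZ Z0 HZ]; exists Z; split => // x /= Hx; apply: HZ => /= HG; apply: Hx => xp.
have Kx : K x by exact: AK.
have Ox : Omega x by exact: KO.
have m0 : (0 < m)%N by case: m i => // -[].
have ax0 := a0 Ox; have bx0 := b0 Ox.
have uE : enorm (u x) = value_norm x.
  by rewrite /value_norm; congr enorm; apply/rowP => l; rewrite !mxE /component patchE mem_set.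
have DE : enorm (Du x) = jacobian_norm x.
  by rewrite /jacobian_norm; congr enorm; apply/matrixP => j l; rewrite !mxE /dcomponent patchE mem_set.
have v0 : 0 <= value_norm x by exact: enorm_ge0.
have j0 : 0 <= jacobian_norm x by exact: enorm_ge0.
have V0 : 0 <= Vp x by rewrite le_max lexx orbT.
have g0 : 0 <= level_gradient x by exact: enorm_ge0.
have phiE : phiK x = 1 + 2 * value_norm x by rewrite /phiK indicE patchE !mem_set.
have psiE : psiK x = 1 + 2 * jacobian_norm x by rewrite /psiK indicE patchE !mem_set.
have aE : weight a x = a x + 1 by rewrite /weight patchE indicE !mem_set.
have bE : weight b x = b x + 1 by rewrite /weight patchE indicE !mem_set.
have a1 : 0 < a x + 1 by lra.
have b1 : 0 < b x + 1 by lra.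
have Ph1 : 1 <= phiK x + Vp x by rewrite phiE; lra.
have Ps1 : 1 <= psiK x + level_gradient x by rewrite psiE; lra.
have [S [T [HS HT HST]]] := oscillation_young a1 b1 alpha0 beta0 sigma10 sigma20 p0 r0 e0 e1
  E1 E2 aq bq N1 t0 t1 Ph1 Ps1.
have HG' s' s'' xi xi' : `|G x s' xi - G x s'' xi'| <=
    (a x + 1) * enorm (s' - s'') `^ alpha * (enorm xi + enorm xi' + 1) `^ q1 +
    (b x + 1) * (enorm s' + enorm s'' + 1) `^ q2 * enorm (xi - xi') `^ beta.
  apply: (le_trans (HG Ox _ _ _ _)); apply: lerD.
    by rewrite ler_wpM2r ?powR_ge0// ler_wpM2r ?powR_ge0// lerDl.
  by rewrite ler_wpM2r ?powR_ge0// ler_wpM2r ?powR_ge0// lerDl.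
have nS : 1 + enorm (u x + phi x) + enorm (u x) <= S.
  have := enormD (u x) (phi x); rewrite enorm_phi uE => H.
  by move: HS; rewrite phiE; lra.
have nT : 1 + enorm (Du x + dphi x) + enorm (Du x) <= T.
  have := enormD (Du x) (dphi x); rewrite enorm_dphi DE => H.
  by move: HT; rewrite psiE; lra.
apply: (le_trans (far_point_oscillation m0 n0 (ltW a1) (ltW b1) alpha0 beta0 HG' nS nT)).
rewrite /kappa -[leRHS]mulrA; apply: ler_wpM2l; first by rewrite mulr_ge0 ?powR_ge0.
apply: (le_trans HST); rewrite ler_wpM2l ?mulr_ge0 ?powR_ge0//.
rewrite /majorant aE bE (gtr0_norm a1) (gtr0_norm b1) indicE mem_set//.
have split2 (q y z : R) : 0 < q -> 0 <= y -> 0 <= z ->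
    t * ((y + z) / N) `^ q <= t * 2 `^ q * (`|y| `^ q + (N `^ q)^-1 * z `^ q).
  move=> q0 y0 z0; rewrite -mulrA ler_wpM2l ?(ltW t0)//.
  have -> : (N `^ q)^-1 * z `^ q = (z / N) `^ q.
    rewrite powRM ?invr_ge0 ?(ltW N0)// mulrC; congr (_ * _).
    by rewrite -(powR_inv1 (ltW N0)) powRAC powR_inv1 ?powR_ge0.
  have zN : 0 <= z / N by rewrite divr_ge0// ltW.
  apply: le_trans (powRD_le (ltW q0) (normr_ge0 y) zN).
  have yzN : 0 <= (y + z) / N by rewrite divr_ge0 ?(ltW N0)// addr_ge0.
  apply: (ge0_ler_powR (ltW q0)); rewrite ?nnegrE//; first by rewrite addr_ge0.
  by rewrite mulrDl lerD2r (ger0_norm y0) ler_piMr// invf_le1.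
have c1 : 0 <= phiK x by rewrite phiE; lra.
have c2 : 0 <= psiK x by rewrite psiE; lra.
rewrite lerD// lerD//; last exact: split2.
by rewrite lerD2l [`|Vp x|]ger0_norm//; exact: split2.
Qed.

(** The oscillation of the integrand contributes [N^p * t^(1-e)] up to a
    constant, and [N^p] is bounded by the energy itself. *)
Lemma cutoff_energy_le : cutoff_energy <= c * level_power +
  energy_constant C * (1 + cutoff_energy + c * level_power) * t `^ (1 - e).
Proof.
have Lkm : L1 la (fun x => kappa * majorant x) by exact: L1Z.
have m0 x : 0 <= majorant x.
  by rewrite /majorant !addr_ge0// ?mulr_ge0 ?powR_ge0 ?addr_ge0 ?mulr_ge0 ?invr_ge0 ?powR_ge0 ?(ltW t0)// indicE.
have LH : L1 la (fun x => if 0 < ex x then kappa * majorant x else 0).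
  apply: (L1_dom _ Lkm).
    apply: (measurable_excess_ite p1 Wu); [exact: tz| |exact: measurable_cst].
    exact: L1_measurable Lkm.
  move=> x; have km0 : 0 <= kappa * majorant x by rewrite mulr_ge0.
  by case: ifP => _; rewrite ?normr0 ?(ger0_norm km0).
have := @variation_energy R n m p Omega u Du p1 Wu zeta s k i tz (@cutoff_ge0 _ _ x0 rho ro)
  (@cutoff_le1 _ _ x0 rho ro) s1 G min_u c _ (fun x _ => zeta_grad x) LH oscillation_le_majorant.
move=> /le_trans; apply; rewrite lerD2l.
apply: (@le_trans _ _ (kappa * (t * data_mass C))).
  apply: (@le_trans _ _ (\int[la]_x (kappa * majorant x))).
    apply: integral_le => // x; case: ifP => // _.
    by rewrite mulr_ge0.
  by rewrite integral_scale// ler_wpM2l.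
have d0' := data_mass_ge0 C0.
have te : t `^ (1 - e) = t `^ (- e) * t.
  by rewrite addrC powRD ?(gt_eqF t0) ?implybT// powRr1// ltW.
rewrite /kappa /energy_constant te.
have -> : osc_constant * (2 * N `^ p * t `^ (- e)) * (t * data_mass C) =
  N `^ p * (osc_constant * 2 * data_mass C * (t `^ (- e) * t)) by ring.
have -> : osc_constant * 2 * 4 `^ p * data_mass C * (1 + cutoff_energy + c * level_power) *
    (t `^ (- e) * t) = (4 `^ p * (1 + cutoff_energy + c * level_power)) *
    (osc_constant * 2 * data_mass C * (t `^ (- e) * t)) by ring.
apply: ler_wpM2r N_le.
by rewrite !mulr_ge0 ?powR_ge0// ltW.
Qed.

End estimate.

Definition side_level (h : R) : set X :=
  [set x | Omega x /\ 0 < s * (u x ord0 i - k)] `&` eball x0 h.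

Lemma side_levelE : side_level ro = A.
Proof.
apply/seteqP; split=> x.
  move=> [[Ox wx] xr]; rewrite /A/= /ex /excess mulrCA pmulr_rgt0.
    by rewrite /component patchE mem_set.
  by rewrite cutoff_gt0.
move=> /(excess_gt0 tz (@cutoff_ge0 _ _ x0 rho ro))[Ox zx wx].
split; last by move: zx; rewrite cutoff_gt0.
by split => //; move: wx; rewrite /component patchE mem_set.
Qed.

Let energy_null : t = 0 -> cutoff_energy = 0.
Proof.
move=> tE; have A0 : la A = 0%E.
  by rewrite -[LHS]fineK ?ge0_fin_numE ?level_set_finite//; rewrite -/t tE.
rewrite /cutoff_energy /Rintegral.
have -> : (\int[la]_x (if 0 < ex x then zeta x * gradient_norm Omega Du i x `^ p else 0)%:E =
    \int[la]_(x in A) (zeta x * gradient_norm Omega Du i x `^ p)%:E)%E.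
  rewrite [RHS]integral_mkcond; apply: eq_integral => x _; rewrite patchE.
  have [xA|xA] := boolP (x \in A); first by move/set_mem : xA; rewrite /A/= => ->.
  by move: xA; rewrite notin_setE /A/= => /negP/negbTE ->.
rewrite (null_set_integral mA _ A0); [by []|].
apply: measurable_funTS; apply/measurable_EFinP.
apply: (measurable_funM _ (L1_measurable (L1_gradient_norm p1 Wu i))).
by apply: measurable_fun_Rn; exact: (test_measurable (test_functionS tz)).
Qed.

(** The factor [t^eps] is so small that half of the energy on the left absorbs
    the energy on the right; what is left of the power of [t] is [t^gam]. *)
Let absorbed_energy (C gam eps : R) : 0 <= C ->
  sobolev_bound n p r ((3 * d) ^+ n) C ->
  0 <= gam -> 1 - e = eps + gam -> t <= 1 ->
  energy_constant C * t `^ eps <= 2^-1 ->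
  cutoff_energy <= 3 * (c * level_power) + t `^ gam.
Proof.
move=> C0 HC gam0 eE t1 small.
have W0 : 0 <= c * level_power.
  by rewrite mulr_ge0// integral_pos// => x; case: ifP => // _; exact: powR_ge0.
have I0 : 0 <= cutoff_energy.
  by apply: integral_pos => x; case: ifP => // _; rewrite mulr_ge0 ?powR_ge0 ?cutoff_ge0.
have [t0|t0] := ltP 0 t; last first.
  rewrite energy_null; first by rewrite addr_ge0 ?powR_ge0// mulr_ge0.
  by apply/eqP; rewrite eq_le t0 fine_ge0.
have H := cutoff_energy_le C0 t0 t1 (excess_pos_sobolev HC).
have g1 : t `^ gam <= 1.
  by rewrite -[leRHS](powRr0 t); apply: ger_powR; rewrite ?t0.
have g0 : 0 <= t `^ gam by exact: powR_ge0.
set B := 1 + cutoff_energy + c * level_power in H.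
have B0 : 0 <= B by rewrite /B; lra.
have : energy_constant C * B * t `^ (1 - e) <= 2^-1 * (B * t `^ gam).
  rewrite eE powRD ?(gt_eqF t0) ?implybT//.
  have -> : energy_constant C * B * (t `^ eps * t `^ gam) =
    energy_constant C * t `^ eps * (B * t `^ gam) by ring.
  by rewrite ler_wpM2r// mulr_ge0.
have : B * t `^ gam <= t `^ gam + (cutoff_energy + c * level_power).
  have : (cutoff_energy + c * level_power) * t `^ gam <= cutoff_energy + c * level_power.
    by rewrite ler_piMr// addr_ge0.
  have -> : B * t `^ gam = t `^ gam + (cutoff_energy + c * level_power) * t `^ gam.
    by rewrite /B; ring.
  by rewrite lerD2l.
move: H; lra.
Qed.

(** On the inner ball the cutoff is at least [expR (-1)], which accounts for
    the factors [expR 1]. *)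
Lemma one_sided_caccioppoli (C gam eps tau : R) : 0 <= C ->
  sobolev_bound n p r ((3 * d) ^+ n) C ->
  0 <= gam -> 1 - e = eps + gam -> 0 <= eps -> (la (side_level ro) <= tau%:E)%E -> tau <= 1 ->
  energy_constant C * tau `^ eps <= 2^-1 ->
  (\int[la]_(x in side_level rho) (enorm (col i (Du x)) `^ p)%:E <=
   (expR 1 * (3 * cutoff_constant p) / (ro - rho) `^ p)%:E *
     \int[la]_(x in side_level ro) ((s * (u x ord0 i - k)) `^ p)%:E +
   (expR 1)%:E * la (side_level ro) `^ gam)%E.
Proof.
move=> C0 HC gam0 eE eps0 ttau tau1 small'.
have tt : t <= tau.
  by rewrite -lee_fin /t fineK -?side_levelE// side_levelE ge0_fin_numE// level_set_finite.
have t1 : t <= 1 by exact: le_trans tau1.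
have small : energy_constant C * t `^ eps <= 2^-1.
  apply: le_trans small'; apply: (ler_wpM2l (energy_constant_ge0 C0)).
  have t0 : 0 <= t by exact: fine_ge0.
  by apply: ge0_ler_powR; rewrite ?nnegrE// (le_trans t0).
have main := absorbed_energy C0 HC gam0 eE t1 small.
have expr0 : 0 <= expR 1 :> R by exact: expR_ge0.
have -> : (\int[la]_(x in side_level ro) ((s * (u x ord0 i - k)) `^ p)%:E = level_power%:E)%E.
  rewrite /level_power -Rintegral_EFin; last exact: L1_level.
  rewrite [LHS]integral_mkcond; apply: eq_integral => x _.
  rewrite side_levelE patchE; have [/set_mem xA|] := boolP (x \in A); last first.
    by rewrite notin_setE /A/= => /negP/negbTE ->.
  have [Ox _ wx] := excess_gt0 tz (@cutoff_ge0 _ _ x0 rho ro) xA.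
  move: (xA); rewrite /A/= => ->; congr (_ `^ p)%:E.
  rewrite -[RHS]mul1r -s1 -normrM gtr0_norm//.
  by rewrite /component patchE mem_set.
rewrite side_levelE.
have -> : la A = t%:E by rewrite /t fineK// ge0_fin_numE// level_set_finite.
rewrite poweR_EFin -!EFinM -EFinD.
apply: (@le_trans _ _ (expR 1 * cutoff_energy)%:E); last first.
  rewrite lee_fin; apply: (le_trans (ler_wpM2l expr0 main)).
  by rewrite mulrDr lerD2r /c le_eqVlt; apply/orP; left; apply/eqP; ring.
rewrite /cutoff_energy -integral_scale// -Rintegral_EFin; last exact: L1Z.
rewrite [leLHS]integral_mkcond.
have -> : (fun x => (enorm (col i (Du x)) `^ p)%:E) \_ (side_level rho) =
    fun x => (((fun x => enorm (col i (Du x)) `^ p) \_ (side_level rho)) x)%:E.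
  by apply/funext => x; rewrite !patchE; case: ifP.
apply: integral_ae_le_integrable; first exact: L1Z.
apply: aeW => x; rewrite patchE; case: ifPn => [/set_mem[[Ox wx] xr]|_]; last first.
  by rewrite mulr_ge0//; case: ifP => // _; rewrite mulr_ge0 ?powR_ge0 ?cutoff_ge0.
have xA : A x.
  by rewrite -side_levelE; split; [split|exact: lt_trans xr rhor].
move: (xA); rewrite /A/= => ->; rewrite (gradient_normE _ _ Ox) mulrA ler_peMl ?powR_ge0//.
have zx : expR (-1) <= zeta x by exact: cutoff_ge.
apply: (@le_trans _ _ (expR 1 * expR (-1))); first by rewrite -expRD subrr expR0.
by rewrite ler_wpM2l.
Qed.

End ball.

End one_sided.

(** * The theorem *)

Theorem theorem2 (R : realType) (n : nat) (p : R) (hn : (2 <= n)%N)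
    (hp1 : 1 < p) (hpn : p < n%:R) :
  (* chosen before all the other data: they depend on Sigma, p and n only *)
  exists C1 C2 : set 'rV[R]_n -> R,
    (forall Sigma, 0 < C1 Sigma /\ 0 < C2 Sigma) /\
  forall (m : nat) (Omega : set 'rV[R]_n)
    (G : 'rV[R]_n -> 'rV[R]_m -> 'M[R]_(n, m) -> R)
    (a b : 'rV[R]_n -> R) (q1 q2 alpha beta sigma1 sigma2 : R)
    (u : 'rV[R]_n -> 'rV[R]_m) (Du : 'rV[R]_n -> 'M[R]_(n, m)),
  let pstar := sobolev_exponent n p in
  (1 <= m)%N ->
  open Omega ->
  caratheodory_function Omega G ->
  {ae lebesgue n, forall x, Omega x ->
     forall (s1 s2 : 'rV[R]_m) (xi1 xi2 : 'M[R]_(n, m)),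
       `|G x s1 xi1 - G x s2 xi2| <=
         a x * enorm (s1 - s2) `^ alpha
             * (enorm xi1 + enorm xi2 + 1) `^ q1
       + b x * (enorm s1 + enorm s2 + 1) `^ q2
             * enorm (xi1 - xi2) `^ beta} ->
  q1 < p -> q2 < p ->
  0 < alpha -> alpha < Num.min 1 (p - q1) ->
  0 < beta -> beta < Num.min 1 (p - q2) ->
  Lp_loc Omega sigma1 a -> Lp_loc Omega sigma2 b ->
  (forall x, Omega x -> 0 <= a x) -> (forall x, Omega x -> 0 <= b x) ->
  p * pstar / ((pstar - alpha) * p - q1 * pstar) < sigma1 ->
  p * pstar / ((p - beta) * pstar - q2 * p) < sigma2 ->
  q1 / p + alpha / pstar + sigma1^-1 < p / n%:R ->
  beta / p + q2 / pstar + sigma2^-1 < p / n%:R ->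
  local_minimizer p Omega G u Du ->
  exists2 eps : R, 0 < eps &
  forall Sigma : set 'rV[R]_n, compact Sigma -> Sigma `<=` Omega ->
  exists2 R0 : R, 0 < R0 &
  forall (rho r : R) (x0 : 'rV[R]_n) (k : R) (i : 'I_m),
    0 < rho -> rho < r -> r < R0 -> Sigma x0 ->
    (\int[lebesgue n]_(x in superlevel Omega u i x0 k rho)
         (enorm (col i (Du x)) `^ p)%:E <=
       (C1 Sigma / (r - rho) `^ p)%:E *
         \int[lebesgue n]_(x in superlevel Omega u i x0 k r)
           ((u x ord0 i - k) `^ p)%:E
       + (C2 Sigma)%:E *
           lebesgue n (superlevel Omega u i x0 k r) `^ (1 - p / n%:R + eps))%E
    /\
    (\int[lebesgue n]_(x in sublevel Omega u i x0 k rho)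
         (enorm (col i (Du x)) `^ p)%:E <=
       (C1 Sigma / (r - rho) `^ p)%:E *
         \int[lebesgue n]_(x in sublevel Omega u i x0 k r)
           ((k - u x ord0 i) `^ p)%:E
       + (C2 Sigma)%:E *
           lebesgue n (sublevel Omega u i x0 k r) `^ (1 - p / n%:R + eps))%E.
Proof.
have n0 : (0 < n)%N by exact: leq_trans hn.
have p0 : 0 < p by exact: lt_trans hp1.
have nR : 0 < n%:R :> R by rewrite ltr0n.
exists (fun=> expR 1 * (3 * cutoff_constant p)), (fun=> expR 1); split.
  by move=> _; rewrite !mulr_gt0 ?expR_gt0 ?powR_gt0// ltr0n fact_gt0.
move=> m Omega G a b q1 q2 alpha beta sigma1 sigma2 u Du pstar m1 oO _ aeG q1p q2p
  al0 al be0 be La Lb a0 b0 s1 s2 h1 h2 min_u.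
have [al1 alq] : alpha < 1 /\ alpha + q1 <= p.
  by move: al; rewrite lt_min => /andP[? ?]; split => //; lra.
have [be1 beq] : beta < 1 /\ beta + q2 <= p.
  by move: be; rewrite lt_min => /andP[? ?]; split => //; lra.
have pnd : 0 < n%:R - p by rewrite subr_gt0.
have ps0 : 0 < pstar by rewrite divr_gt0 ?mulr_gt0.
have psV : pstar^-1 = p^-1 - n%:R^-1.
  by rewrite /pstar /sobolev_exponent; field; rewrite !gt_eqF.
have pps : p < pstar.
  by rewrite -(ltf_pV2) ?posrE// psV ltrBlDr ltrDl invr_gt0.
have q1a : q1 < p - alpha by move: al; rewrite lt_min => /andP[_]; lra.
have q2b : q2 < p - beta by move: be; rewrite lt_min => /andP[_]; lra.
have sig10 : 0 < sigma1.
  apply: lt_trans s1; apply: divr_gt0; first exact: mulr_gt0.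
  have k1 : q1 * pstar < (p - alpha) * pstar by rewrite ltr_pM2r.
  have k2 : 0 < alpha * (pstar - p) by rewrite mulr_gt0// subr_gt0.
  rewrite subr_gt0 (lt_trans k1)// -subr_gt0.
  by rewrite (_ : _ - _ = alpha * (pstar - p))//; ring.
have sig20 : 0 < sigma2.
  apply: lt_trans s2; apply: divr_gt0; first exact: mulr_gt0.
  have k1 : q2 * p < (p - beta) * p by rewrite ltr_pM2r.
  have pb : 0 < p - beta by lra.
  have k2 : 0 < (p - beta) * (pstar - p) by rewrite mulr_gt0// subr_gt0.
  rewrite subr_gt0 (lt_trans k1)// -subr_gt0.
  by rewrite (_ : _ - _ = (p - beta) * (pstar - p))//; ring.
(* the Sobolev inequality is available below the critical exponent only; [r] is
   so close to it that both smallness conditions persist *)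
pose g1 := p / n%:R - (q1 / p + alpha / pstar + sigma1^-1).
pose g2 := p / n%:R - (beta / p + q2 / pstar + sigma2^-1).
have g10 : 0 < g1 by rewrite subr_gt0.
have g20 : 0 < g2 by rewrite subr_gt0.
(* [q2] may be negative, but replacing [pstar^-1] by [pstar^-1 + del] costs at
   most [`|q2| * del] *)
pose del := Num.min (g1 / 2) (g2 / (2 * (`|q2| + 1))).
have q21 : 0 < `|q2| + 1 by rewrite ltr_wpDl.
have del0 : 0 < del by rewrite lt_min !divr_gt0// mulr_gt0.
pose r := (pstar^-1 + del)^-1.
have rV : r^-1 = pstar^-1 + del by rewrite invrK.
have r0 : 0 < r by rewrite invr_gt0 addr_gt0 ?invr_gt0.
have rps : r < (p^-1 - n%:R^-1)^-1.
  by rewrite -psV invrK -(ltf_pV2) ?posrE// rV ltrDl.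
pose e1 := q1 / p + alpha / r + sigma1^-1.
pose e2 := beta / p + q2 / r + sigma2^-1.
have pn1 : p / n%:R < 1 by rewrite ltr_pdivrMr// mul1r.
have pn0 : 0 < p / n%:R by rewrite divr_gt0.
have e1lt : e1 < p / n%:R.
  rewrite /e1 rV mulrDr.
  have : alpha * del <= g1 / 2.
    have d1 : del <= g1 / 2 by rewrite ge_min lexx.
    apply: le_trans d1; rewrite ler_piMl// ltW//.
  by rewrite /g1; lra.
have e2lt : e2 < p / n%:R.
  rewrite /e2 rV mulrDr.
  have : q2 * del <= g2 / 2.
    have d2 : del <= g2 / (2 * (`|q2| + 1)) by rewrite ge_min lexx orbT.
    apply: (@le_trans _ _ ((`|q2| + 1) * del)).
      by rewrite ler_wpM2r ?(ltW del0)// (le_trans (ler_norm _))// lerDl.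
    rewrite -ler_pdivlMl//; apply: (le_trans d2); rewrite le_eqVlt; apply/orP; left; apply/eqP.
    by field; rewrite gt_eqF.
  by rewrite /g2; lra.
pose e := Num.max 0 (Num.max e1 e2).
have e0 : 0 <= e by rewrite le_max lexx.
have ee1 : e1 <= e by rewrite !le_max lexx !orbT.
have ee2 : e2 <= e by rewrite !le_max lexx !orbT.
have elt : e < p / n%:R by rewrite !gt_max pn0 e1lt e2lt.
have ele1 : e <= 1 by exact: ltW (lt_trans elt pn1).
(* one half of the margin is spent on absorbing the energy, the other half is
   the gain in the exponent *)
pose eps := (p / n%:R - e) / 2.
have eps0 : 0 < eps by rewrite divr_gt0// subr_gt0.
have gamE : 1 - e = eps + (1 - p / n%:R + eps) by rewrite /eps; field; rewrite gt_eqF.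
have gam0 : 0 <= 1 - p / n%:R + eps.
  by apply: addr_ge0; [rewrite subr_ge0; exact: ltW|exact: ltW].
exists eps => // Sigma cS SO.
have [d [K [d0 cK KO SK]]] := exists_compact_neighbourhood oO cS SO.
have [C C0 HC] := @lebesgue_sobolev R n p r ((3 * d) ^+ n) n0 hp1 hpn r0 rps.
pose M := energy_constant p r Omega K u Du a b q1 q2 alpha beta sigma1 sigma2 C.
have M0 : 0 <= M by apply: energy_constant_ge0; exact: ltW.
(* below this measure the energy can be absorbed *)
pose tau := Num.min 1 ((2 * (M + 1))^-1 `^ eps^-1).
have M1 : 0 < 2 * (M + 1) by rewrite mulr_gt0// ltr_wpDl.
have tau0 : 0 < tau by rewrite lt_min ltr01 powR_gt0// invr_gt0.
have tau1 : tau <= 1 by rewrite ge_min lexx.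
have Mtau : M * tau `^ eps <= 2^-1.
  have : tau `^ eps <= (2 * (M + 1))^-1.
    have -> : (2 * (M + 1))^-1 = ((2 * (M + 1))^-1 `^ eps^-1) `^ eps.
      by rewrite -powRrM mulVf ?gt_eqF// powRr1// invr_ge0 ltW.
    apply: ge0_ler_powR; rewrite ?nnegrE ?(ltW eps0) ?(ltW tau0) ?powR_ge0//.
    by rewrite ge_min lexx orbT.
  move=> /(ler_wpM2l M0) /le_trans; apply.
  by rewrite ler_pdivrMr// mulrA mulVf// mul1r lerDl.
exists (Num.min d (tau / 3)); first by rewrite lt_min d0 divr_gt0.
move=> rho ro x0 k i rho0 rhor; rewrite lt_min => /andP[rod rotau] Sx0.
have ro0 : 0 < ro by exact: lt_trans rhor.
have sub : ceball x0 ro `<=` K.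
  by move=> x xr; apply: (SK x0 Sx0); apply: le_trans (ltW rod).
have small (s : R) : (lebesgue n (side_level Omega u x0 s k i ro) <= tau%:E)%E.
  apply: (@le_trans _ _ ((3 * ro) ^+ n)%:E).
    apply: le_trans (lebesgue_ceball x0 ro0).
    rewrite -lebesgueE; last by apply: closed_measurable_rV; exact: closed_ceball (ltW ro0).
    apply: (le_outer_measure (mu_ext (@borel_lebesgue R n))) => x [_].
    exact: ltW.
  have r3 : 3 * ro <= tau by rewrite mulrC -ler_pdivlMr// ltW.
  have r30 : 0 <= 3 * ro by rewrite mulr_ge0// ltW.
  rewrite lee_fin (le_trans _ r3)// -[leRHS]expr1.
  by apply: ler_wiXn2l => //; exact: le_trans tau1.
have side (s : R) : `|s| = 1 -> _ := fun s1' =>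
  @one_sided_caccioppoli R n m p r e Omega K d u Du G a b q1 q2 alpha beta sigma1 sigma2
  n0 hp1 hpn r0 rps oO cK KO d0 min_u aeG al0 be0 sig10 sig20 La Lb a0 b0 e0 ele1 ee1 ee2
  alq beq x0 rho ro s k i rho0 rhor s1' sub (ltW rod) C (1 - p / n%:R + eps) eps tau (ltW C0) HC
  gam0 gamE (ltW eps0) (small s) tau1 Mtau.
have upE h : superlevel Omega u i x0 k h = side_level Omega u x0 1 k i h.
  by apply/seteqP; split => x [[Ox ux] xh]; split => //; split => //; move: ux; rewrite mul1r subr_gt0.
have downE h : sublevel Omega u i x0 k h = side_level Omega u x0 (-1) k i h.
  by apply/seteqP; split => x [[Ox ux] xh]; split => //; split => //; move: ux;
    rewrite mulN1r opprB subr_gt0.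
split.
  rewrite !upE; have := side 1 (normr1 R).
  by under [in X in (_ <= X)%E -> _]eq_integral do rewrite mul1r.
rewrite !downE; have := side (-1) (normrN1 R).
by under [in X in (_ <= X)%E -> _]eq_integral do rewrite mulN1r opprB.
Qed.
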